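(* There exists a polynomial-time $O(1)$-approximation algorithm for the $O$-facility location problem for arbitrary $O$.
   Context: An instance of the $O$-facility location problem consists of a finite set $F$ of facilities, a finite set $D$ of clients, a metric $c$ on $F\cup D$, opening costs $f:F\to\mathbb{Q}_{\ge 0}$, and an arbitrary subset $O\subseteq F$ (given as part of the input). A feasible solution is a set $S\subseteq F$ of open facilities together with an assignment $\sigma:D\to S$ such that for every $i\in S$, $|\sigma^{-1}(i)|$ is odd if $i\in O$ and even if $i\notin O$. Its cost is $f(S)+\sum_{j\in D}c(\sigma(j),j)$; the goal is to minimize the cost. An $\alpha$-approximation algorithm is a polynomial-time algorithm that, on every instance admitting a feasible solution, outputs a feasible solution of cost at most $\alpha$ times the optimum; an $O(1)$-approximation algorithm is an $\alpha$-approximation algorithm for some constant $\alpha$. *)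

(* Defs.v *)
From mathcomp Require Import all_boot all_order all_algebra.

Set Implicit Arguments.
Unset Strict Implicit.
Unset Printing Implicit Defensive.

Import Order.TTheory GRing.Theory Num.Theory.
Local Open Scope ring_scope.

(** * Algorithms and running time

  The model of computation is first-order Lisp over binary trees (the language
  F of N. D. Jones, "Computability and Complexity from a Programming
  Perspective", with local definitions added).  A program is a finite list of
  mutually recursive one-argument functions, evaluated call by value; every
  evaluation rule costs one unit of time.  Every rule does a bounded number of
  operations on pointers to shared, immutable cons cells, so that a run of
  cost [t] is simulated by a Turing machine in time polynomial in [t] and the
  size of the input; conversely a Turing machine is simulated with constant
  overhead, a tape being a pair of lists.  Polynomial time in this model is
  therefore the usual polynomial time. *)

Inductive tree : Type :=
| Leaf
| Node of tree & tree.

Fixpoint tree_size (v : tree) : nat :=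
  if v is Node l r then (tree_size l + tree_size r).+1 else 1%N.

Definition tree_hd (v : tree) : tree := if v is Node l _ then l else Leaf.
Definition tree_tl (v : tree) : tree := if v is Node _ r then r else Leaf.

(** Variables are de Bruijn indices into the environment: [ELet e1 e2] pushes
    the value of [e1] for the evaluation of [e2]. *)
Inductive expr : Type :=
| EVar of nat
| ELeaf
| ENode of expr & expr
| EHd of expr
| ETl of expr
| EIf of expr & expr & expr
| ELet of expr & expr
| ECall of nat & expr.

Definition program : Type := seq expr.

(** [eval P env e v t]: in the environment [env], the expression [e] evaluates
    to [v] in time [t].  In a conditional, [Leaf] is false and every [Node] is
    true.  The body of a function sees its argument only, as variable 0. *)
Inductive eval (P : program) : seq tree -> expr -> tree -> nat -> Prop :=
| eval_var env x :
    eval P env (EVar x) (nth Leaf env x) 1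
| eval_leaf env :
    eval P env ELeaf Leaf 1
| eval_node env e1 e2 v1 v2 t1 t2 :
    eval P env e1 v1 t1 -> eval P env e2 v2 t2 ->
    eval P env (ENode e1 e2) (Node v1 v2) (t1 + t2).+1
| eval_hd env e v t :
    eval P env e v t -> eval P env (EHd e) (tree_hd v) t.+1
| eval_tl env e v t :
    eval P env e v t -> eval P env (ETl e) (tree_tl v) t.+1
| eval_if_true env e e1 e2 l r v t t1 :
    eval P env e (Node l r) t -> eval P env e1 v t1 ->
    eval P env (EIf e e1 e2) v (t + t1).+1
| eval_if_false env e e1 e2 v t t2 :
    eval P env e Leaf t -> eval P env e2 v t2 ->
    eval P env (EIf e e1 e2) v (t + t2).+1
| eval_let env e1 e2 v1 v2 t1 t2 :
    eval P env e1 v1 t1 -> eval P (v1 :: env) e2 v2 t2 ->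
    eval P env (ELet e1 e2) v2 (t1 + t2).+1
| eval_call env g e v w t1 t2 :
    eval P env e v t1 -> eval P [:: v] (nth ELeaf P g) w t2 ->
    eval P env (ECall g e) w (t1 + t2).+1.

Lemma eval_deterministic P env e v1 t1 v2 t2 :
  eval P env e v1 t1 -> eval P env e v2 t2 -> v1 = v2 /\ t1 = t2.
Proof.
move=> ev1; elim: ev1 v2 t2 => {env e v1 t1}; intros;
  match goal with H : eval _ _ _ ?v ?t |- _ = ?v /\ _ = ?t => inversion H; subst end;
  repeat match goal with
    IH : forall v t, eval _ ?env ?e v t -> _, H : eval _ ?env ?e _ _ |- _ =>
      case: (IH _ _ H) => ? ?; clear H; subst; try discriminate
  end; by [].
Qed.

(** The entry point of a program is its first function. *)
Definition runs (P : program) (input output : tree) (t : nat) : Prop :=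
  eval P [:: input] (nth ELeaf P 0) output t.

(** * The facility location problem with parity constraints *)

Definition is_metric (T : Type) (d : T -> T -> rat) : Prop :=
  [/\ forall x y, 0 <= d x y,
      forall x y, d x y = 0 <-> x = y,
      forall x y, d x y = d y x
    & forall x y z, d x z <= d x y + d y z].

(** The points of F ∪ D are numbered; F and D may overlap.  Distances are
    rational, as they are part of the input of an algorithm. *)
Record instance : Type := Instance {
  npoints : nat;
  facilities : {set 'I_npoints};
  clients : {set 'I_npoints};
  odd_facilities : {set 'I_npoints};
  dist : 'I_npoints -> 'I_npoints -> rat;
  opening_cost : 'I_npoints -> rat; (* meaningful on [facilities] only *)
  points_cover : facilities :|: clients = [set: 'I_npoints];
  odd_facilities_sub : odd_facilities \subset facilities;
  dist_metric : is_metric dist;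
  opening_cost_ge0 : forall i, i \in facilities -> 0 <= opening_cost i
}.

Record solution (I : instance) : Type := Solution {
  opened : {set 'I_(npoints I)};
  assign : {ffun 'I_(npoints I) -> 'I_(npoints I)} (* meaningful on [clients I] only *)
}.

Definition feasible (I : instance) (s : solution I) : Prop :=
  [/\ opened s \subset facilities I,
      forall j, j \in clients I -> assign s j \in opened s
    & forall i, i \in opened s ->
        odd #|[set j in clients I | assign s j == i]| = (i \in odd_facilities I)].

Definition cost (I : instance) (s : solution I) : rat :=
  \sum_(i in opened s) opening_cost i
  + \sum_(j in clients I) dist (assign s j) j.

Definition optimal (I : instance) (s : solution I) : Prop :=
  feasible s /\ forall s' : solution I, feasible s' -> cost s <= cost s'.

(** * Encodings

  Numbers are written in binary, least significant bit first and without
  leading zeros, so that the size of an encoding is linear in the usual bit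
  length. *)

Definition enc_bool (b : bool) : tree := if b then Node Leaf Leaf else Leaf.

Definition enc_seq (s : seq tree) : tree := foldr Node Leaf s.

Definition enc_nat (n : nat) : tree :=
  enc_seq (mkseq (fun i => enc_bool (odd (n %/ 2 ^ i)%N)) (up_log 2 n.+1)).

(** The sign is omitted: only nonnegative rationals are encoded. *)
Definition enc_rat (x : rat) : tree :=
  Node (enc_nat `|numq x|%N) (enc_nat `|denq x|%N).

Definition enc_set (n : nat) (A : {set 'I_n}) : tree :=
  enc_seq [seq enc_bool (i \in A) | i <- enum 'I_n].

Definition enc_instance (I : instance) : tree :=
  enc_seq
    [:: enc_set (facilities I);
        enc_set (clients I);
        enc_set (odd_facilities I);
        enc_seq [seq enc_rat (opening_cost i) | i <- enum (facilities I)];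
        enc_seq [seq enc_seq [seq enc_rat (dist x y) | y <- enum 'I_(npoints I)]
                | x <- enum 'I_(npoints I)]].

Definition enc_solution (I : instance) (s : solution I) : tree :=
  Node (enc_set (opened s))
       (enc_seq [seq enc_nat (assign s j) | j <- enum (clients I)]).

(** * Approximation algorithms *)

(** The program halts on every instance, feasible or not, within a number of
    steps polynomial in the size of the encoded instance. *)
Definition polynomial_time (P : program) : Prop :=
  exists a k : nat, forall I : instance, exists (v : tree) (t : nat),
    runs P (enc_instance I) v t
    /\ (t <= a * tree_size (enc_instance I) ^ k + a)%N.

Definition approximation_algorithm (alpha : rat) (P : program) : Prop :=
  polynomial_time P
  /\ forall I : instance, (exists s : solution I, feasible s) ->
       exists (s : solution I) (t : nat),
         [/\ runs P (enc_instance I) (enc_solution s) t,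
             feasible s
           & forall s_opt : solution I, optimal s_opt ->
               cost s <= alpha * cost s_opt].

(* Main.v *)
Require Import Defs.
From mathcomp Require Import all_boot all_order all_algebra.
From mathcomp Require Import zify.

(* Multiplying by a common denominator makes all costs integral.  First open
   facilities regardless of parity, with the greedy algorithm of Mettu and
   Plaxton for uncapacitated facility location, and assign every client to the
   nearest open facility; let W be the set of open facilities of wrong parity.

   Parities are corrected along a W-join in the complete graph on the
   facilities with an additional root.  An edge {i, k} of the join stands for
   moving one client between i and k and costs d(i, k).  An edge {i, root},
   available for i in O only, stands for toggling i: opening it if it is
   closed, and otherwise closing it by moving all its clients to the target
   that is cheapest, opening costs included.  The first assignment and an
   optimal solution, drawn on top of each other, give a join whose cost is
   bounded by a constant times the optimum.  The primal-dual method of Goemans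
   and Williamson finds a forest containing a W-join that is at most 4 times as
   expensive as any W-join; the factor is 4 instead of 2 because the dual
   variables are rounded down to integers, which loses one unit per edge of the
   join.  Rooting the forest and carrying a token from every facility of W
   towards the roots, eliminating leaves first, extracts this join while every
   facility gains at most two clients, so that closing a facility costs at most
   3 times as much as it did for the first assignment.

   The running time is bounded compositionally: the functions computed by
   polynomial-time programs contain the basic operations on lists and binary
   numbers and are closed under composition and under left folds whose
   intermediate states stay of polynomial size. *)

Set Implicit Arguments.
Unset Strict Implicit.
Unset Printing Implicit Defensive.

(** The output opens exactly the facilities that receive clients. Feasibility then says that every
    load is zero or has the right parity, and only a facility of [O] can choose between two
    parities, a zero load and an odd one; this is why root edges exist for [O] alone. The obstacle
    is the price of closing. It depends on where the clients go, and the receiving facility must end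
    with a correct parity as well. An even batch of clients may go to a facility of the first
    assignment or to an even facility, but not to a closed odd one, which would become open with an
    even load. An optimum may nevertheless replace a facility by exactly such an odd one, and the
    comparison join has to be modified there. Several facilities may also choose to close into one
    another, although each is priced separately. Dual variables are rounded because an edge with two
    active ends becomes tight at half its residual cost: exact arithmetic could double the
    denominators at every step, whereas rounded numbers stay integral and bounded by the input
    costs. *)

Lemma leq_expl m n k : m <= n -> m ^ k <= n ^ k.
Proof. by case: k => // k le_mn; rewrite leq_exp2r. Qed.

(** * Polynomial-time functions *)

(** One constant serves as offset and as exponent, so that a bound has a single witness;
    [poly_boundedI] converts from two separate constants. *)
Definition poly_bounded (X : Type) (s g : X -> nat) : Prop :=
  exists k, forall x, g x <= (s x + k) ^ k.

Section PolyBounded.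
Variables (X : Type) (s : X -> nat).
Implicit Types g h : X -> nat.

Lemma poly_boundedI a b g :
  (forall x, g x <= (s x + a) ^ b) -> poly_bounded s g.
Proof.
move=> le_g; exists (a + b).+1 => x; apply: (leq_trans (le_g x)).
apply: (@leq_trans ((s x + (a + b).+1) ^ b)); first by apply: leq_expl; lia.
by rewrite leq_pexp2l //; lia.
Qed.

Lemma poly_bounded_le h g :
  poly_bounded s h -> (forall x, g x <= h x) -> poly_bounded s g.
Proof. by case=> k hk le_gh; exists k => x; apply: leq_trans (hk x). Qed.

Lemma poly_bounded_self : poly_bounded s s.
Proof. by exists 1 => x; rewrite expn1 leq_addr. Qed.

Lemma poly_bounded_const c : poly_bounded s (fun=> c).
Proof. by apply: (@poly_boundedI c 1) => x; rewrite expn1 leq_addl. Qed.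

Lemma poly_boundedD g h :
  poly_bounded s g -> poly_bounded s h -> poly_bounded s (fun x => g x + h x).
Proof.
case=> k gk [l hl]; apply: (@poly_boundedI (k + l + 2) (k + l).+1) => x.
set m := s x + _; have m1 : 1 < m by rewrite /m; lia.
have gle : g x <= m ^ (k + l).
  apply: (leq_trans (gk x)); apply: (@leq_trans (m ^ k)).
    by apply: leq_expl; rewrite /m; lia.
  by rewrite leq_pexp2l ?leq_addr //; lia.
have hle : h x <= m ^ (k + l).
  apply: (leq_trans (hl x)); apply: (@leq_trans (m ^ l)).
    by apply: leq_expl; rewrite /m; lia.
  by rewrite leq_pexp2l ?leq_addl //; lia.
apply: (leq_trans (leq_add gle hle)); rewrite addnn -mul2n expnS.
by rewrite leq_mul2r m1 orbT.
Qed.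

Lemma poly_boundedM g h :
  poly_bounded s g -> poly_bounded s h -> poly_bounded s (fun x => g x * h x).
Proof.
case=> k gk [l hl]; apply: (@poly_boundedI (k + l) (k + l)) => x.
rewrite expnD leq_mul //.
  apply: (leq_trans (gk x)).
  by apply: leq_expl; lia.
apply: (leq_trans (hl x)).
by apply: leq_expl; lia.
Qed.

Lemma poly_boundedS g : poly_bounded s g -> poly_bounded s (fun x => (g x).+1).
Proof.
move=> bg; apply: poly_bounded_le (poly_boundedD bg (poly_bounded_const 1)) _.
by move=> x; rewrite addn1.
Qed.

Lemma poly_bounded_exp g l :
  poly_bounded s g -> poly_bounded s (fun x => g x ^ l).
Proof.
move=> bg; elim: l => [|l IH]; first exact: (poly_bounded_const 1).
apply: poly_bounded_le (poly_boundedM bg IH) _ => x; exact: eq_leq (expnS _ _).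
Qed.

Lemma poly_bounded_trans g h :
  poly_bounded s g -> poly_bounded g h -> poly_bounded s h.
Proof.
move=> bg [l hl]; apply: poly_bounded_le hl.
by apply: poly_bounded_exp; apply: poly_boundedD bg (poly_bounded_const l).
Qed.

End PolyBounded.

Lemma poly_bounded_comp (X Y : Type) (f : X -> Y) (s g : Y -> nat) :
  poly_bounded s g -> poly_bounded (s \o f) (g \o f).
Proof. by case=> k gk; exists k => x /=. Qed.

(** * Linking of programs *)

Fixpoint closed_expr (m : nat) (e : expr) : bool :=
  match e with
  | EVar _ | ELeaf => true
  | EHd e | ETl e => closed_expr m e
  | ENode e1 e2 | ELet e1 e2 => closed_expr m e1 && closed_expr m e2
  | EIf e e1 e2 => [&& closed_expr m e, closed_expr m e1 & closed_expr m e2]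
  | ECall g e => (g < m) && closed_expr m e
  end.

(** A call beyond the table runs the default body [ELeaf]. After relocation into a larger program
    such an index could hit foreign code, so linking is restricted to closed programs. *)
Definition closed_program (P : program) : bool :=
  (0 < size P) && all (closed_expr (size P)) P.

Fixpoint shift_calls (d : nat) (e : expr) : expr :=
  match e with
  | EVar x => EVar x
  | ELeaf => ELeaf
  | EHd e => EHd (shift_calls d e)
  | ETl e => ETl (shift_calls d e)
  | ENode e1 e2 => ENode (shift_calls d e1) (shift_calls d e2)
  | ELet e1 e2 => ELet (shift_calls d e1) (shift_calls d e2)
  | EIf e e1 e2 => EIf (shift_calls d e) (shift_calls d e1) (shift_calls d e2)
  | ECall g e => ECall (d + g) (shift_calls d e)
  end.

Definition shift_program (d : nat) (P : program) : program :=
  map (shift_calls d) P.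

Lemma closed_expr_shift d m n e :
  closed_expr m e -> d + m <= n -> closed_expr n (shift_calls d e).
Proof.
move=> + le_n; elim: e => //=.
- by move=> e1 IH1 e2 IH2 /andP[/IH1-> /IH2->].
- by move=> e IH e1 IH1 e2 IH2 /and3P[/IH-> /IH1-> /IH2->].
- by move=> e1 IH1 e2 IH2 /andP[/IH1-> /IH2->].
- by move=> g e IH /andP[ltg /IH->]; rewrite andbT; lia.
Qed.

Lemma eval_link P pre post env e v t :
  closed_program P -> closed_expr (size P) e -> eval P env e v t ->
  eval (pre ++ shift_program (size pre) P ++ post) env
       (shift_calls (size pre) e) v t.
Proof.
move=> clP cle ev; elim: ev cle => {env e v t} /=; try by constructor.
- by move=> env e1 e2 v1 v2 t1 t2 _ IH1 _ IH2 /andP[/IH1 ? /IH2 ?]; constructor.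
- by move=> env e v t _ IH /IH ?; constructor.
- by move=> env e v t _ IH /IH ?; constructor.
- move=> env e e1 e2 l r v t t1 _ IH _ IH1 /and3P[/IH ? /IH1 ? _].
  exact: (@eval_if_true _ _ _ _ _ l r).
- by move=> env e e1 e2 v t t2 _ IH _ IH2 /and3P[/IH ? _ /IH2 ?]; constructor.
- by move=> env e1 e2 v1 v2 t1 t2 _ IH1 _ IH2 /andP[/IH1 ? /IH2 ?];
    apply: (@eval_let _ _ _ _ v1).
- move=> env g e v w t1 t2 _ IH1 _ IH2 /andP[ltg /IH1 ev1].
  apply: (eval_call ev1); rewrite nth_cat ifN -?leqNgt ?leq_addr // addKn.
  rewrite nth_cat size_map ltg (nth_map ELeaf) //; apply: IH2.
  by case/andP: clP => _ /(all_nthP ELeaf); apply.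
Qed.

Lemma eval_link_call P pre post env e v w t1 t2 :
  closed_program P ->
  eval (pre ++ shift_program (size pre) P ++ post) env e v t1 ->
  eval P [:: v] (nth ELeaf P 0) w t2 ->
  eval (pre ++ shift_program (size pre) P ++ post) env
       (ECall (size pre) e) w (t1 + t2).+1.
Proof.
move=> clP ev1 ev2; apply: (eval_call ev1).
rewrite nth_cat ltnn subnn nth_cat size_map; case/andP: (clP) => gt0 /(all_nthP ELeaf) clA.
rewrite gt0 (nth_map ELeaf) //; apply: eval_link => //.
exact: clA.
Qed.

(** * Encoded types and polynomial-time functions between them *)

Record etype := EType { ecar :> Type; enc : ecar -> tree }.
Arguments enc {e} x : rename.

Canonical nat_etype := EType enc_nat.
Canonical bool_etype := EType enc_bool.
Canonical unit_etype := EType (fun _ : unit => Leaf).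
Canonical tree_etype := EType (@id tree).
Canonical prod_etype (X Y : etype) :=
  EType (fun p : X * Y => Node (enc p.1) (enc p.2)).
Canonical seq_etype (X : etype) := EType (fun s : seq X => enc_seq (map enc s)).

Definition sz (X : etype) (x : X) : nat := tree_size (enc x).

(** The bound on the output size does not follow from the bound on the time: subtrees are shared, so
    [ENode] applied to one variable twice doubles a tree in constant time. Composition needs the
    size bound, because the second program is timed in the size of the first output. *)
Definition polytime (X Y : etype) (f : X -> Y) : Prop :=
  exists (P : program) (T : X -> nat),
    [/\ closed_program P,
        forall x, eval P [:: enc x] (nth ELeaf P 0) (enc (f x)) (T x),
        poly_bounded (@sz X) T
      & poly_bounded (@sz X) (fun x => sz (f x))].

Lemma tree_size_gt0 v : 0 < tree_size v. Proof. by case: v. Qed.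

Lemma sz_gt0 (X : etype) (x : X) : 0 < sz x. Proof. exact: tree_size_gt0. Qed.

Lemma sz_pair (X Y : etype) (x : X) (y : Y) : sz (x, y) = (sz x + sz y).+1.
Proof. by []. Qed.

Lemma sz_nil (X : etype) : sz ([::] : seq X) = 1. Proof. by []. Qed.

Lemma sz_cons (X : etype) (x : X) (s : seq X) : sz (x :: s) = (sz x + sz s).+1.
Proof. by []. Qed.

Lemma sz_cat (X : etype) (s1 s2 : seq X) : sz (s1 ++ s2) <= sz s1 + sz s2.
Proof. elim: s1 => [|x s1 IH] //=; rewrite ?sz_cons ?sz_nil; lia. Qed.

Lemma sz_rcons (X : etype) (x : X) (s : seq X) : sz (rcons s x) = (sz x + sz s).+1.
Proof. elim: s => [|y s IH] //=; rewrite !sz_cons ?IH; lia. Qed.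

Lemma sz_take (X : etype) k (s : seq X) : sz (take k s) <= sz s.
Proof.
elim: s k => [|x s IH] [|k] //=; rewrite ?sz_cons ?sz_nil //.
by move: (IH k); lia.
Qed.

Lemma size_le_sz (X : etype) (s : seq X) : size s <= sz s.
Proof. elim: s => //= x s IH; rewrite sz_cons; lia. Qed.

Lemma sz_bool (b : bool) : sz b <= 3. Proof. by case: b. Qed.

Lemma polytime_enc (X Y Z : etype) (f : X -> Y) (g : X -> Z) :
  (forall x, enc (g x) = enc (f x)) -> polytime f -> polytime g.
Proof.
move=> efg [P [T [clP evP bT bf]]]; exists P, T; split=> //.
  by move=> x; rewrite efg.
by apply: poly_bounded_le bf _ => x; rewrite /sz efg.
Qed.

Lemma polytime_ext (X Y : etype) (f g : X -> Y) :
  f =1 g -> polytime f -> polytime g.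
Proof. by move=> efg; apply: polytime_enc => x; rewrite efg. Qed.

Lemma polytime_sz (X Y : etype) (f : X -> Y) :
  polytime f -> poly_bounded (@sz X) (fun x => sz (f x)).
Proof. by case=> [P [T []]]. Qed.

Lemma polytime_expr (X Y : etype) (f : X -> Y) e (T : X -> nat) :
  closed_expr 1 e -> (forall P x, eval P [:: enc x] e (enc (f x)) (T x)) ->
  poly_bounded (@sz X) T -> poly_bounded (@sz X) (fun x => sz (f x)) ->
  polytime f.
Proof.
move=> cle eve bT bf; exists [:: e], T; split=> //.
by rewrite /closed_program /= cle.
Qed.

(** Different types may share trees, and the identity program converts between them: numbers and
    lists of bits, or nested pairs ending in [unit] and lists of trees. *)
Lemma polytime_recode (X Y : etype) (f : X -> Y) :
  (forall x, enc (f x) = enc x) -> polytime f.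
Proof.
move=> ef; apply: (@polytime_expr _ _ _ (EVar 0) (fun=> 1)) => //.
- by move=> P x; rewrite ef; apply: eval_var.
- exact: poly_bounded_const.
- by apply: poly_bounded_le (poly_bounded_self _) _ => x; rewrite /sz ef.
Qed.

Lemma polytime_id (X : etype) : polytime (fun x : X => x).
Proof. exact: polytime_recode. Qed.

Fixpoint quote (v : tree) : expr :=
  if v is Node l r then ENode (quote l) (quote r) else ELeaf.

Lemma polytime_const (X Y : etype) (y : Y) : polytime (fun _ : X => y).
Proof.
have [t ev] : exists t, forall P env, eval P env (quote (enc y)) (enc y) t.
  elim: (enc y) => [|l [tl IHl] r [tr IHr]] /=; first by exists 1; constructor.
  by exists (tl + tr).+1 => P env; constructor.
apply: (@polytime_expr _ _ _ (quote (enc y)) (fun=> t)) => //.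
- by elim: (enc y) => //= l -> r ->.
- exact: poly_bounded_const.
- exact: poly_bounded_const.
Qed.

Lemma polytime_comp (X Y Z : etype) (f : X -> Y) (g : Y -> Z) :
  polytime g -> polytime f -> polytime (fun x => g (f x)).
Proof.
case=> [Q [U [clQ evQ bU bg]]] [P [T [clP evP bT bf]]].
pose pre := [:: ECall (1 + size P) (ECall 1 (EVar 0))].
pose prg := pre ++ shift_program 1 P ++ shift_program (1 + size P) Q.
have sprg : size prg = (size P + size Q).+1 by rewrite size_cat size_cat !size_map.
exists prg, (fun x => ((1 + T x).+1 + U (f x)).+1); split.
- case/andP: (clP) => P0 clPa; case/andP: (clQ) => Q0 clQa.
  rewrite /closed_program sprg /= all_cat /shift_program !all_map.
  do ?[apply/andP; split] => //; try lia.
    by apply: sub_all clPa => e /= /closed_expr_shift; apply; lia.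
  by apply: sub_all clQa => e /= /closed_expr_shift; apply; lia.
- move=> x; have ev1 : eval prg [:: enc x] (ECall 1 (EVar 0)) (enc (f x)) (1 + T x).+1.
    by apply: (@eval_link_call P pre _ _ _ _ _ _ _ clP _ (evP x)); apply: eval_var.
  have -> : nth ELeaf prg 0 = ECall (1 + size P) (ECall 1 (EVar 0)) by [].
  rewrite /prg catA -[shift_program (1 + size P) Q]cats0.
  have -> : 1 + size P = size (pre ++ shift_program 1 P) by rewrite size_cat size_map.
  apply: eval_link_call => //; move: ev1; rewrite /prg catA cats0.
  by rewrite size_cat size_map.
- apply: poly_boundedS; apply: poly_boundedD.
    by apply: poly_boundedS; apply: poly_boundedD bT; apply: poly_bounded_const.
  by apply: poly_bounded_trans bf _; apply: (poly_bounded_comp f bU).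
- by apply: poly_bounded_trans bf _; apply: (poly_bounded_comp f bg).
Qed.

Lemma polytime_pair (X Y Z : etype) (f : X -> Y) (g : X -> Z) :
  polytime f -> polytime g -> polytime (fun x => (f x, g x)).
Proof.
case=> [P [T [clP evP bT bf]]] [Q [U [clQ evQ bU bg]]].
pose pre := [:: ENode (ECall 1 (EVar 0)) (ECall (1 + size P) (EVar 0))].
pose prg := pre ++ shift_program 1 P ++ shift_program (1 + size P) Q.
have sprg : size prg = (size P + size Q).+1 by rewrite size_cat size_cat !size_map.
exists prg, (fun x => ((1 + T x).+1 + (1 + U x).+1).+1); split.
- case/andP: (clP) => P0 clPa; case/andP: (clQ) => Q0 clQa.
  rewrite /closed_program sprg /= all_cat /shift_program !all_map.
  do ?[apply/andP; split] => //; try lia.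
    by apply: sub_all clPa => e /= /closed_expr_shift; apply; lia.
  by apply: sub_all clQa => e /= /closed_expr_shift; apply; lia.
- move=> x; apply: eval_node.
    by apply: (@eval_link_call P pre _ _ _ _ _ _ _ clP _ (evP x)); apply: eval_var.
  rewrite /prg catA -[shift_program (1 + size P) Q]cats0.
  have -> : 1 + size P = size (pre ++ shift_program 1 P) by rewrite size_cat size_map.
  by apply: (eval_link_call clQ _ (evQ x)); apply: eval_var.
- apply: poly_boundedS; apply: poly_boundedD; apply: poly_boundedS;
    by apply: poly_boundedD => //; apply: poly_bounded_const.
- by apply: poly_boundedS; apply: poly_boundedD.
Qed.

Lemma polytime_comp2 (X Y Z W : etype) (op : Y -> Z -> W) (f : X -> Y) (g : X -> Z) :
  polytime (fun p : Y * Z => op p.1 p.2) -> polytime f -> polytime g ->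
  polytime (fun x => op (f x) (g x)).
Proof.
move=> pop pf pg.
exact: (polytime_comp (f := fun x => (f x, g x)) pop (polytime_pair pf pg)).
Qed.

Lemma polytime_comp3 (X Y Z V W : etype) (op : Y -> Z -> V -> W)
    (f : X -> Y) (g : X -> Z) (h : X -> V) :
  polytime (fun p : Y * (Z * V) => op p.1 p.2.1 p.2.2) ->
  polytime f -> polytime g -> polytime h ->
  polytime (fun x => op (f x) (g x) (h x)).
Proof.
move=> pop pf pg ph; apply: (polytime_comp (f := fun x => (f x, (g x, h x))) pop).
by do 2?apply: polytime_pair.
Qed.

Lemma polytime_fst (X Y Z : etype) (f : X -> Y * Z) :
  polytime f -> polytime (fun x => (f x).1).
Proof.
apply: polytime_comp; apply: (@polytime_expr _ _ _ (EHd (EVar 0)) (fun=> 2)) => //.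
- by move=> P [y z]; apply: (eval_hd (v := Node _ _)); apply: eval_var.
- exact: poly_bounded_const.
- by apply: poly_bounded_le (poly_bounded_self _) _ => -[y z]; rewrite sz_pair /=; lia.
Qed.

Lemma polytime_snd (X Y Z : etype) (f : X -> Y * Z) :
  polytime f -> polytime (fun x => (f x).2).
Proof.
apply: polytime_comp; apply: (@polytime_expr _ _ _ (ETl (EVar 0)) (fun=> 2)) => //.
- by move=> P [y z]; apply: (eval_tl (v := Node _ _)); apply: eval_var.
- exact: poly_bounded_const.
- by apply: poly_bounded_le (poly_bounded_self _) _ => -[y z]; rewrite sz_pair /=; lia.
Qed.

Lemma polytime_if (X Y : etype) (b : X -> bool) (f g : X -> Y) :
  polytime b -> polytime f -> polytime g ->
  polytime (fun x => if b x then f x else g x).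
Proof.
apply: (@polytime_comp3 _ _ _ _ _ (fun (b : bool) y z => if b then y else z)).
apply: (@polytime_expr _ _ _
  (EIf (EHd (EVar 0)) (EHd (ETl (EVar 0))) (ETl (ETl (EVar 0)))) (fun=> 6)) => //.
- move=> P [[] [y z]] /=.
  + apply: (@eval_if_true _ _ _ _ _ Leaf Leaf _ 2 3).
      by apply: (eval_hd (v := Node _ _)); apply: eval_var.
    by apply: (eval_hd (v := Node _ _)); apply: (eval_tl (v := Node _ _)); apply: eval_var.
  + apply: (@eval_if_false _ _ _ _ _ _ 2 3).
      by apply: (eval_hd (v := Node _ _)); apply: eval_var.
    by apply: (eval_tl (v := Node _ _)); apply: (eval_tl (v := Node _ _)); apply: eval_var.
- exact: poly_bounded_const.
- apply: poly_bounded_le (poly_bounded_self _) _ => -[c [y z]]; rewrite !sz_pair /=.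
  by case: c; lia.
Qed.

Lemma polytime_cons (X Y : etype) (f : X -> Y) (g : X -> seq Y) :
  polytime f -> polytime g -> polytime (fun x => f x :: g x).
Proof. by apply: polytime_comp2; apply: polytime_recode => -[y s]. Qed.

Lemma polytime_behead (X Y : etype) (f : X -> seq Y) :
  polytime f -> polytime (fun x => behead (f x)).
Proof.
apply: polytime_comp; apply: (@polytime_expr _ _ _ (ETl (EVar 0)) (fun=> 2)) => //.
- move=> P s; have -> : enc (behead s) = tree_tl (enc s) by case: s.
  by apply: eval_tl; apply: eval_var.
- exact: poly_bounded_const.
- by apply: poly_bounded_le (poly_bounded_self _) _ => -[|y s]; rewrite ?sz_cons /=; lia.
Qed.

Lemma polytime_nilp (X Y : etype) (f : X -> seq Y) :
  polytime f -> polytime (fun x => nilp (f x)).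
Proof.
apply: polytime_comp; apply: (@polytime_expr _ _ _
   (EIf (EVar 0) ELeaf (ENode ELeaf ELeaf)) (fun s => if nilp s then 5 else 3)) => //.
- move=> P [|y s] /=.
    apply: (@eval_if_false _ _ _ _ _ _ 1 3); first exact: eval_var.
    exact: (eval_node (eval_leaf _ _) (eval_leaf _ _)).
  apply: (@eval_if_true _ _ _ _ _ (enc y) (enc s) _ 1 1); first exact: eval_var.
  exact: eval_leaf.
- by apply: poly_bounded_le (poly_bounded_const _ 5) _ => s; case: ifP.
- by apply: poly_bounded_le (poly_bounded_const _ 3) _ => s; apply: sz_bool.
Qed.

(** [EHd] sends the empty list to [Leaf], which need not encode [y0]. The head is therefore taken at
    type [tree] first, and the default is supplied by a conditional. *)
Lemma polytime_head (X Y : etype) (y0 : Y) (f : X -> seq Y) :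
  polytime f -> polytime (fun x => head y0 (f x)).
Proof.
move=> pf; have hd : polytime (fun s : seq Y => tree_hd (enc s)).
  apply: (@polytime_expr _ _ _ (EHd (EVar 0)) (fun=> 2)) => //.
  - by move=> P s; apply: eval_hd; apply: eval_var.
  - exact: poly_bounded_const.
  - apply: poly_bounded_le (poly_bounded_self _) _ => -[|y s] //.
    by rewrite sz_cons /sz /=; lia.
apply: (polytime_comp (g := head y0) _ pf).
have [P [T [clP evP bT bf]]] : polytime
    (fun s : seq Y => if nilp s then enc y0 else tree_hd (enc s)).
  apply: polytime_if hd; first by apply: polytime_nilp; apply: polytime_id.
  exact: polytime_const.
have eh s : enc (head y0 s) = if nilp s then enc y0 else tree_hd (enc s) by case: s.
exists P, T; split=> // [s|]; first by rewrite eh.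
by apply: poly_bounded_le bf _ => s; rewrite /sz eh.
Qed.

(** * Left folds, the only form of iteration *)

Section Foldl.
Variables (X U S : etype) (h : X -> S -> U -> S).
Variables (l : X -> seq U) (s0 : X -> S).

(** The bound [B] on all intermediate states is essential: a polynomial-time step that doubles its
    state would make the fold exponential. *)
Lemma polytime_foldl (B : X -> nat) :
  polytime (fun p : X * (S * U) => h p.1 p.2.1 p.2.2) ->
  polytime l -> polytime s0 ->
  poly_bounded (@sz X) B ->
  (forall x k, sz (foldl (h x) (s0 x) (take k (l x))) <= B x) ->
  polytime (fun x => foldl (h x) (s0 x) (l x)).
Proof.
case=> [P [T [clP evP bT bh]]] pl ps0 bB leB.
(* [X'] is [X] with every element encoded as the start configuration of the loop. The loop program,
   which expects the input, the remaining list and the state, is then itself a program for the fold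
   on [X']. *)
pose X' := @EType X (fun x => enc (x, (l x, s0 x))).
have pX' : polytime (fun x : X => (x : X')).
  have [Q [V [clQ evQ bV bq]]] : polytime (fun x : X => (x, (l x, s0 x))).
    by do 2?apply: polytime_pair => //; apply: polytime_id.
  by exists Q, V.
apply: (@polytime_comp X X' S _ (fun x => foldl (h x) (s0 x) (l x)) _ pX').
pose cx := EHd (EVar 0); pose cl := EHd (ETl (EVar 0)); pose cs := ETl (ETl (EVar 0)).
pose body := EIf cl (ECall 0 (ENode cx (ENode (ETl cl)
                 (ECall 1 (ENode cx (ENode cs (EHd cl))))))) cs.
pose prg := [:: body] ++ shift_program 1 P.
(* 25 is the fixed overhead of one round, and 7 the cost of the last test together with returning
   the state. *)
pose fix time x s (r : seq U) :=
  if r is u :: r' then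
    time x (h x s u) r' + T (x, (s, u)) + 25
  else 7.
have evF x r s : eval prg [:: enc (x, (r, s))] body (enc (foldl (h x) s r)) (time x s r).
  elim: r s => [|u r IH] s.
    apply: (@eval_if_false _ _ _ _ _ _ 3 3); rewrite /cl /cs.
      by apply: (eval_hd (v := Node _ _)); apply: (eval_tl (v := Node _ _)); apply: eval_var.
    by apply: (eval_tl (v := Node _ _)); apply: (eval_tl (v := Node _ _)); apply: eval_var.
  have ecl : eval prg [:: enc (x, (u :: r, s))] cl (enc (u :: r)) 3.
    by apply: (eval_hd (v := Node _ _)); apply: (eval_tl (v := Node _ _)); apply: eval_var.
  have ecx : eval prg [:: enc (x, (u :: r, s))] cx (enc x) 2.
    by apply: (eval_hd (v := Node _ _)); apply: eval_var.
  have ecs : eval prg [:: enc (x, (u :: r, s))] cs (enc s) 3.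
    by apply: (eval_tl (v := Node _ _)); apply: (eval_tl (v := Node _ _)); apply: eval_var.
  have ev1 : eval prg [:: enc (x, (u :: r, s))]
      (ECall 1 (ENode cx (ENode cs (EHd cl)))) (enc (h x s u))
      (((2 + (3 + 4).+1).+1) + T (x, (s, u))).+1.
    rewrite /prg -[shift_program 1 P]cats0; apply: (@eval_link_call P [:: body]) => //;
      last exact: (evP (x, (s, u))).
    rewrite cats0; apply: eval_node => //; apply: eval_node => //.
    exact: (eval_hd ecl).
  rewrite [time _ _ _]/= (_ : _ + 25 =
     (3 + ((2 + (4 + (((2 + (3 + 4).+1).+1) + T (x, (s, u))).+1).+1).+1
            + time x (h x s u) r).+1).+1); last by lia.
  apply: (@eval_if_true _ _ _ _ _ (enc u) (enc r)) => //.
  apply: (eval_call (v := enc (x, (r, h x s u)))); last exact: IH.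
  apply: eval_node => //; apply: eval_node => //.
  exact: (eval_tl ecl).
exists prg, (fun x : X' => time x (s0 x) (l x)); split.
- case/andP: (clP) => P0 clPa.
  rewrite /closed_program /= /shift_program all_map size_map !andbT.
  do ?[apply/andP; split] => //; try lia.
  apply: sub_all clPa => e /= /closed_expr_shift; apply; lia.
- by move=> x; apply: evF.
- case: bT => k Tk.
  have letime x r s : (forall j, sz (foldl (h x) s (take j r)) <= B x) ->
      time x s r <= 7 + size r * ((sz x + B x + sz r + k + 2) ^ k + 25).
    elim: r s => [|u r IH] s les //=.
    have {}IH : time x (h x s u) r <=
       7 + size r * ((sz x + B x + sz r + k + 2) ^ k + 25).
      by apply: IH => j; have := les j.+1.
    have leT : T (x, (s, u)) <= (sz x + B x + sz (u :: r) + k + 2) ^ k.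
      apply: (leq_trans (Tk _)); rewrite !sz_pair sz_cons.
      have /= les0 := les 0.
      by apply: leq_expl; lia.
    have leE : (sz x + B x + sz r + k + 2) ^ k <= (sz x + B x + sz (u :: r) + k + 2) ^ k.
      by rewrite sz_cons; apply: leq_expl; lia.
    move: leE leT IH; set a := (_ ^ k); set b := (_ ^ k); set c := T _ => leE leT IH.
    have : size r * (a + 25) <= size r * (b + 25) by rewrite leq_mul2l; lia.
    by rewrite mulSn; lia.
  have bX' g : poly_bounded (@sz X) g -> poly_bounded (@sz X') g.
    case=> j gj; exists j => x; apply: (leq_trans (gj x)).
    have le : sz (x : X) <= sz (x : X') by rewrite {2}/sz /= -/(sz _); rewrite /sz; lia.
    by apply: leq_expl; lia.
  apply: (@poly_bounded_le _ _ (fun x : X' =>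
     7 + sz (l x) * ((sz (x : X) + B x + sz (l x) + k + 2) ^ k + 25))); last first.
    move=> x; apply: (leq_trans (letime x (l x) (s0 x) (leB x))).
    by rewrite leq_add2l leq_mul2r size_le_sz orbT.
  apply: bX'; have bl := polytime_sz pl.
  apply: poly_boundedD (poly_bounded_const _ _) _; apply: poly_boundedM => //.
  apply: poly_boundedD (poly_bounded_const _ _); apply: poly_bounded_exp.
  do 2?apply: poly_boundedD (poly_bounded_const _ _); apply: poly_boundedD bl.
  by apply: poly_boundedD bB; apply: poly_bounded_self.
- case: bB => j Bj; exists j => x.
  have := leB x (size (l x)); rewrite take_size => /leq_trans; apply.
  apply: (leq_trans (Bj x)).
  have le : sz (x : X) <= sz (x : X') by rewrite {2}/sz /= -/(sz _); rewrite /sz; lia.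
  by apply: leq_expl; lia.
Qed.

End Foldl.

Create HintDb polytime.
#[global] Hint Resolve polytime_id polytime_const polytime_fst polytime_snd
  polytime_pair polytime_if polytime_cons polytime_behead polytime_nilp
  polytime_head : polytime.
Ltac ptime := solve [auto 200 with polytime nocore].

Section Booleans.
Variables (X : etype) (f g : X -> bool).
Hypotheses (pf : polytime f) (pg : polytime g).

Lemma polytime_andb : polytime (fun x => f x && g x).
Proof. by apply: (@polytime_ext _ _ (fun x => if f x then g x else false)) => //; ptime. Qed.

Lemma polytime_orb : polytime (fun x => f x || g x).
Proof. by apply: (@polytime_ext _ _ (fun x => if f x then true else g x)) => //; ptime. Qed.

Lemma polytime_negb : polytime (fun x => ~~ f x).
Proof. by apply: (@polytime_ext _ _ (fun x => if f x then false else true)) => //; ptime. Qed.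

Lemma polytime_addb : polytime (fun x => f x (+) g x).
Proof.
apply: (@polytime_ext _ _ (fun x => if f x then (if g x then false else true) else g x)).
  by move=> x; case: (f x) (g x) => [] [].
ptime.
Qed.

Lemma polytime_eqb : polytime (fun x => f x == g x).
Proof.
apply: (@polytime_ext _ _ (fun x => if f x then g x else (if g x then false else true))).
  by move=> x; case: (f x) (g x) => [] [].
ptime.
Qed.

End Booleans.
#[global] Hint Resolve polytime_andb polytime_orb polytime_negb polytime_addb
  polytime_eqb : polytime.

Section Folds.
Variables (X U S : etype) (h : X -> S -> U -> S).
Variables (l : X -> seq U) (s0 : X -> S).
Hypothesis ph : polytime (fun p : X * (S * U) => h p.1 p.2.1 p.2.2).
Hypotheses (pl : polytime l) (ps0 : polytime s0).

(* The measure [mu] grows by a bounded amount at each step, so that the state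
   stays of polynomial size. *)
Lemma polytime_foldl_gen (Inv : X -> S -> Prop) (mu : S -> nat) (B : X -> nat) c
    (g : X * U -> nat) :
  (forall x, Inv x (s0 x)) -> (forall x s u, Inv x s -> Inv x (h x s u)) ->
  poly_bounded (@sz _) B -> poly_bounded (@sz _) g ->
  (forall x, mu (s0 x) <= B x) ->
  (forall x s u, Inv x s -> mu (h x s u) <= mu s + g (x, u)) ->
  (forall x s, Inv x s -> sz s <= B x + c * mu s) ->
  polytime (fun x => foldl (h x) (s0 x) (l x)).
Proof.
move=> inv0 invS bB [k gk] muB mustep szmu.
pose G x := (sz x + sz (l x) + 1 + k) ^ k.
apply: (@polytime_foldl _ _ _ h l s0
  (fun x => B x + c * (B x + sz (l x) * G x))) => //.
  apply: (poly_boundedD bB _); apply: poly_boundedM (poly_bounded_const _ _) _.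
  apply: (poly_boundedD bB _); apply: poly_boundedM (polytime_sz pl) _.
  apply: poly_bounded_exp; do 2?apply: poly_boundedD (poly_bounded_const _ _).
  by apply: poly_boundedD (poly_bounded_self _) (polytime_sz pl).
move=> x j.
have leG u (r : seq U) : sz r <= sz (l x) -> sz u <= sz r -> g (x, u) <= G x.
  move=> le1 le2; apply: (leq_trans (gk _)); apply: leq_expl.
  by rewrite sz_pair; lia.
have leF r s : sz r <= sz (l x) -> Inv x s ->
    Inv x (foldl (h x) s r) /\ mu (foldl (h x) s r) <= mu s + size r * G x.
  elim: r s => [|u r IH] s ler invs /=; first by rewrite addn0.
  have [|inv' le'] := IH (h x s u) _ (invS x s u invs).
    by move: ler; rewrite sz_cons; lia.
  split=> //; apply: (leq_trans le'); rewrite mulSn addnA leq_add2r.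
  apply: leq_trans (mustep x s u invs) _; rewrite leq_add2l.
  by apply: (leG u (u :: r)) => //; rewrite sz_cons; lia.
have [inv' le'] := leF _ _ (sz_take j (l x)) (inv0 x).
apply: leq_trans (szmu x _ inv') _; rewrite leq_add2l leq_mul2l; apply/orP; right.
apply: leq_trans le' _; apply: leq_add => //.
by rewrite leq_mul2r (leq_trans (size_le_sz _)) ?orbT // sz_take.
Qed.

Lemma polytime_foldl_measure (mu : S -> nat) c (g : X * U -> nat) :
  (forall s, sz s <= c * (mu s).+1) -> (forall s, mu s <= sz s) ->
  poly_bounded (@sz _) g ->
  (forall x s u, mu (h x s u) <= mu s + g (x, u)) ->
  polytime (fun x => foldl (h x) (s0 x) (l x)).
Proof.
move=> szmu musz bg mustep.
apply: (@polytime_foldl_gen (fun _ _ => True) mu (fun x => c + sz (s0 x)) c g) => //.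
- by apply: poly_boundedD (poly_bounded_const _ _) (polytime_sz ps0).
- by move=> x; apply: leq_trans (musz _) (leq_addl _ _).
- by move=> x s _; have := szmu s; rewrite mulnS; lia.
Qed.

Lemma polytime_foldl_add (g : X * U -> nat) :
  poly_bounded (@sz _) g -> (forall x s u, sz (h x s u) <= sz s + g (x, u)) ->
  polytime (fun x => foldl (h x) (s0 x) (l x)).
Proof. by move=> bg; apply: (polytime_foldl_measure (c := 1)) bg => // s; lia. Qed.

Lemma polytime_foldl_inv (Inv : X -> S -> Prop) (B : X -> nat) :
  (forall x, Inv x (s0 x)) -> (forall x s u, Inv x s -> Inv x (h x s u)) ->
  poly_bounded (@sz X) B -> (forall x s, Inv x s -> sz s <= B x) ->
  polytime (fun x => foldl (h x) (s0 x) (l x)).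
Proof.
move=> inv0 invS bB le_B.
apply: (@polytime_foldl_gen Inv (fun=> 0) B 0 (fun=> 0)) => //; first exact: poly_bounded_const.
by move=> x s /le_B; rewrite addn0.
Qed.

End Folds.

Section Reversal.
Variables (X U : etype).

Lemma polytime_rev (l : X -> seq U) : polytime l -> polytime (fun x => rev (l x)).
Proof.
move=> pl; apply: (@polytime_ext _ _ (fun x => foldl (fun s u => u :: s) [::] (l x))).
  move=> x; rewrite /rev; elim: (l x) [::] => //=.
apply: (@polytime_foldl_add _ _ _ _ _ _ _ _ _ (fun p => (sz p.2).+1)) => //; try ptime.
  by apply: poly_boundedS; apply: polytime_sz; ptime.
by move=> x s u; rewrite sz_cons /=; lia.
Qed.

End Reversal.

Section MapFilter.
Variables (X Y U : etype).

Lemma polytime_map (h : X -> U -> Y) (l : X -> seq U) :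
  polytime (fun p : X * U => h p.1 p.2) -> polytime l ->
  polytime (fun x => [seq h x u | u <- l x]).
Proof.
move=> ph pl.
apply: (@polytime_ext _ _ (fun x => rev (foldl (fun s u => h x u :: s) [::] (l x)))).
  move=> x; rewrite -[RHS]revK; congr rev; rewrite -[RHS]cats0.
  by elim: (l x) [::] => //= u r IH s; rewrite IH rev_cons cat_rcons.
apply: polytime_rev.
apply: (@polytime_foldl_add _ _ _ (fun x s u => h x u :: s) _ _ _ _ _
  (fun p => (sz (h p.1 p.2)).+1)) => //; try ptime.
- apply: polytime_cons; last by ptime.
  apply: (polytime_comp (f := fun p : X * (seq Y * U) => (p.1, p.2.2)) ph); ptime.
- by apply: poly_boundedS; apply: polytime_sz.
- by move=> x s u; rewrite sz_cons /=; lia.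
Qed.

Lemma polytime_filter (h : X -> U -> bool) (l : X -> seq U) :
  polytime (fun p : X * U => h p.1 p.2) -> polytime l ->
  polytime (fun x => [seq u <- l x | h x u]).
Proof.
move=> ph pl.
apply: (@polytime_ext _ _ (fun x => rev (foldl (fun s u => if h x u then u :: s else s) [::] (l x)))).
  move=> x; rewrite -[RHS]revK; congr rev; rewrite -[RHS]cats0.
  elim: (l x) [::] => //= u r IH s; rewrite IH; case: ifP => //.
  by rewrite rev_cons cat_rcons.
apply: polytime_rev.
apply: (@polytime_foldl_add _ _ _ (fun x s u => if h x u then u :: s else s) _ _ _ _ _
  (fun p => (sz p.2).+1)) => //; try ptime.
- apply: polytime_if; try ptime.
  apply: (polytime_comp (f := fun p : X * (seq U * U) => (p.1, p.2.2)) ph); ptime.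
- by apply: poly_boundedS; apply: polytime_sz; ptime.
- by move=> x s u; case: ifP => _; rewrite ?sz_cons /=; lia.
Qed.

Lemma polytime_cat (l1 l2 : X -> seq U) :
  polytime l1 -> polytime l2 -> polytime (fun x => l1 x ++ l2 x).
Proof.
move=> p1 p2.
apply: (@polytime_ext _ _ (fun x => foldl (fun s u => u :: s) (l2 x) (rev (l1 x)))).
  by move=> x; rewrite foldl_rev; elim: (l1 x) => //= u r ->.
apply: (@polytime_foldl_add _ _ _ _ _ _ _ _ _ (fun p => (sz p.2).+1)) => //; try ptime.
- exact: polytime_rev.
- by apply: poly_boundedS; apply: polytime_sz; ptime.
- by move=> x s u; rewrite sz_cons /=; lia.
Qed.

Lemma polytime_rcons (l : X -> seq U) (u : X -> U) :
  polytime l -> polytime u -> polytime (fun x => rcons (l x) (u x)).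
Proof.
move=> pl pu; apply: (@polytime_ext _ _ (fun x => l x ++ [:: u x])).
  by move=> x; rewrite cats1.
by apply: polytime_cat => //; ptime.
Qed.

End MapFilter.

Section Flatten.
Variables (X U : etype).

Lemma polytime_flatten (l : X -> seq (seq U)) :
  polytime l -> polytime (fun x => flatten (l x)).
Proof.
move=> pl; apply: (@polytime_ext _ _ (fun x => foldl (fun s r => s ++ r) [::] (l x))).
  move=> x; rewrite -[RHS]cat0s.
  by elim: (l x) [::] => [|r s IH] t /=; rewrite ?cats0 // IH catA.
apply: (@polytime_foldl_add _ _ _ _ _ _ _ _ _ (fun p => sz p.2)) => //; try ptime.
- by apply: polytime_cat; ptime.
- by apply: polytime_sz; ptime.
- by move=> x s r; apply: sz_cat.
Qed.

Lemma polytime_has (h : X -> U -> bool) (l : X -> seq U) :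
  polytime (fun p : X * U => h p.1 p.2) -> polytime l ->
  polytime (fun x => has (h x) (l x)).
Proof.
move=> ph pl; apply: (@polytime_ext _ _ (fun x => ~~ nilp [seq u <- l x | h x u])).
  by move=> x; rewrite /nilp size_filter has_count -lt0n.
by apply: polytime_negb; apply: polytime_nilp; apply: polytime_filter.
Qed.

End Flatten.
#[global] Hint Resolve polytime_rev polytime_map polytime_filter polytime_cat
  polytime_rcons polytime_flatten polytime_has : polytime.

(** * Binary arithmetic *)

Fixpoint bval (s : seq bool) : nat := if s is b :: s' then b + (bval s').*2 else 0.

Definition bits (n : nat) : seq bool :=
  mkseq (fun i => odd (n %/ 2 ^ i)) (up_log 2 n.+1).

Lemma enc_bits n : enc (bits n) = enc n.
Proof. by rewrite /enc /= /enc_nat /bits /mkseq -map_comp. Qed.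

Lemma bitsE n : bits n = if n == 0 then [::] else odd n :: bits n./2.
Proof.
case: n => [|n] //=; rewrite /bits up_log2S //= /mkseq /=.
rewrite expn0 divn1 /=; congr cons; rewrite -[1]/(1 + 0) iotaDl -map_comp.
by apply: eq_map => i /=; rewrite expnS divnMA divn2.
Qed.

Lemma bitsK : cancel bits bval.
Proof.
elim/ltn_ind => n IH; rewrite bitsE; case: eqP => [-> //|/eqP n0] /=.
by rewrite IH ?odd_double_half //; lia.
Qed.

Definition bnorm (s : seq bool) : seq bool :=
  foldr (fun b r => if nilp r && ~~ b then [::] else b :: r) [::] s.

Lemma bits_bval s : bits (bval s) = bnorm s.
Proof.
elim: s => //= b s <-; rewrite bitsE.
case: eqP => [|/eqP]; first by case: b => //=; case: (bval s).
have e : nilp (bits (bval s)) = (bval s == 0) by rewrite bitsE; case: eqP.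
rewrite e => ne; case: ifP => [/andP[/eqP v0 /negPf b0]|_]; first by rewrite v0 b0 in ne.
by rewrite oddD odd_double addbF oddb half_bit_double.
Qed.

Lemma size_bits n : size (bits n) = up_log 2 n.+1.
Proof. exact: size_mkseq. Qed.

Lemma sz_bits n : sz (bits n) = sz n.
Proof. by rewrite /sz enc_bits. Qed.

Lemma sz_bitseq_le (s : seq bool) : sz s <= 4 * size s + 1.
Proof. by elim: s => //= b s IH; rewrite sz_cons; have := sz_bool b; lia. Qed.

Lemma sz_nat_le n : sz n <= 4 * up_log 2 n.+1 + 1.
Proof. by rewrite -sz_bits -size_bits sz_bitseq_le. Qed.

Lemma log_le_sz n : up_log 2 n.+1 <= sz n.
Proof. by rewrite -sz_bits -size_bits size_le_sz. Qed.

Lemma leq_sz_nat m n : m <= n -> sz m <= 4 * sz n + 1.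
Proof.
move=> le_mn; apply: (leq_trans (sz_nat_le m)); rewrite leq_add2r leq_mul2l /=.
by apply: leq_trans (log_le_sz n); apply: leq_up_log.
Qed.

Lemma log_leM m n k : k < m.+1 * n.+1 ->
  up_log 2 k.+1 <= up_log 2 m.+1 + up_log 2 n.+1.
Proof.
move=> ltk; apply: (@up_log_min 2) => //; rewrite expnD.
by apply: (leq_trans ltk); apply: leq_mul; apply: up_logP.
Qed.

Section NatRecode.
Variable X : etype.

Lemma polytime_bits (f : X -> nat) : polytime f -> polytime (fun x => bits (f x)).
Proof. by apply: polytime_comp; apply: polytime_recode => n; apply: enc_bits. Qed.

Lemma polytime_bval (f : X -> seq bool) : polytime f -> polytime (fun x => bval (f x)).
Proof.
move=> pf; apply: (@polytime_enc _ _ _ (fun x => bnorm (f x))).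
  by move=> x; rewrite -bits_bval enc_bits.
apply: (@polytime_ext _ _ (fun x => foldl (fun (r : seq bool) b =>
   if nilp r && ~~ b then [::] else b :: r) [::] (rev (f x)))).
  by move=> x; rewrite foldl_rev.
apply: (@polytime_foldl_add _ _ _ _ _ _ _ _ _ (fun=> 4)) => //; try ptime.
  exact: poly_bounded_const.
by move=> x s b; have := sz_bool b; case: ifP => _; rewrite ?sz_cons ?sz_nil; lia.
Qed.

End NatRecode.
#[global] Hint Resolve polytime_bits polytime_bval : polytime.

Lemma bval_cat s t : bval (s ++ t) = bval s + 2 ^ size s * bval t.
Proof.
elim: s => [|b s IH] /=; first by rewrite mul1n.
by rewrite IH expnS doubleD -!mul2n mulnA addnA.
Qed.

Lemma bval_rev_cons b s : bval (rev (b :: s)) = bval (rev s) + 2 ^ size s * b.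
Proof. by rewrite rev_cons -cats1 bval_cat size_rev /= addn0. Qed.

Lemma bval_headE s : bval s = head false s + (bval (behead s)).*2.
Proof. by case: s. Qed.

Lemma bval_lt s : bval s < 2 ^ size s.
Proof. elim: s => //= b s IH; rewrite expnS; case: b => /=; lia. Qed.

Lemma sz_behead (U : etype) (s : seq U) : sz (behead s) <= sz s.
Proof. by case: s => //= u s; rewrite sz_cons; lia. Qed.

Section SerialArithmetic.

(* A serial adder or subtractor: carry, remaining digits of both operands, and
   the digits already output, most significant first. *)
Notation state := (bool * (seq bool * (seq bool * seq bool)))%type.
Variables carry digit : bool -> bool -> bool -> bool.

Definition serial_step (s : state) (_ : bool) : state :=
  let: (c, (a, (b, out))) := s in
  let a0 := head false a in let b0 := head false b in
  (carry a0 b0 c, (behead a, (behead b, digit a0 b0 c :: out))).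

(** The list [a ++ b] is only fuel: it is at least as long as either operand, so both are consumed,
    and any further rounds read zeros. *)
Definition serial (a b : seq bool) : bool * seq bool :=
  let s := foldl serial_step (false, (a, (b, [::]))) (a ++ b) in (s.1, s.2.2.2).

Lemma serialP (Inv : state -> Prop) a b :
  (forall s u, Inv s -> Inv (serial_step s u)) -> Inv (false, (a, (b, [::]))) ->
  Inv ((serial a b).1, ([::], ([::], (serial a b).2))).
Proof.
move=> invS inv0; rewrite /serial.
suff main r s : Inv s -> Inv (foldl serial_step s r) /\
    (size s.2.1 <= size r -> size s.2.2.1 <= size r ->
     let s' := foldl serial_step s r in s'.2.1 = [::] /\ s'.2.2.1 = [::]).
  have [inv1] := main (a ++ b) _ inv0; rewrite /= size_cat leq_addr leq_addl.
  move: inv1; case: (foldl _ _ _) => c [a' [b' out]] /= inv1.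
  by case=> // e1 e2; rewrite e1 e2 in inv1.
elim: r s => [|u r IH] s invs /=.
  by split=> //; rewrite !leqn0 !size_eq0 => /eqP-> /eqP->.
have [inv' sz'] := IH _ (invS s u invs); split=> // lea leb; apply: sz'.
  by move: lea; case: s {invs inv' leb} => c [[|a0 a'] [b' out]] //=.
by move: leb; case: s {invs inv' lea} => c [a' [[|b0 b'] out]] //=.
Qed.

Variable X : etype.
Hypotheses (pc : polytime (fun p : bool * (bool * bool) => carry p.1 p.2.1 p.2.2))
           (pd : polytime (fun p : bool * (bool * bool) => digit p.1 p.2.1 p.2.2)).

Lemma polytime_serial (f g : X -> seq bool) :
  polytime f -> polytime g -> polytime (fun x => serial (f x) (g x)).
Proof.
move=> pf pg; rewrite /serial.
have pstep : polytime (fun x => foldl serial_step (false, (f x, (g x, [::]))) (f x ++ g x)).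
  apply: (@polytime_foldl_measure _ _ _ _ _ _ _ _ _
    (fun s => sz s.2.1 + sz s.2.2.1 + sz s.2.2.2) 10 (fun=> 4)) => //; try ptime.
  - apply: (@polytime_ext _ _ (fun p : X * (state * bool) =>
      let s := p.2.1 in let a0 := head false s.2.1 in let b0 := head false s.2.2.1 in
      (carry a0 b0 s.1, (behead s.2.1, (behead s.2.2.1, digit a0 b0 s.1 :: s.2.2.2))))).
      by case=> [x [[c [a [b out]]] u]].
    apply: polytime_pair; first by apply: (polytime_comp3 pc); ptime.
    do 2?[apply: polytime_pair; first by ptime].
    by apply: polytime_cons; [apply: (polytime_comp3 pd); ptime | ptime].
  - by case=> [c [a [b out]]]; rewrite !sz_pair /=; have := sz_bool c; lia.
  - by case=> [c [a [b out]]]; rewrite !sz_pair /=; lia.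
  - exact: poly_bounded_const.
  - move=> x [c [a [b out]]] u /=; rewrite sz_cons.
    apply: (@leq_trans (sz a + sz b + (3 + sz out).+1)); last by lia.
    apply: leq_add; first by apply: leq_add; apply: sz_behead.
    by rewrite ltnS leq_add2r; apply: sz_bool.
apply: polytime_pair; first by apply: polytime_fst.
by do 3?apply: polytime_snd.
Qed.

End SerialArithmetic.

Definition maj a b c := [|| a && b, a && c | b && c].
Definition xor3 (a b c : bool) := a (+) b (+) c.
Definition borrow a b c := if a then b && c else b || c.

Lemma serial_addn m n : let s := serial maj xor3 (bits m) (bits n) in
  m + n = bval (rev (s.1 :: s.2)).
Proof.
pose Inv (s : bool * (seq bool * (seq bool * seq bool))) :=
  m + n = bval (rev s.2.2.2) + 2 ^ size s.2.2.2 * (s.1 + bval s.2.1 + bval s.2.2.1).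
move=> s; have : Inv (s.1, ([::], ([::], s.2))).
  apply: serialP; last by rewrite /Inv /= !bitsK mul1n.
  move=> [c [a [b out]]] u; rewrite /Inv /= => ->.
  rewrite bval_rev_cons (bval_headE a) (bval_headE b) expnS.
  set k := 2 ^ _; set A := bval (behead a); set B := bval (behead b).
  by case: c; case: (head false a); case: (head false b); rewrite /maj /xor3 /borrow /=; lia.
by rewrite /Inv /= !addn0 bval_rev_cons.
Qed.

Lemma serial_subn m n : let s := serial borrow xor3 (bits m) (bits n) in
  m - n = if s.1 then 0 else bval (rev s.2).
Proof.
pose Inv (s : bool * (seq bool * (seq bool * seq bool))) :=
  m + 2 ^ size s.2.2.2 * (s.1 + bval s.2.2.1) =
  n + bval (rev s.2.2.2) + 2 ^ size s.2.2.2 * bval s.2.1.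
move=> s; have : Inv (s.1, ([::], ([::], s.2))).
  apply: serialP; last by rewrite /Inv /= !bitsK !mul1n add0n addn0 addnC.
  move=> [c [a [b out]]] u; rewrite /Inv /=.
  rewrite bval_rev_cons (bval_headE a) (bval_headE b) expnS.
  set k := 2 ^ _; set A := bval (behead a); set B := bval (behead b).
  by case: c; case: (head false a); case: (head false b); rewrite /maj /xor3 /borrow /=; lia.
(* A final borrow means [m + 2 ^ k = n + out] with [out < 2 ^ k], where [k] is the number of digits
   written; hence [m < n] and the truncated difference is 0. *)
rewrite /Inv; clearbody s; case: s => c out /=; rewrite !addn0 muln0 addn0.
by have := bval_lt (rev out); rewrite size_rev; case: c => /=; lia.
Qed.

Section Arithmetic.
Variable X : etype.
Implicit Types f g : X -> nat.

Lemma polytime_addn f g : polytime f -> polytime g -> polytime (fun x => f x + g x).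
Proof.
move=> pf pg; pose s x := serial maj xor3 (bits (f x)) (bits (g x)).
apply: (@polytime_ext _ _ (fun x => bval (rev ((s x).1 :: (s x).2)))).
  by move=> x; rewrite -serial_addn.
have ps : polytime s by apply: polytime_serial; rewrite /maj /xor3; ptime.
ptime.
Qed.

Lemma polytime_subn f g : polytime f -> polytime g -> polytime (fun x => f x - g x).
Proof.
move=> pf pg; pose s x := serial borrow xor3 (bits (f x)) (bits (g x)).
apply: (@polytime_ext _ _ (fun x => if (s x).1 then 0 else bval (rev (s x).2))).
  by move=> x; rewrite -serial_subn.
have ps : polytime s by apply: polytime_serial; rewrite /borrow /xor3; ptime.
ptime.
Qed.

Lemma polytime_leq f g : polytime f -> polytime g -> polytime (fun x => f x <= g x).
Proof.
move=> pf pg; apply: (@polytime_ext _ _ (fun x => nilp (bits (f x - g x)))).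
  by move=> x; rewrite /leq bitsE; case: eqP.
by have := polytime_subn pf pg; ptime.
Qed.

Lemma polytime_succn f : polytime f -> polytime (fun x => (f x).+1).
Proof.
move=> pf; apply: (@polytime_ext _ _ (fun x => f x + 1)); first by move=> x; rewrite addn1.
by apply: polytime_addn => //; ptime.
Qed.

Lemma polytime_eqn f g : polytime f -> polytime g -> polytime (fun x => f x == g x).
Proof.
move=> pf pg; apply: (@polytime_ext _ _ (fun x => (f x <= g x) && (g x <= f x))).
  by move=> x; rewrite -eqn_leq.
by apply: polytime_andb; apply: polytime_leq.
Qed.

End Arithmetic.
#[global] Hint Resolve polytime_addn polytime_subn polytime_leq polytime_succn
  polytime_eqn : polytime.

Section NatFolds.
Variables X U : etype.

(* Numbers are measured by their number of bits, which is subadditive. *)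
Lemma polytime_foldl_nat (h : X -> nat -> U -> nat) (l : X -> seq U) (s0 : X -> nat)
    (g : X * U -> nat) :
  polytime (fun p : X * (nat * U) => h p.1 p.2.1 p.2.2) ->
  polytime l -> polytime s0 -> poly_bounded (@sz _) g ->
  (forall x s u, up_log 2 (h x s u).+1 <= up_log 2 s.+1 + g (x, u)) ->
  polytime (fun x => foldl (h x) (s0 x) (l x)).
Proof.
move=> ph pl ps0 bg hg.
apply: (@polytime_foldl_measure _ _ _ h l s0 ph pl ps0 (fun s => up_log 2 s.+1) 4 g) => //.
  by move=> s; apply: leq_trans (sz_nat_le s) _; lia.
exact: log_le_sz.
Qed.

Lemma polytime_size (l : X -> seq U) : polytime l -> polytime (fun x => size (l x)).
Proof.
move=> pl; apply: (@polytime_ext _ _ (fun x => foldl (fun s _ => s.+1) 0 (l x))).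
  by move=> x; rewrite -[RHS]add0n; elim: (l x) 0 => [|_ r IH] s /=; rewrite ?addn0 ?IH ?addSnnS.
apply: (@polytime_foldl_nat _ _ _ (fun=> 1)) => //; try ptime.
  exact: poly_bounded_const.
by move=> _ s _; rewrite -[1]/(up_log 2 2); apply: log_leM; lia.
Qed.

End NatFolds.
#[global] Hint Resolve polytime_size : polytime.

Section MoreArithmetic.
Variable X : etype.
Implicit Types f g : X -> nat.

Lemma polytime_count (U : etype) (h : X -> U -> bool) (l : X -> seq U) :
  polytime (fun p : X * U => h p.1 p.2) -> polytime l ->
  polytime (fun x => count (h x) (l x)).
Proof.
move=> ph pl; apply: (@polytime_ext _ _ (fun x => size [seq u <- l x | h x u])).
  by move=> x; rewrite size_filter.
ptime.
Qed.

Lemma polytime_sumn (l : X -> seq nat) : polytime l -> polytime (fun x => sumn (l x)).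
Proof.
move=> pl; apply: (@polytime_ext _ _ (fun x => foldl addn 0 (l x))).
  by move=> x; rewrite -[RHS]add0n; elim: (l x) 0 => [|u r IH] s /=; rewrite ?addn0 ?IH ?addnA.
apply: (@polytime_foldl_nat _ _ (fun _ => addn) _ _ (fun p => sz p.2)) => //; try ptime.
  by apply: polytime_sz; ptime.
move=> x s u; apply: (@leq_trans (up_log 2 s.+1 + up_log 2 u.+1)).
  by apply: log_leM; lia.
by rewrite leq_add2l log_le_sz.
Qed.

Lemma muln_bits s n :
  bval s * n = foldr (fun (b : bool) acc => acc + acc + (if b then n else 0)) 0 s.
Proof. by elim: s => //= b s <-; case: b => /=; lia. Qed.

Lemma polytime_muln f g : polytime f -> polytime g -> polytime (fun x => f x * g x).
Proof.
move=> pf pg; apply: (@polytime_ext _ _ (fun x =>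
  foldl (fun acc (b : bool) => acc + acc + (if b then g x else 0)) 0 (rev (bits (f x))))).
  by move=> x; rewrite foldl_rev -muln_bits bitsK.
apply: (@polytime_foldl_nat _ _ (fun x acc (b : bool) => acc + acc + (if b then g x else 0))
   _ _ (fun p => (1 + sz (g p.1)))) => //; try ptime.
- have pg1 : polytime (fun p : X * (nat * bool) => g p.1) by apply: polytime_comp pg _; ptime.
  ptime.
- apply: poly_boundedD; first exact: poly_bounded_const.
  by apply: polytime_sz; apply: polytime_comp pg _; ptime.
- move=> x s b; apply: (@leq_trans (up_log 2 (s + s).+1 + up_log 2 (g x).+1)).
    by apply: log_leM; case: b; nia.
  rewrite addnA leq_add ?log_le_sz //.
  by rewrite -[1]/(up_log 2 2); apply: log_leM; lia.
Qed.

(** Long division from the most significant bit. The remainder stays below [d], so one subtraction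
    suffices after doubling it. *)
Definition div_step (d : nat) (b : bool) (qr : nat * nat) : nat * nat :=
  let r := qr.2 + qr.2 + b in
  if d <= r then ((qr.1 + qr.1).+1, r - d) else (qr.1 + qr.1, r).

Lemma divn_bits s d : 0 < d ->
  foldr (div_step d) (0, 0) s = (bval s %/ d, bval s %% d).
Proof.
move=> d0; elim: s => [|b s IH] /=; first by rewrite div0n mod0n.
rewrite {}IH /div_step /=; set q := bval s %/ d; set r := bval s %% d.
have ltr : r < d by rewrite ltn_mod.
have -> : b + (bval s).*2 = (q + q) * d + (r + r + b).
  by rewrite (divn_eq (bval s) d) -/q -/r; lia.
case: leqP => le.
  have -> : (q + q) * d + (r + r + b) = (q + q).+1 * d + (r + r + b - d) by lia.
  have lt : r + r + b - d < d by case: (b) => /=; lia.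
  by rewrite divnMDl // divn_small // modnMDl modn_small // addn0.
by rewrite divnMDl // divn_small // modnMDl modn_small // addn0.
Qed.

Lemma polytime_divn f g : polytime f -> polytime g -> polytime (fun x => f x %/ g x).
Proof.
move=> pf pg; apply: (@polytime_ext _ _ (fun x => if g x == 0 then 0 else
  (foldl (fun qr (b : bool) => div_step (g x) b qr) (0, 0) (rev (bits (f x)))).1)).
  move=> x; case: eqP => [->|/eqP g0]; first by rewrite divn0.
  by rewrite foldl_rev divn_bits ?bitsK // lt0n.
apply: polytime_if; try ptime; apply: polytime_fst.
apply: (@polytime_foldl_measure _ _ _ (fun x qr (b : bool) => div_step (g x) b qr) _ _ _ _ _
  (fun qr => up_log 2 qr.1.+1 + up_log 2 qr.2.+1) 8 (fun=> 4)) => //; try ptime.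
- have pg1 : polytime (fun p : X * (nat * nat * bool) => g p.1) by apply: polytime_comp pg _; ptime.
  have pb : polytime (fun p : X * (nat * nat * bool) => nat_of_bool p.2.2).
    by apply: (@polytime_ext _ _ (fun p => if p.2.2 then 1 else 0)) => [p|]; [case: p.2.2|ptime].
  rewrite /div_step; ptime.
- by case=> q r; rewrite sz_pair /=; have := sz_nat_le q; have := sz_nat_le r; lia.
- by case=> q r; rewrite sz_pair /=; have := log_le_sz q; have := log_le_sz r; lia.
- exact: poly_bounded_const.
- move=> x [q r] b; rewrite /div_step /=.
  have lq a : a <= (q + q).+1 -> up_log 2 a.+1 <= up_log 2 q.+1 + 2.
    by move=> lea; rewrite -[2]/(up_log 2 4); apply: log_leM; lia.
  have lr a : a <= r + r + b -> up_log 2 a.+1 <= up_log 2 r.+1 + 2.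
    by move=> lea; rewrite -[2]/(up_log 2 4); apply: log_leM; case: (b) lea; lia.
  case: ifP => _ /=.
    by have := lq _ (leqnn _); have := lr (r + r + b - g x) (leq_subr _ _); lia.
  by have := lq (q + q) (leqnSn _); have := lr _ (leqnn _); lia.
Qed.

Lemma polytime_mem f (l : X -> seq nat) :
  polytime f -> polytime l -> polytime (fun x => f x \in l x).
Proof.
move=> pf pl; apply: (@polytime_ext _ _ (fun x => has (fun u => u == f x) (l x))).
  by move=> x; rewrite -has_pred1; apply: eq_has => u.
have pf1 : polytime (fun p : X * nat => f p.1) by apply: polytime_comp pf _; ptime.
by apply: (@polytime_has X nat_etype (fun x (u : nat) => u == f x)); ptime.
Qed.

End MoreArithmetic.
#[global] Hint Resolve polytime_count polytime_sumn polytime_muln polytime_divn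
  polytime_mem : polytime.

Lemma sz_seq_le (U : etype) (s : seq U) b :
  all (fun u => sz u <= b) s -> sz s <= size s * b.+1 + 1.
Proof.
elim: s => [|u s IH] //= /andP[leu /IH]; rewrite sz_cons; lia.
Qed.

Definition argmin (U : Type) (w : U -> nat) (u0 : U) (l : seq U) : U :=
  foldl (fun b u => if w u < w b then u else b) (head u0 l) l.

Lemma argminP (U : eqType) (w : U -> nat) u0 (l : seq U) : l != [::] ->
  argmin w u0 l \in l /\ {in l, forall u, w (argmin w u0 l) <= w u}.
Proof.
suff main b r : (let a := foldl (fun b u => if w u < w b then u else b) b r in
    [/\ a \in b :: r, w a <= w b & {in r, forall u, w a <= w u}]).
  case: l => // u l _; have [in1 _ le2] := main u (u :: l).
  split; last exact: le2.
  have : argmin w u0 (u :: l) \in u :: u :: l := in1.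
  by rewrite in_cons => /predU1P[->|//]; rewrite mem_head.
elim: r b => [|u r IH] b /=; first by rewrite mem_head.
have [in1 le1 le2] := IH (if w u < w b then u else b); split.
- by move: in1; rewrite !in_cons; case: ifP => _ /orP[->|->]; rewrite ?orbT.
- by apply: (leq_trans le1); case: ltnP => // /ltnW.
- move=> v; rewrite in_cons => /predU1P[->|/le2 //].
  by apply: (leq_trans le1); case: ltnP.
Qed.

Section MoreLists.
Variables X U : etype.

(** The length comes from a list and not from a number, because [iota 0 n] is exponentially long in
    the binary size of [n]. *)
Lemma polytime_iota (l : X -> seq U) :
  polytime l -> polytime (fun x => iota 0 (size (l x))).
Proof.
have E (l' : seq U) : foldl (fun s _ => rcons s (size s)) [::] l' = iota 0 (size l').
  elim/last_ind: l' => //= r u IH.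
  rewrite size_rcons -[(size r).+1]addn1 iotaD add0n -[rcons r u]cats1 foldl_cat IH.
  by rewrite [LHS]/= size_iota cats1.
move=> pl; apply: (@polytime_ext _ _ (fun x => foldl (fun s _ => rcons s (size s)) [::] (l x))).
  by move=> x.
apply: (@polytime_foldl _ _ _ (fun _ s _ => rcons s (size s)) _ _
  (fun x => sz (l x) * (4 * sz (size (l x)) + 1).+1 + 1)) => //; try ptime.
  apply: poly_boundedD (poly_bounded_const _ _).
  apply: poly_boundedM (polytime_sz pl) _; apply: poly_boundedS.
  apply: poly_boundedD (poly_bounded_const _ _).
  by apply: poly_boundedM (poly_bounded_const _ _) _; apply: polytime_sz; ptime.
move=> x k; rewrite E; apply: leq_trans (@sz_seq_le _ _ (4 * sz (size (l x)) + 1) _) _; last first.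
  rewrite leq_add2r leq_mul2r size_iota (leq_trans (size_le_sz _)) ?orbT //.
  exact: sz_take.
apply/allP => i; rewrite mem_iota => /andP[_]; rewrite add0n => lti.
apply: leq_sz_nat; apply: leq_trans (ltnW lti) _.
by rewrite size_take; case: ltnP => // /ltnW.
Qed.

Lemma polytime_nth (u0 : U) (l : X -> seq U) (i : X -> nat) :
  polytime l -> polytime i -> polytime (fun x => nth u0 (l x) (i x)).
Proof.
move=> pl pi; apply: (@polytime_ext _ _ (fun x =>
   (foldl (fun s u => (s.1.+1, if s.1 == i x then u else s.2)) (0, u0) (l x)).2)).
  move=> x.
  have main (r : seq U) (k : nat) (v : U) :
      snd (foldl (fun s u => (s.1.+1, if s.1 == i x then u else s.2)) (k, v) r)
      = if k <= i x then nth v r (i x - k) else v.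
    elim: r k v => [|u r IH] k v /=; first by rewrite nth_nil if_same.
    rewrite IH /=; case: (ltngtP k (i x)) => [lt|gt|eq].
    - rewrite (_ : i x - k = (i x - k.+1).+1); last by lia.
      by [].
    - by [].
    - by rewrite -eq subnn.
  by rewrite main leq0n subn0.
have pi1 : polytime (fun p : X * (nat * U * U) => i p.1) by apply: polytime_comp pi _; ptime.
apply: polytime_snd; apply: (@polytime_foldl_measure _ _ _
  (fun x s u => (s.1.+1, if s.1 == i x then u else s.2)) _ _ _ _ _
  (fun s => up_log 2 s.1.+1 + sz s.2) 4 (fun p => 1 + sz p.2)) => //; try ptime.
- by case=> k u; rewrite sz_pair /=; have := sz_nat_le k; lia.
- by case=> k u; rewrite sz_pair /=; have := log_le_sz k; lia.
- by apply: poly_boundedD (poly_bounded_const _ _) _; apply: polytime_sz; ptime.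
- move=> x [k v] u /=; have : up_log 2 k.+2 <= up_log 2 k.+1 + up_log 2 2.
    by apply: log_leM; lia.
  by rewrite (_ : up_log 2 2 = 1) //; case: ifP => _; lia.
Qed.

Lemma polytime_argmin (w : X -> U -> nat) (u0 : U) (l : X -> seq U) :
  polytime (fun p : X * U => w p.1 p.2) -> polytime l ->
  polytime (fun x => argmin (w x) u0 (l x)).
Proof.
move=> pw pl; apply: (@polytime_foldl_add _ _ _
   (fun x b u => if w x u < w x b then u else b) _ _ _ _ _ (fun p => sz p.2)) => //; try ptime.
- have p1 : polytime (fun p : X * (U * U) => w p.1 p.2.1).
    by apply: (polytime_comp (f := fun p : X * (U * U) => (p.1, p.2.1)) pw); ptime.
  have p2 : polytime (fun p : X * (U * U) => w p.1 p.2.2).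
    by apply: (polytime_comp (f := fun p : X * (U * U) => (p.1, p.2.2)) pw); ptime.
  ptime.
- by apply: polytime_sz; ptime.
- by move=> x b u; case: ifP => _ /=; lia.
Qed.

End MoreLists.
#[global] Hint Resolve polytime_iota polytime_nth polytime_argmin : polytime.

(** * The primal-dual method for joins *)

Lemma count_sum (T : Type) (p : pred T) s : count p s = \sum_(e <- s) p e.
Proof. by elim: s => [|e s IH] /=; rewrite ?big_nil // big_cons IH. Qed.

Lemma odd_count_addb (T : Type) (p q : pred T) s :
  odd (count (fun e => p e (+) q e) s) = odd (count p s) (+) odd (count q s).
Proof.
by elim: s => //= e s IH; rewrite !oddD IH !oddb addbACA.
Qed.

Lemma leq_sum_sub (T : eqType) (s : seq T) (P Q : pred T) (F : T -> nat) :
  {in s, forall x, P x -> Q x} -> \sum_(x <- s | P x) F x <= \sum_(x <- s | Q x) F x.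
Proof.
move=> sub; rewrite [leqLHS]big_seq_cond [leqRHS]big_seq_cond.
rewrite big_mkcond [leqRHS]big_mkcond; apply: leq_sum => x _.
by case: ifP => // /andP[xs Px]; rewrite xs sub.
Qed.

Lemma leq_sum_seq (T : eqType) (s : seq T) (P : pred T) (F G : T -> nat) :
  {in s, forall x, P x -> F x <= G x} -> \sum_(x <- s | P x) F x <= \sum_(x <- s | P x) G x.
Proof.
move=> le; rewrite [leqLHS]big_seq_cond [leqRHS]big_seq_cond.
by apply: leq_sum => x /andP[xs Px]; apply: le.
Qed.

Definition edge : Type := (nat * nat)%type.

Section Contraction.
Variable rt : nat.
Implicit Types (lab : nat -> nat) (A : seq nat) (e : edge) (J M E : seq edge).

Definition relabel (a b x : nat) : nat := if x == a then b else x.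

(** A class is active if it avoids the root and contains an odd number of wrong facilities; hence
    the exclusive or. *)
Definition merge_active (a b : nat) A : seq nat :=
  (if (b != rt) && ((a \in A) (+) (b \in A)) then [:: b] else [::])
  ++ [seq x : nat <- A | (x != a) && (x != b)].

Definition crossing lab e : bool := lab e.1 != lab e.2.
Definition cross lab (x : nat) e : bool := (lab e.1 == x) (+) (lab e.2 == x).
(** The rate at which a uniform growth of the active classes uses up the cost of an edge. *)
Definition acts lab A e : nat := (lab e.1 \in A) + (lab e.2 \in A).

(** The degree of the root is free, so it absorbs the parity of [A]. Edges inside a class contribute
    nothing because [cross] is an exclusive or. *)
Definition join lab A J : Prop :=
  forall x, x != rt -> odd (count (cross lab x) J) = (x \in A).

(** The absorbed class [a] is never [rt], so the class of the root keeps its name. The edge is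
    stored in its original direction whichever end is absorbed. *)
Inductive merges : (nat -> nat) -> seq edge -> (nat -> nat) -> Prop :=
| merges_nil lab : merges lab [::] lab
| merges_cons lab e a b M lab' :
    crossing lab e -> (a, b) = (lab e.1, lab e.2) \/ (a, b) = (lab e.2, lab e.1) ->
    a != rt -> merges (relabel a b \o lab) M lab' -> merges lab (e :: M) lab'.

(* One step of the primal-dual method: every active class grows by [eps], an
   edge [e] becomes tight up to rounding, and its ends are merged.  The last
   argument is the total growth, i.e. the value of the dual solution. *)
Inductive run : seq edge -> (edge -> nat) -> (nat -> nat) -> seq nat ->
                seq edge -> (nat -> nat) -> seq nat -> nat -> Prop :=
| run_stop E cf lab A :
    {in E, forall e, acts lab A e = 0} -> run E cf lab A [::] lab A 0
| run_step E cf lab A e a b eps M lab' A' Y :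
    e \in E -> (a, b) = (lab e.1, lab e.2) \/ (a, b) = (lab e.2, lab e.1) ->
    a != rt -> {in E, forall f, eps * acts lab A f <= cf f} ->
    cf e <= eps * acts lab A e + 1 ->
    run [seq f <- E | crossing (relabel a b \o lab) f]
        (fun f => cf f - eps * acts lab A f) (relabel a b \o lab)
        (merge_active a b A) M lab' A' Y ->
    run E cf lab A (e :: M) lab' A' (eps * size A + Y).

Lemma merge_active_uniq a b A : uniq A -> uniq (merge_active a b A).
Proof.
move=> uA; rewrite /merge_active; case: ifP => _; rewrite /= filter_uniq //.
by rewrite mem_filter eqxx andbF.
Qed.

Lemma mem_merge_active a b A : rt \notin A -> rt \notin merge_active a b A.
Proof.
move=> nrt; rewrite /merge_active mem_cat mem_filter (negPf nrt) !andbF orbF.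
by case: ifP => // /andP[brt _]; rewrite inE eq_sym.
Qed.

Lemma cross_relabel a b lab x e : a != b ->
  cross (relabel a b \o lab) x e =
  if x == a then false else if x == b then cross lab a e (+) cross lab b e
  else cross lab x e.
Proof.
move=> ab; rewrite /cross /relabel /=; set u := lab _; set v := lab _.
have aux w : ((if w == a then b else w) == x) =
    if x == a then false else if x == b then (w == a) (+) (w == b) else w == x.
  case: (eqVneq x a) => [->|xa]; first by case: (eqVneq w a) => [_|/negPf //]; rewrite eq_sym (negPf ab).
  case: (eqVneq x b) => [->|xb].
    by case: (eqVneq w a) => [->|]; rewrite ?eqxx ?(negPf ab).
  by case: (eqVneq w a) => [->|//]; rewrite eq_sym (negPf xb) [RHS]eq_sym (negPf xa).
rewrite !aux; case: ifP => // _; case: ifP => // _.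
by rewrite addbACA.
Qed.

Lemma join_relabel a b lab A J : a != b ->
  join lab A J -> a != rt -> join (relabel a b \o lab) (merge_active a b A) J.
Proof.
move=> ab jJ art x xrt; rewrite (eq_count (fun e => cross_relabel lab x e ab)).
rewrite /merge_active mem_cat mem_filter.
case: (eqVneq x a) => [->|xa].
  by rewrite count_pred0 /= orbF; case: ifP => //; rewrite inE (negPf ab).
case: (eqVneq x b) => [xb|xb]; last first.
  by rewrite jJ //; case: ifP => //; rewrite inE (negPf xb).
subst b; rewrite odd_count_addb !jJ // andbF orbF xrt /=.
by case: ifP; rewrite // inE eqxx.
Qed.

Lemma join_cons_internal lab A e J :
  ~~ crossing lab e -> join lab A (e :: J) -> join lab A J.
Proof.
move=> ncr jJ x /jJ /=; move: ncr; rewrite /crossing /cross negbK => /eqP->.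
by rewrite addbb.
Qed.

Lemma acts_sum lab A e : uniq A -> crossing lab e ->
  acts lab A e = \sum_(x <- A) cross lab x e.
Proof.
rewrite /crossing /acts /cross => uA; set u := lab _; set v := lab _ => uv.
rewrite -!(count_uniq_mem _ uA) !count_sum -big_split /=; apply: eq_bigr => x _.
by rewrite !(eq_sym x); case: (eqVneq u x) uv => [->|_]; case: (eqVneq v x) => // ->;
   rewrite ?eqxx.
Qed.

Lemma sum_acts lab A J : uniq A ->
  \sum_(e <- J | crossing lab e) acts lab A e = \sum_(x <- A) count (cross lab x) J.
Proof.
move=> uA; rewrite (eq_bigr _ (fun e cr => acts_sum uA cr)) exchange_big /=.
apply: eq_bigr => x _; rewrite count_sum big_mkcond /=; apply: eq_bigr => e _.
by rewrite /crossing /cross; case: (eqVneq (lab e.1)) => [->|//]; rewrite addbb.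
Qed.

Lemma runE_merge E lab e a b : {in E, forall f, crossing lab f} -> e \in E ->
  (a, b) = (lab e.1, lab e.2) \/ (a, b) = (lab e.2, lab e.1) ->
  a != b /\ ~~ crossing (relabel a b \o lab) e.
Proof.
move=> crE eE ab; have := crE _ eE; rewrite /crossing /relabel /=.
case: ab => -[-> ->] ne; split=> //; rewrite ?[lab e.2 == _]eq_sym //.
  by rewrite negbK eqxx (negPf ne).
by rewrite negbK eqxx (negPf ne).
Qed.

(** Weak duality. A join crosses every active class an odd number of times, hence at least once, so
    growing all of them by [eps] uses up at least [eps * size A] of its cost. It remains a join
    after the contraction, so the phases add up. *)
Lemma run_lower_bound E cf lab A M lab' A' Y J : run E cf lab A M lab' A' Y ->
  uniq A -> {in E, forall e, crossing lab e} ->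
  rt \notin A -> {in J, forall e, crossing lab e -> e \in E} -> join lab A J ->
  Y <= \sum_(e <- J | crossing lab e) cf e.
Proof.
move=> r; elim: r => // {E cf lab A M lab' A' Y}.
move=> E cf lab A e a b eps M lab' A' Y eE ab art epsE tight _ IH uA crE nrt JE jJ.
have [neab ncr] := runE_merge crE eE ab.
set lab1 := relabel a b \o lab in IH ncr *.
have sub f : crossing lab1 f -> crossing lab f.
  by rewrite /crossing /lab1 /=; apply: contraNneq => ->.
have {}IH : Y <= \sum_(f <- J | crossing lab1 f) (cf f - eps * acts lab A f).
  apply: IH; first exact: merge_active_uniq.
  - by move=> f; rewrite mem_filter => /andP[].
  - exact: mem_merge_active.
  - by move=> f fJ cr1; rewrite mem_filter cr1 JE // sub.
  - exact: join_relabel.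
apply: (@leq_trans (\sum_(f <- J | crossing lab f) (eps * acts lab A f + (cf f - eps * acts lab A f)))).
  rewrite big_split /= -big_distrr /= sum_acts // leq_add //; last first.
    by apply: (leq_trans IH); apply: leq_sum_sub => f _; apply: sub.
  rewrite leq_mul2l -sum1_size; apply/orP; right; apply: leq_sum_seq => x xA _.
  have xrt : x != rt by apply: contraNneq nrt => <-.
  by have := jJ x xrt; rewrite xA; case: count.
by apply: leq_sum_seq => f fJ cr; rewrite subnKC // epsE // JE.
Qed.

Lemma run_join E cf lab A M lab' A' Y J : run E cf lab A M lab' A' Y ->
  {in E, forall e, crossing lab e} -> join lab A J -> join lab' A' J.
Proof.
elim=> // {E cf lab A M lab' A' Y}.
move=> E cf lab A e a b eps M lab' A' Y eE ab art _ _ _ IH crE jJ.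
have [neab _] := runE_merge crE eE ab.
by apply: IH; [move=> f; rewrite mem_filter => /andP[] | apply: join_relabel].
Qed.

Lemma run_sub E cf lab A M lab' A' Y : run E cf lab A M lab' A' Y -> {subset M <= E}.
Proof.
elim=> // {E cf lab A M lab' A' Y} E cf lab A e a b eps M lab' A' Y eE _ _ _ _ _ IH f.
by rewrite inE => /predU1P[->//|/IH]; rewrite mem_filter => /andP[].
Qed.

Lemma run_merges E cf lab A M lab' A' Y : run E cf lab A M lab' A' Y ->
  {in E, forall e, crossing lab e} -> merges lab M lab'.
Proof.
elim=> {E cf lab A M lab' A' Y} [*|]; first exact: merges_nil.
move=> E cf lab A e a b eps M lab' A' Y eE ab art _ _ _ IH crE.
apply: (merges_cons (crE _ eE) ab art); apply: IH => f.
by rewrite mem_filter => /andP[].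
Qed.

(* All classes without crossing edges are inactive as soon as a join exists. *)
Lemma run_inactive E cf lab A M lab' A' Y J : run E cf lab A M lab' A' Y ->
  uniq A -> rt \notin A -> {in E, forall e, crossing lab e} ->
  {in J, forall e, crossing lab e -> e \in E} -> join lab A J -> A' = [::].
Proof.
elim=> {E cf lab A M lab' A' Y} [E cf lab A act0|].
  move=> uA nrt crE JE jJ; case: A act0 uA nrt jJ => // x A act0 _ nrt jJ.
  have xrt : x != rt by apply: contraNneq nrt => <-; rewrite mem_head.
  have := jJ x xrt; rewrite mem_head => oddx.
  have /hasP[e eJ cre] : has (cross lab x) J by rewrite has_count; case: count oddx.
  have cr : crossing lab e.
    by move: cre; rewrite /cross /crossing; apply: contraTneq => ->; rewrite addbb.
  have := act0 e (JE e eJ cr); move: cre; rewrite /cross /acts !inE.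
  by case: (lab e.1 == x); case: (lab e.2 == x); rewrite //= ?addn1.
move=> E cf lab A e a b eps M lab' A' Y eE ab art _ _ _ IH uA nrt crE JE jJ.
have [neab _] := runE_merge crE eE ab; apply: IH.
- exact: merge_active_uniq.
- exact: mem_merge_active.
- by move=> f; rewrite mem_filter => /andP[].
- move=> f fJ cr; rewrite mem_filter cr JE //; move: cr.
  by rewrite /crossing /=; apply: contraNneq => ->.
- exact: join_relabel.
Qed.

Definition ends lab J : seq nat := undup ([seq lab e.1 | e <- J] ++ [seq lab e.2 | e <- J]).

Lemma mem_ends lab J x :
  (x \in ends lab J) = has (fun e => (lab e.1 == x) || (lab e.2 == x)) J.
Proof.
rewrite mem_undup mem_cat; apply/orP/hasP => [[]/mapP[e eJ ->]|[e eJ /orP[]/eqP<-]].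
- by exists e; rewrite ?eqxx.
- by exists e; rewrite ?eqxx ?orbT.
- by left; apply: map_f (fun e => lab e.1) _ _ eJ.
- by right; apply: map_f (fun e => lab e.2) _ _ eJ.
Qed.

(** Each contraction joins distinct classes, so the edges of [M], and any selection of them, form a
    forest. In the induction, contracting a selected edge loses an edge and at least one vertex,
    while contracting an unselected one adds no vertex. *)
Lemma merges_forest lab M lab' p : merges lab M lab' -> has p M ->
  size [seq e <- M | p e] < size (ends lab [seq e <- M | p e]).
Proof.
elim=> // {lab M lab'} lab e a b M lab' cr ab art _ IH.
set lab1 := relabel a b \o lab in IH; set J1 := [seq f <- M | p f] in IH.
have ends1 J : size (ends lab1 J) <= size (ends lab J).
  rewrite -(size_map (relabel a b) (ends lab J)); apply: uniq_leq_size; first exact: undup_uniq.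
  move=> x; rewrite mem_ends => /hasP[f fJ /orP[]/eqP<-]; apply: map_f;
    by rewrite mem_ends; apply/hasP; exists f; rewrite ?eqxx ?orbT.
rewrite /= -/J1; case: ifP => [pe _|_ /= hM]; last exact: leq_trans (IH hM) (ends1 _).
have ltends : size (ends lab1 J1) < size (ends lab (e :: J1)).
  have neab : lab e.1 != lab e.2 := cr.
  have e1 : lab e.1 \in ends lab (e :: J1) by rewrite mem_ends /= eqxx.
  have e2 : lab e.2 \in ends lab (e :: J1) by rewrite mem_ends /= eqxx orbT.
  have aE : a \in ends lab (e :: J1) by case: ab => -[-> _].
  have bE : b \in rem a (ends lab (e :: J1)).
    rewrite mem_rem_uniq ?undup_uniq // inE; case: ab => -[-> ->]; rewrite ?e1 ?e2 ?andbT //.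
    by rewrite eq_sym.
  rewrite -(prednK (n := size (ends lab (e :: J1)))); last by case: (ends _ _) aE.
  rewrite ltnS -(size_rem aE) -(size_map (relabel a b) (rem a _)).
  apply: uniq_leq_size; first exact: undup_uniq.
  move=> x; rewrite mem_ends => /hasP[f fJ fx].
  have [y yE <-] : exists2 y, y \in ends lab (e :: J1) & relabel a b y = x.
    case/orP: fx => /eqP<-; [exists (lab f.1) | exists (lab f.2)] => //;
      by rewrite mem_ends /=; apply/orP; right; apply/hasP; exists f; rewrite ?eqxx ?orbT.
  case: (eqVneq y a) => [->|ya].
    rewrite (_ : relabel a b a = relabel a b b) ?map_f //.
    by rewrite /relabel eqxx if_same.
  by apply: map_f; rewrite mem_rem_uniq ?undup_uniq // inE ya.
case hM: (has p M); first exact: leq_ltn_trans (IH hM) ltends.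
have J0 : J1 = [::] by apply/eqP; rewrite -size_eq0 size_filter eqn0Ngt -has_count hM.
have : uniq [:: lab e.1; lab e.2] by rewrite /= inE andbT.
rewrite J0 => /uniq_leq_size; apply=> x; rewrite !inE mem_ends /= orbF.
by rewrite ![x == _]eq_sym.
Qed.

(* In a forest the degrees average less than 2, and the inactive vertices have
   even degree, so those that matter have degree at least 2. *)
Lemma active_degrees lab A J : uniq A -> {in J, forall e, crossing lab e} ->
  (J != [::] -> size J < size (ends lab J)) -> join lab A J ->
  \sum_(x <- A) count (cross lab x) J <= 2 * size A.
Proof.
move=> uA crJ forestJ jJ; case: (eqVneq J [::]) forestJ => [-> _|_ /(_ isT) lt].
  by rewrite big1.
set deg := fun x => count (cross lab x) J; set V := ends lab J in lt.
have uV : uniq V by apply: undup_uniq.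
have deg0 x : x \notin V -> deg x = 0.
  rewrite mem_ends; apply: contraNeq; rewrite -lt0n -has_count => /hasP[e eJ].
  by rewrite /cross => c; apply/hasP; exists e => //; move: c; do 2?case: eqP.
have deg_gt0 x : x \in V -> 0 < deg x.
  rewrite mem_ends -has_count => /hasP[e eJ c]; apply/hasP; exists e => //.
  have := crJ e eJ; move: c; rewrite /cross /crossing.
  by case: eqP => [->|_] /=; rewrite ?[_ == x]eq_sym ?(eq_sym _ x) => //; case: eqP => // _ /negPf->.
have degV : \sum_(x <- V) deg x <= 2 * size J.
  rewrite -sum_acts // -sum1_size big_distrr /= [leqRHS](bigID (crossing lab)) /=.
  apply: leq_trans (leq_addr _ _); apply: leq_sum => e _.
  by rewrite /acts; case: (_ \in _); case: (_ \in _).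
have degA : \sum_(x <- A) deg x = \sum_(x <- V | x \in A) deg x.
  rewrite (bigID (mem V)) /= [X in _ + X]big1 ?addn0; last by move=> x /deg0.
  rewrite -big_filter -[RHS]big_filter; apply: perm_big; apply: uniq_perm; rewrite ?filter_uniq //.
  by move=> x; rewrite !mem_filter andbC.
(* The root may be inactive and have degree 1. The missing unit is covered by the strict inequality
   between the numbers of edges and vertices. *)
have even2 : 2 * count (fun x => x \notin A) V <=
    \sum_(x <- V | x \notin A) deg x + count (pred1 rt) V.
  rewrite !count_sum big_distrr /= [X in _ <= X + _]big_mkcond -big_split /= .
  rewrite big_seq [leqRHS]big_seq; apply: leq_sum => x xV; rewrite /= .
  case: (boolP (x \in A)) => //= xA; case: (eqVneq x rt) => [_|xrt].
    by have := deg_gt0 x xV; lia.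
  by have := jJ x xrt; rewrite -/(deg x) (negPf xA); have := deg_gt0 x xV; lia.
have cA : count (mem A) V <= size A.
  rewrite -size_filter; apply: uniq_leq_size; first exact: filter_uniq.
  by move=> x; rewrite mem_filter => /andP[].
have cV : count (mem A) V + count (fun x => x \notin A) V = size V := count_predC _ _.
move: degV; rewrite (bigID (mem A)) /= -degA => degV.
move: even2; rewrite (count_uniq_mem rt uV) => even2.
suff : \sum_(x <- A) deg x <= 2 * size A by [].
move: even2 lt degV cV cA; set S1 := \sum_(x <- A) _; set S2 := \sum_(x <- V | _) _.
set c1 := count (mem A) V; set c2 := count _ V.
by case: (rt \in V) => /=; lia.
Qed.

Lemma join_filter_cons lab A p e M : ~~ crossing lab e ->
  join lab A [seq f <- e :: M | p f] -> join lab A [seq f <- M | p f].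
Proof. by move=> ncr /=; case: ifP => // _; apply: join_cons_internal. Qed.

(** One phase takes [eps] times the degrees of the active classes from the selected edges, which by
    [active_degrees] is at most twice the dual growth. The unit that rounding may leave on a tight
    edge is counted once, when that edge is contracted, and only if its cost is positive. *)
Lemma run_upper_bound E cf lab A M lab' A' Y p : run E cf lab A M lab' A' Y ->
  uniq A -> rt \notin A -> {in E, forall e, crossing lab e} ->
  join lab A [seq e <- M | p e] ->
  \sum_(e <- M | p e) cf e <= 2 * Y + count (fun e => p e && (0 < cf e)) M.
Proof.
move=> r; move: (r); elim: r => [*|]; first by rewrite big_nil.
move=> {E cf lab A M lab' A' Y} E cf lab A e a b eps M lab' A' Y eE ab art epsE tight r IH r0.
move=> uA nrt crE jM; have [neab ncr] := runE_merge crE eE ab.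
set lab1 := relabel a b \o lab in IH r ncr *.
have crM : {in e :: M, forall f, crossing lab f} by move=> f /(run_sub r0)/crE.
have {}IH : \sum_(f <- M | p f) (cf f - eps * acts lab A f) <=
    2 * Y + count (fun f => p f && (0 < cf f)) M.
  apply: (leq_trans (IH r _ _ _ _)).
  - exact: merge_active_uniq.
  - exact: mem_merge_active.
  - by move=> f; rewrite mem_filter => /andP[].
  - by apply: (join_filter_cons (e := e)) => //; apply: join_relabel.
  - rewrite leq_add2l; apply: sub_count => f /= /andP[-> /leq_trans->] //.
    exact: leq_subr.
have degs : \sum_(f <- e :: M | p f) acts lab A f <= 2 * size A.
  have := active_degrees uA _ _ jM; rewrite -sum_acts // => le.
  apply: leq_trans (le _ _) => [|f|].
  - rewrite big_filter_cond; apply: leq_sum_sub => f fM pf /=.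
    by rewrite pf crM.
  - by rewrite mem_filter => /andP[_ /crM].
  - move=> ne; apply: (merges_forest (run_merges r0 crE)).
    by rewrite has_filter.
have rest : \sum_(f <- M | p f) cf f <= \sum_(f <- M | p f) (cf f - eps * acts lab A f)
    + eps * \sum_(f <- M | p f) acts lab A f.
  rewrite big_distrr -big_split /=; apply: leq_sum => f _; lia.
move: degs; rewrite !big_cons /=; case: (p e) => /= degs; last by nia.
have : cf e <= eps * acts lab A e + (0 < cf e).
  by case: (cf e) tight => //= c; rewrite addn1.
nia.
Qed.

End Contraction.

(* An edge of the contracted graph: its original ends, their current classes
   and its residual cost. *)
Definition cedge : Type := (nat * nat * (nat * nat) * nat)%type.

Definition cacts (A : seq nat) (e : cedge) : nat := (e.1.2.1 \in A) + (e.1.2.2 \in A).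
Definition gw_src (rt : nat) (e : cedge) : nat :=
  if e.1.2.1 == rt then e.1.2.2 else e.1.2.1.
Definition gw_dst (rt : nat) (e : cedge) : nat :=
  if e.1.2.1 == rt then e.1.2.1 else e.1.2.2.
Definition gw_update (eps a b : nat) (A : seq nat) (e : cedge) : cedge :=
  (e.1.1, (relabel a b e.1.2.1, relabel a b e.1.2.2), e.2 - eps * cacts A e).
Definition gw_growth (A : seq nat) (e : cedge) : nat := e.2 %/ cacts A e.
Definition gw_next (A : seq nat) (E : seq cedge) : cedge :=
  argmin (gw_growth A) (0, 0, (0, 0), 0) [seq e <- E | 0 < cacts A e].
Definition gw_contract (rt : nat) (e : cedge) (A : seq nat) (E : seq cedge) : seq cedge :=
  [seq f : cedge <- [seq gw_update (gw_growth A e) (gw_src rt e) (gw_dst rt e) A f | f <- E]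
  | f.1.2.1 != f.1.2.2].

Definition gw_state : Type := (seq cedge * (seq nat * seq (nat * nat)))%type.

Definition gw_step (rt : nat) (st : gw_state) : gw_state :=
  if nilp [seq e <- st.1 | 0 < cacts st.2.1 e] then st
  else let e := gw_next st.2.1 st.1 in
    (gw_contract rt e st.2.1 st.1,
     (merge_active rt (gw_src rt e) (gw_dst rt e) st.2.1, rcons st.2.2 e.1.1)).

(** The fold over [E] uses it only as fuel: a step makes its chosen edge internal and thereby
    deletes it, so [size E] steps suffice. *)
Definition gw (rt : nat) (E : seq cedge) (A : seq nat) : seq (nat * nat) :=
  (foldl (fun st _ => gw_step rt st) (E, (A, [::])) E).2.2.

Definition represent (E : seq edge) (cf : edge -> nat) (lab : nat -> nat) : seq cedge :=
  [seq (e, (lab e.1, lab e.2), cf e) | e <- E].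

(** * The executable loop performs a run *)

Section GWRun.
Variable rt : nat.

Lemma gw_foldl_run (T : Type) (fuel : seq T) E cf lab A M0 :
  size E <= size fuel -> {in E, forall e, crossing lab e} ->
  exists M lab' A' Y, run rt E cf lab A M lab' A' Y /\
    (foldl (fun st _ => gw_step rt st) (represent E cf lab, (A, M0)) fuel).2.2 = M0 ++ M.
Proof.
elim: fuel E cf lab A M0 => [|z fuel IH] E cf lab A M0.
  rewrite leqn0 size_eq0 => /eqP-> _; exists [::], lab, A, 0; split; last by rewrite cats0.
  exact: run_stop.
move=> szE crE /=; rewrite {2}/gw_step /=.
set cand := [seq e <- _ | _]; case: (boolP (nilp cand)) => [nc|nc].
  have act0 : {in E, forall e, acts lab A e = 0}.
    move=> e eE; apply/eqP; rewrite eqn0Ngt; apply/negP => gt0.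
    suff : (e, (lab e.1, lab e.2), cf e) \in cand by rewrite (nilP nc).
    by rewrite mem_filter gt0; apply: map_f.
  exists [::], lab, A, 0; split; first exact: run_stop.
  rewrite cats0 (_ : foldl _ _ _ = (represent E cf lab, (A, M0))) //.
  by elim: fuel {IH szE} => //= z' fuel IH; rewrite {2}/gw_step /= -/cand nc.
have candE : cand = [seq (e, (lab e.1, lab e.2), cf e) | e <- E & 0 < acts lab A e].
  by rewrite /cand /represent filter_map.
have [] := @argminP _ (gw_growth A) (0, 0, (0, 0), 0) cand; first by apply: contraNneq nc => ->.
rewrite -/(gw_next A (represent E cf lab)); move: (gw_next _ _) => ce.
rewrite {1}candE => /mapP[e]; rewrite mem_filter => /andP[gt0 eE] -> {ce} minP.
set eps := gw_growth A _ in minP *; set a := gw_src rt _; set b := gw_dst rt _.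
have ab : (a, b) = (lab e.1, lab e.2) \/ (a, b) = (lab e.2, lab e.1).
  by rewrite /a /b /gw_src /gw_dst /=; case: ifP => _; [right | left].
have art : a != rt.
  rewrite /a /gw_src /=; case: ifP => [/eqP<-|->//]; rewrite eq_sym; exact: crE.
have [neab ncr] := runE_merge crE eE ab.
set E' := [seq f <- E | crossing (relabel a b \o lab) f].
have rE : gw_contract rt (e, (lab e.1, lab e.2), cf e) A (represent E cf lab) =
    represent E' (fun f => cf f - eps * acts lab A f) (relabel a b \o lab).
  by rewrite /gw_contract /represent -map_comp filter_map.
have szE' : size E' <= size fuel.
  rewrite -ltnS; apply: leq_trans szE; rewrite size_filter ltn_neqAle count_size andbT.
  by rewrite -all_count; apply/allPn; exists e.
have [|M [lab' [A' [Y [r res]]]]] := IH E' (fun f => cf f - eps * acts lab A f)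
    (relabel a b \o lab) (merge_active rt a b A) (rcons M0 e) szE'.
  by move=> f; rewrite mem_filter => /andP[].
exists (e :: M), lab', A', (eps * size A + Y); split; last by rewrite rE res cat_rcons.
apply: run_step r => // [f fE|].
  case: (posnP (acts lab A f)) => [->|gtf]; first by rewrite muln0.
  have := minP (f, (lab f.1, lab f.2), cf f); rewrite candE => /(_ _) le.
  have {}le : eps <= cf f %/ acts lab A f.
    by apply: le; apply: map_f; rewrite mem_filter gtf.
  by apply: leq_trans (leq_trunc_div _ (acts lab A f)); rewrite leq_mul2r le orbT.
(* The divisor [acts lab A e] is 1 or 2, so the remainder is at most 1. This is the whole loss due
   to rounding. *)
have -> : eps = cf e %/ acts lab A e by [].
rewrite {1}(divn_eq (cf e) (acts lab A e)) leq_add2l -ltnS.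
by apply: (leq_trans (ltn_pmod _ gt0)); rewrite /acts; case: (_ \in _); case: (_ \in _).
Qed.

Lemma gw_run E cf A : {in E, forall e, e.1 != e.2} ->
  exists lab' A' Y,
    run rt E cf id A (gw rt [seq (e, e, cf e) | e <- E] A) lab' A' Y.
Proof.
move=> ne; have -> : [seq (e, e, cf e) | e <- E] = represent E cf id.
  by apply: eq_map => -[u v].
have [|M [lab' [A' [Y [r e]]]]] :=
  @gw_foldl_run _ (represent E cf id) E cf id A [::] _ ne; first by rewrite size_map.
by exists lab', A', Y; rewrite /gw e.
Qed.

End GWRun.

(** * Rooted forests as elimination orders *)

(* A rooted forest is listed as edges (child, parent), a child being listed
   after all its own children. *)
Fixpoint elim_order (l : seq edge) : bool :=
  if l is e :: l' then
    [&& e.1 != e.2, e.1 \notin [seq f.1 | f <- l'], e.1 \notin [seq f.2 | f <- l']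
      & elim_order l']
  else true.

(** Reverses the path from [v] to its root. The reversed edges go to the end, the one into [v] last,
    since each vertex of the path has to wait for its other children. *)
Fixpoint reroot (v : nat) (l : seq edge) : seq edge :=
  if l is e :: l' then
    if e.1 == v then rcons (reroot e.2 l') (e.2, v) else e :: reroot v l'
  else [::].

Fixpoint root_of (v : nat) (l : seq edge) : nat :=
  if l is e :: l' then root_of (if e.1 == v then e.2 else v) l' else v.

Definition symmetric_weight (g : edge -> nat) : Prop := forall u v, g (u, v) = g (v, u).

Lemma reroot_sum g v l : symmetric_weight g ->
  \sum_(e <- reroot v l) g e = \sum_(e <- l) g e.
Proof.
move=> gS; elim: l v => //= -[x y] l IH v /=; case: eqP => [->|_].
  by rewrite big_rcons big_cons IH /= gS addnC.
by rewrite !big_cons IH.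
Qed.

(** Roots are the vertices that are not children: [v] takes over this role from its old root, and
    nothing else changes. *)
Lemma perm_reroot v l :
  perm_eq (v :: [seq e.1 | e <- reroot v l]) (root_of v l :: [seq e.1 | e <- l]).
Proof.
elim: l v => //= -[x y] l IH v /=; apply/permP => p.
case: eqP => [->|_]; rewrite ?map_rcons -?cats1 /= ?count_cat /=.
  by have /permP/(_ p) /= := IH y; lia.
by have /permP/(_ p) /= := IH v; lia.
Qed.

Lemma elim_order_rcons l u v : elim_order (rcons l (u, v)) =
  [&& elim_order l, u != v & all (fun e => (e.1 != u) && (e.1 != v)) l].
Proof.
elim: l => [|[x y] l IH] /=; first by rewrite !andbT.
rewrite IH !map_rcons !mem_rcons !inE !negb_or /=.
case: (x != y) => //=; case: (x != u); case: (x != v); rewrite /= ?andbF //.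
by rewrite -!andbA.
Qed.

Lemma elim_order_uniq v l : elim_order l -> uniq (root_of v l :: [seq e.1 | e <- l]).
Proof.
elim: l v => //= -[x y] l IH v /= /and4P[xy x1 x2 /IH /= el].
have {el} /andP[r1 u1] := el (if x == v then y else v); rewrite x1 u1 !inE !andbT.
rewrite negb_or r1 andbT.
suff main w : w != x -> root_of w l != x by apply: main; case: (eqVneq x v) => [_|]; rewrite eq_sym.
elim: l w {IH r1 u1 x1} x2 => //= -[z t] l IH w; rewrite inE negb_or => /andP[/= xt x2] wx.
by apply: IH => //; case: ifP => // _; rewrite eq_sym.
Qed.

Lemma mem_reroot v l x : elim_order l ->
  (x \in [seq e.1 | e <- reroot v l]) =
  (x != v) && ((x == root_of v l) || (x \in [seq e.1 | e <- l])).
Proof.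
move=> el; have P := perm_reroot v l.
have := perm_uniq P; rewrite elim_order_uniq //= => /andP[nv _].
have := perm_mem P x; rewrite !inE => <-.
by case: eqP => //= ->; rewrite (negPf nv).
Qed.

Lemma reroot_verts v l : {subset [seq e.1 | e <- reroot v l] ++ [seq e.2 | e <- reroot v l]
  <= [seq e.1 | e <- l] ++ [seq e.2 | e <- l]}.
Proof.
move=> z; elim: l v => //= -[x y] l IH v; case: eqP => [<-|_] /=.
  rewrite !map_rcons /= !(mem_cat, mem_rcons, inE) -!orbA.
  have := IH y; rewrite !mem_cat => {}IH.
  case/or4P => [->|zl|->|zl]; rewrite ?orbT //; move: IH;
    by rewrite zl ?orbT => /(_ isT)/orP[]->; rewrite ?orbT.
rewrite !(mem_cat, inE); have := IH v; rewrite !mem_cat => {}IH.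
case/or4P => [->|zl|->|zl]; rewrite ?orbT //; move: IH;
  by rewrite zl ?orbT => /(_ isT)/orP[]->; rewrite ?orbT.
Qed.

Lemma elim_order_reroot v l : elim_order l -> elim_order (reroot v l).
Proof.
elim: l v => //= -[x y] l IH v /= /and4P[xy x1 x2 el].
have nx w : x \notin [seq e.1 | e <- reroot w l] ++ [seq e.2 | e <- reroot w l].
  by apply: contra (@reroot_verts w l x) _; rewrite mem_cat negb_or x1.
case: eqP => [<-|_] /=; last by rewrite xy IH // andbT -negb_or -mem_cat nx.
rewrite elim_order_rcons IH //= eq_sym xy /=; apply/allP => e el'.
have e1 : e.1 \in [seq e.1 | e <- reroot y l] by apply: map_f.
apply/andP; split; first by move: e1; rewrite mem_reroot // => /andP[].
by apply: contraNneq (nx y) => <-; rewrite mem_cat e1.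
Qed.

Definition consistent (lab : nat -> nat) (l : seq edge) : bool :=
  all (fun e => lab e.1 == lab e.2) l.

Lemma consistent_reroot lab v l : consistent lab l -> consistent lab (reroot v l).
Proof.
elim: l v => //= -[x y] l IH v /= /andP[xy cl]; case: eqP => [<-|_] /=.
  by rewrite /consistent all_rcons /= eq_sym xy; apply: IH.
by rewrite xy; apply: IH.
Qed.

Lemma root_of_lab lab v l : consistent lab l -> lab (root_of v l) = lab v.
Proof.
elim: l v => //= -[x y] l IH v /= /andP[/eqP xy cl]; rewrite IH //.
by case: eqP => [<-|].
Qed.

(** Together with [consistent], this makes each class a single tree, because two trees in one class
    would give it two roots. A vertex without edges counts as a tree. *)
Definition rooted (lab : nat -> nat) (l : seq edge) : Prop :=
  forall p q, lab p = lab q -> p \notin [seq e.1 | e <- l] ->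
    q \notin [seq e.1 | e <- l] -> p = q.

Lemma rooted_reroot lab v l : elim_order l -> consistent lab l ->
  rooted lab l -> rooted lab (reroot v l).
Proof.
move=> el cl rl; have /andP[rn _] := elim_order_uniq v el.
have rv := root_of_lab v cl.
have aux q : lab q = lab v -> ~~ ((q == root_of v l) || (q \in [seq e.1 | e <- l])) -> q = v.
  move=> qv; rewrite negb_or => /andP[/eqP qr nq].
  by case: qr; apply: rl => //; rewrite rv.
move=> p q pq; rewrite !mem_reroot //.
case: (eqVneq p v) => [pv|pv]; case: (eqVneq q v) => [qv|qv] /=; rewrite ?pv ?qv in pq *; try done.
- by move=> _ /(aux _ (esym pq)) ->.
- by move=> /(aux _ pq) ->.
- by rewrite !negb_or => /andP[_ np] /andP[_ nq]; apply: rl.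
Qed.

Definition link (l : seq edge) (e : edge) : seq edge :=
  rcons (reroot e.2 (reroot e.1 l)) (e.2, e.1).

(** Both ends of a new edge are made roots and the second is hung below the first. Rerooting
    reverses edges, so the forest and [M] agree only as undirected graphs; sums of symmetric weights
    express this. *)
Lemma link_inv rt lab M lab' l : merges rt lab M lab' ->
  elim_order l -> consistent lab l -> rooted lab l ->
  [/\ elim_order (foldl link l M), consistent lab' (foldl link l M),
      rooted lab' (foldl link l M)
    & forall g, symmetric_weight g ->
        \sum_(e <- foldl link l M) g e = \sum_(e <- l) g e + \sum_(e <- M) g e].
Proof.
move=> mg; elim: mg l => {lab M lab'} [lab|lab [u v] a b M lab' cr ab _ _ IH] l el cl rl.
  by split=> // g _; rewrite big_nil addn0.
set lab1 := relabel a b \o lab in IH; pose l1 := reroot u l; pose l2 := reroot v l1.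
have [el1 cl1 rl1] : [/\ elim_order l1, consistent lab l1 & rooted lab l1].
  by split; [apply: elim_order_reroot | apply: consistent_reroot | apply: rooted_reroot].
have [el2 cl2 rl2] : [/\ elim_order l2, consistent lab l2 & rooted lab l2].
  by split; [apply: elim_order_reroot | apply: consistent_reroot | apply: rooted_reroot].
have uv : lab u != lab v := cr.
have nu1 : u \notin [seq e.1 | e <- l1] by rewrite mem_reroot // eqxx.
have nv2 : v \notin [seq e.1 | e <- l2] by rewrite mem_reroot // eqxx.
have nu2 : u \notin [seq e.1 | e <- l2].
  rewrite mem_reroot // (negPf nu1) orbF negb_and; apply/orP; right.
  by apply: contraNneq uv => ->; rewrite root_of_lab.
have luv : lab1 v = lab1 u.
  by rewrite /lab1 /relabel /=; case: ab => -[-> ->]; rewrite eqxx if_same.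
have sub x y : lab x = lab y -> lab1 x = lab1 y by rewrite /lab1 /= => ->.
have [] := IH (link l (u, v)).
- rewrite elim_order_rcons el2 /=; apply/andP; split.
    by apply: contraNneq uv => ->.
  apply/allP => e e2; have e1 : e.1 \in [seq e.1 | e <- l2] by apply: map_f.
  by apply/andP; split; [apply: contraNneq nv2 | apply: contraNneq nu2] => <-.
- rewrite /consistent all_rcons /= luv eqxx /=.
  by apply/allP => e /(allP cl2)/eqP/sub->.
- move=> p q; rewrite /link /= map_rcons !mem_rcons !inE !negb_or /= => pq.
  move=> /andP[pv np] /andP[qv nq].
  case: (eqVneq (lab p) (lab q)) => [e|ne]; first exact: rl2.
  (* Only the classes of [u] and [v] have been merged, so one of [p] and [q] comes from the class of
     [v]. The only vertex there that was not a child was [v], which is now a child of [u]. *)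
  have [e|e] : lab p = lab v \/ lab q = lab v.
    have vab : lab v = a \/ lab v = b by case: ab => -[-> ->]; auto.
    move: pq ne; rewrite /lab1 /relabel /=.
    case: (eqVneq (lab p) a) => [->|pa]; case: (eqVneq (lab q) a) => [->|qa].
    - by rewrite ?eqxx.
    - by move=> <- _; case: vab => ->; auto.
    - by move=> -> _; case: vab => ->; auto.
    - by move=> ->; rewrite ?eqxx.
  + by move: pv; rewrite (rl2 _ _ e np nv2) eqxx.
  + by move: qv; rewrite (rl2 _ _ e nq nv2) eqxx.
move=> el3 cl3 rl3 sum3; split=> // g gS.
by rewrite sum3 // big_rcons !reroot_sum // big_cons /= [g (v, u)]gS addnAC addnA addnAC.
Qed.

(** The last rerooting turns [rt] into a root, so that tokens in its tree can be discharged
    there. *)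
Definition forest_of (rt : nat) (M : seq edge) : seq edge :=
  reroot rt (foldl link [::] M).

Lemma forest_ofP rt M lab : merges rt id M lab ->
  [/\ elim_order (forest_of rt M), consistent lab (forest_of rt M),
      rooted lab (forest_of rt M), rt \notin [seq e.1 | e <- forest_of rt M]
    & forall g, symmetric_weight g ->
        \sum_(e <- forest_of rt M) g e = \sum_(e <- M) g e].
Proof.
move=> mg; have [//|//|//|el cl rl sum] := link_inv (l := [::]) mg.
split; first exact: elim_order_reroot.
- exact: consistent_reroot.
- exact: rooted_reroot.
- by rewrite mem_reroot // eqxx.
- by move=> g gS; rewrite reroot_sum // sum // big_nil.
Qed.

(** * Moving clients along a join *)

(* An assignment is a list of pairs (client, facility). *)
Definition assignment : Type := seq (nat * nat).

Definition load (a : assignment) (i : nat) : nat :=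
  count (fun p : nat * nat => p.2 == i) a.

Fixpoint move_one (i k : nat) (a : assignment) : assignment :=
  if a is p :: a' then
    if p.2 == i then (p.1, k) :: a' else p :: move_one i k a'
  else [::].

Definition move_all (i k : nat) (a : assignment) : assignment :=
  [seq if p.2 == i then (p.1, k) else p | p : nat * nat <- a].

Lemma move_one_clients i k a : unzip1 (move_one i k a) = unzip1 a.
Proof. by elim: a => //= p a IH; case: ifP => //= _; rewrite IH. Qed.

Lemma move_all_clients i k a : unzip1 (move_all i k a) = unzip1 a.
Proof. by elim: a => //= p a IH; case: ifP => //= _; rewrite IH. Qed.

Lemma load_move_one i k a x : 0 < load a i ->
  load (move_one i k a) x + (x == i) = load a x + (x == k).
Proof.
rewrite /load; elim: a => //= p a IH; case: (eqVneq p.2 i) => [->|pi] /=.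
  by rewrite ![_ == x]eq_sym; lia.
by rewrite add0n => /IH; lia.
Qed.

Lemma load_move_all i k a x : i != k ->
  load (move_all i k a) x =
  if x == i then 0 else if x == k then load a x + load a i else load a x.
Proof.
move=> ik; rewrite /load count_map; elim: a => /= [|p a ->]; first by do 2?case: ifP.
case: (eqVneq p.2 i) => [->|pi] /=; case: (eqVneq x i) => [->|xi] //=.
- by rewrite eq_sym (negPf ik).
- by rewrite [k == x]eq_sym; case: (eqVneq x k) => [->|xk]; rewrite ?(negPf ik) ?[i == x]eq_sym ?(negPf xi) /=; lia.
- by rewrite (negPf pi).
- by case: ifP => _; lia.
Qed.

Section Cost.
Variable d : nat -> nat -> nat.
Hypothesis dtri : forall x y z, d x z <= d x y + d y z.
Hypothesis dsym : forall x y, d x y = d y x.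

Definition connection (a : assignment) : nat := \sum_(p <- a) d p.2 p.1.

Lemma connection_move_one i k a : connection (move_one i k a) <= connection a + d i k.
Proof.
rewrite /connection; elim: a => [|p a IH] /=; first by rewrite big_nil.
case: eqP => [pi|_]; rewrite !big_cons /=; last lia.
by have := dtri k i p.1; rewrite pi [d k i]dsym; lia.
Qed.

Lemma connection_move_all i k a :
  connection (move_all i k a) <= connection a + load a i * d i k.
Proof.
elim: a => [|p a IH]; first by rewrite /connection big_nil.
have c1 : connection (p :: a) = d p.2 p.1 + connection a by rewrite /connection big_cons.
have l1 : load (p :: a) i = (p.2 == i) + load a i by [].
have -> : connection (move_all i k (p :: a)) =
    d (if p.2 == i then k else p.2) p.1 + connection (move_all i k a).
  by rewrite /connection /= big_cons; case: ifP.
rewrite c1 l1; case: eqP => [pi|_] /=; last lia.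
by have := dtri k i p.1; rewrite pi [d k i]dsym; lia.
Qed.

End Cost.

(* A token (position, origin) stands for a facility [origin] of wrong parity
   whose surplus client has been carried, virtually, to [position].  When two
   tokens meet, a client moves from one origin to the other. *)
Definition token_state : Type := (assignment * seq (nat * nat))%type.

Definition tokens_at (x : nat) (h : seq (nat * nat)) : seq (nat * nat) :=
  [seq t : nat * nat <- h | t.1 == x].
Definition tokens_off (x : nat) (h : seq (nat * nat)) : seq (nat * nat) :=
  [seq t : nat * nat <- h | t.1 != x].
Definition origin_at (x : nat) (h : seq (nat * nat)) : nat :=
  (head (0, 0) (tokens_at x h)).2.

(** The root holds no clients: a token that reaches it through [e.1] delivers its client to [e.1],
    the facility toggled by this edge. Two tokens at one vertex annihilate, so each vertex carries
    at most one. *)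
Definition token_step (rt : nat) (st : token_state) (e : edge) : token_state :=
  if nilp (tokens_at e.1 st.2) then st
  else let o := origin_at e.1 st.2 in let h := tokens_off e.1 st.2 in
    if e.2 == rt then (move_one o e.1 st.1, h)
    else if nilp (tokens_at e.2 h) then (st.1, (e.2, o) :: h)
    else (move_one o (origin_at e.2 h) st.1, tokens_off e.2 h).

Lemma nilp_tokens_at x h : nilp (tokens_at x h) = (x \notin unzip1 h).
Proof.
rewrite /nilp size_filter eqn0Ngt -has_count; congr negb.
by elim: h => //= t h ->; rewrite inE eq_sym.
Qed.

Lemma tokens_split x h : uniq (unzip1 h) -> ~~ nilp (tokens_at x h) ->
  perm_eq h ((x, origin_at x h) :: tokens_off x h).
Proof.
rewrite nilp_tokens_at negbK /origin_at /tokens_at /tokens_off.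
elim: h => //= -[y o] h IH /= /andP[nh uh].
rewrite inE; case: (eqVneq x y) => [xy _|xy /= xh] /=.
  subst y.
  rewrite perm_cons; apply/permP => p; rewrite (eq_in_filter (a2 := predT)) ?filter_predT //.
  by move=> t th; apply: contraNneq nh => <-; apply: map_f.
have P := IH uh xh.
apply/permP => p; have /permP/(_ p) /= := P; lia.
Qed.

Lemma odd_load_move_one i k a x : 0 < load a i ->
  odd (load (move_one i k a) x) = odd (load a x) (+) (x == i) (+) (x == k).
Proof.
move/(load_move_one k x)/(congr1 odd); rewrite !oddD !oddb => /(canRL (addbK _))->.
by rewrite addbAC.
Qed.

Lemma disjoint_orb (b c : bool) : (b -> ~~ c) -> b || c = b (+) c.
Proof. by case: b => //= /(_ isT). Qed.

Lemma bound_via (o h x w : bool) l l' n :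
  (o -> ~~ h) -> (x -> ~~ w) -> l' + o = l + x -> l + (o || h) <= n + w ->
  l' + h <= n + (x || w).
Proof. by case: o; case: h; case: x; case: w => //=; lia. Qed.

Lemma bound_meet (o h k w : bool) l l' n :
  (o -> ~~ (k || h)) -> (k -> ~~ h) -> l' + o = l + k -> l + (o || (k || h)) <= n + w ->
  l' + h <= n + w.
Proof. by case: o; case: h; case: k; case: w => //=; lia. Qed.

(** * Extracting a join from a rooted forest *)

Section TokenPass.
Variables (rt : nat) (d : nat -> nat -> nat) (S : seq nat) (O : pred nat).
Variable a0 : assignment.
Hypothesis dtri : forall x y z, d x z <= d x y + d y z.
Hypothesis dsym : forall x y, d x y = d y x.
Hypothesis d0 : forall x, d x x = 0.
Hypothesis uniqS : uniq S.
Hypothesis rtS : rt \notin S.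
Hypothesis loadS : forall i, (0 < load a0 i) = (i \in S).

Definition wrong (i : nat) : bool := (i \in S) && (odd (load a0 i) != O i).
Definition tokens0 : seq (nat * nat) := [seq (i, i) | i <- S & odd (load a0 i) != O i].
Definition vias (J : seq edge) : seq nat := [seq e.1 | e <- J & e.2 == rt].

(** [J] collects the edges over which a token has passed, and [vias J] the toggled facilities. A
    facility gains at most one client when its own token is met by another and at most one through
    its root edge, whence [ti_bound]. In [ti_cost] the edges travelled have already paid for the
    distance between origin and position of every live token. *)
Record token_inv (a : assignment) (h : seq (nat * nat)) (J : seq edge) : Prop := TokenInv {
  ti_pos : uniq (unzip1 h);
  ti_org : uniq (unzip2 h);
  ti_sub : {subset unzip2 h <= S};
  ti_parity : {in S, forall i,
    odd (load a i) = O i (+) (i \in unzip2 h) (+) (i \in vias J)};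
  ti_out : forall i, i \notin S -> load a i = (i \in vias J);
  ti_load : {in unzip2 h, forall i, 0 < load a i};
  ti_bound : {in S, forall i,
    load a i + (i \in unzip2 h) <= (load a0 i).+1 + (i \in vias J)};
  ti_degree : forall v, v != rt ->
    odd (count (cross id v) J) = wrong v (+) (v \in unzip1 h);
  ti_cost : connection d a + \sum_(t <- h) d t.2 t.1 <=
            connection d a0 + \sum_(e <- J | e.2 != rt) d e.1 e.2;
  ti_clients : unzip1 a = unzip1 a0;
  ti_root : rt \notin unzip1 h
}.

Lemma token_inv0 : token_inv a0 tokens0 [::].
Proof.
have m1 : unzip1 tokens0 = [seq i <- S | odd (load a0 i) != O i].
  by rewrite /unzip1 -map_comp map_id.
have m2 : unzip2 tokens0 = [seq i <- S | odd (load a0 i) != O i].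
  by rewrite /unzip2 -map_comp map_id.
split; rewrite ?m1 ?m2 ?filter_uniq //.
- by move=> i; rewrite mem_filter => /andP[].
- move=> i iS; rewrite mem_filter iS andbT /= addbF.
  by case: (odd _); case: (O i).
- by move=> i; rewrite -loadS -eqn0Ngt => /eqP.
- by move=> i; rewrite mem_filter loadS => /andP[].
- by move=> i iS; rewrite addn0 -addn1 leq_add2l; case: (_ \in _).
- by move=> v _; rewrite mem_filter andbC addbb.
- by rewrite big_nil big_map big1 // => i _; rewrite d0.
- by rewrite mem_filter (negPf rtS) andbF.
Qed.

Lemma vias_rcons J e : vias (rcons J e) = if e.2 == rt then rcons (vias J) e.1 else vias J.
Proof. by rewrite /vias filter_rcons; case: ifP => // _; rewrite map_rcons. Qed.

Lemma token_step_inv a h J e : token_inv a h J ->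
  e.1 != e.2 -> e.1 != rt -> e.1 \notin vias J ->
  let st := token_step rt (a, h) e in
  (exists2 J', J' = J \/ J' = rcons J e & token_inv st.1 st.2 J') /\
  {subset unzip1 st.2 <= e.2 :: [seq t <- unzip1 h | t != e.1]}.
Proof.
case: e => x y /= inv xy xrt xW; rewrite /token_step /=.
case: ifP => [|/negbT nx] /=.
  rewrite nilp_tokens_at => nx; split; first by exists J; auto.
  by move=> t th; rewrite inE mem_filter th andbT; apply/orP; right; apply: contraNneq nx => <-.
have P := tokens_split (ti_pos inv) nx.
set o := origin_at x h in P *; set h1 := tokens_off x h in P *.
have p1 : perm_eq (unzip1 h) (x :: unzip1 h1) := perm_map fst P.
have p2 : perm_eq (unzip2 h) (o :: unzip2 h1) := perm_map snd P.
have /andP[x1 u1] : uniq (x :: unzip1 h1) by rewrite -(perm_uniq p1) (ti_pos inv).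
have /andP[o1 u2] : uniq (o :: unzip2 h1) by rewrite -(perm_uniq p2) (ti_org inv).
have mem1 z : (z \in unzip1 h) = (z == x) || (z \in unzip1 h1) by rewrite (perm_mem p1) inE.
have mem2 z : (z \in unzip2 h) = (z == o) || (z \in unzip2 h1) by rewrite (perm_mem p2) inE.
have oh : o \in unzip2 h by rewrite mem2 eqxx.
have oS : o \in S := ti_sub inv oh.
have lo : 0 < load a o := ti_load inv oh.
have sub1 : {subset unzip1 h1 <= [seq t <- unzip1 h | t != x]}.
  move=> t th; rewrite mem_filter mem1 th orbT andbT.
  by apply: contraNneq x1 => <-.
have costh : connection d a + (d o x + \sum_(t <- h1) d t.2 t.1) <=
   connection d a0 + \sum_(e <- J | e.2 != rt) d e.1 e.2.
  by apply: leq_trans (ti_cost inv); rewrite (perm_big _ P) big_cons.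
case: ifP => [/eqP yrt|/negbT yrt] /=.
  split; last by move=> t /sub1; rewrite inE => ->; rewrite orbT.
  exists (rcons J (x, y)); [by right | split=> //].
  - by move=> i ih; apply: (ti_sub inv); rewrite mem2 ih orbT.
  - move=> i iS; rewrite odd_load_move_one // (ti_parity inv iS) vias_rcons yrt eqxx.
    rewrite mem_rcons inE mem2 !disjoint_orb => [|/eqP->//|/eqP->//].
    by case: (O i); case: (i == o); case: (i == x); case: (_ \in unzip2 _); case: (_ \in _).
  - move=> i iS; rewrite vias_rcons yrt eqxx mem_rcons inE.
    have io : (i == o) = false by apply: contraNF iS => /eqP->.
    have := load_move_one x i lo; rewrite io addn0 (ti_out inv iS) => ->.
    by case: (eqVneq i x) => [->|_]; rewrite ?(negPf xW) ?addn0.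
  - move=> i ih; have := load_move_one x i lo.
    have -> : (i == o) = false by apply: contraNF o1 => /eqP<-.
    rewrite addn0 => ->; apply: ltn_addr; apply: (ti_load inv).
    by rewrite mem2 ih orbT.
  - move=> i iS; rewrite vias_rcons yrt eqxx mem_rcons inE.
    apply: (bound_via _ _ (load_move_one x i lo)); [by move/eqP-> | by move/eqP-> |].
    by rewrite -mem2; apply: (ti_bound inv).
  - move=> v vrt; rewrite -cats1 count_cat oddD (ti_degree inv vrt) mem1 /= addn0 oddb.
    rewrite /cross /= yrt [rt == v]eq_sym (negPf vrt) addbF [x == v]eq_sym -addbA; congr addb.
    case: (eqVneq v x) => [->|_]; rewrite ?(negPf x1) ?addbF //.
  - rewrite -cats1 big_cat /= big_cons /= big_nil yrt eqxx /= addn0.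
    by move: (connection_move_one dtri dsym o x a) costh; clear; lia.
  - by rewrite move_one_clients (ti_clients inv).
  - by have := ti_root inv; rewrite mem1 negb_or => /andP[].
case: ifP => [ny|/negbT ny] /=.
  split; last first.
    by move=> t; rewrite !inE => /predU1P[->|/sub1->]; rewrite ?eqxx ?orbT.
  rewrite nilp_tokens_at in ny.
  exists (rcons J (x, y)); [by right | split=> //=; rewrite ?vias_rcons /= ?(negPf yrt)].
  - by rewrite ny.
  - by rewrite o1.
  - by move=> i; rewrite inE -mem2 => /(ti_sub inv).
  - by move=> i iS; rewrite inE -mem2 (ti_parity inv iS).
  - by move=> i iS; rewrite (ti_out inv iS).
  - by move=> i; rewrite inE -mem2 => /(ti_load inv).
  - by move=> i iS; rewrite inE -mem2 (ti_bound inv iS).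
  - move=> v vrt; rewrite -cats1 count_cat oddD (ti_degree inv vrt) mem1 /= addn0 oddb.
    rewrite /cross /= inE [y == v]eq_sym [x == v]eq_sym -addbA; congr addb.
    case: (eqVneq v x) => [->|_]; case: (eqVneq v y) => [vy|_]; subst;
      by rewrite ?(negPf x1) ?(negPf ny) ?addbF ?addbb //= ?addbT ?negbK // (negPf xy).
  - rewrite -cats1 big_cat !big_cons /= big_nil yrt addn0.
    by move: (dtri o x y) costh; clear; lia.
  - by rewrite (ti_clients inv).
  - by have := ti_root inv; rewrite ?inE mem1 !negb_or [rt == y]eq_sym yrt => /andP[].
have Q := tokens_split u1 ny.
set o' := origin_at y h1 in Q *; set h2 := tokens_off y h1 in Q *.
have q1 : perm_eq (unzip1 h1) (y :: unzip1 h2) := perm_map fst Q.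
have q2 : perm_eq (unzip2 h1) (o' :: unzip2 h2) := perm_map snd Q.
have /andP[y2 v1] : uniq (y :: unzip1 h2) by rewrite -(perm_uniq q1).
have /andP[o2 v2] : uniq (o' :: unzip2 h2) by rewrite -(perm_uniq q2).
have mem3 z : (z \in unzip1 h1) = (z == y) || (z \in unzip1 h2) by rewrite (perm_mem q1) inE.
have mem4 z : (z \in unzip2 h1) = (z == o') || (z \in unzip2 h2) by rewrite (perm_mem q2) inE.
have oo' : o != o' by apply: contraNneq o1 => ->; rewrite mem4 eqxx.
have o'S : o' \in S by apply: (ti_sub inv); rewrite mem2 mem4 eqxx orbT.
have on2 : o \notin unzip2 h2 by move: o1; rewrite mem4 negb_or => /andP[].
split; last first.
  by move=> t th; rewrite inE sub1 ?orbT // mem3 th orbT.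
exists (rcons J (x, y)); [by right | split=> //=; rewrite ?vias_rcons /= ?(negPf yrt)].
- by move=> i ih; apply: (ti_sub inv); rewrite mem2 mem4 ih !orbT.
- move=> i iS; rewrite odd_load_move_one // (ti_parity inv iS).
  rewrite mem2 disjoint_orb; last by move/eqP->.
  rewrite mem4 disjoint_orb; last by move/eqP->.
  by case: (O i); case: (i == o); case: (i == o'); case: (_ \in unzip2 _); case: (_ \in _).
- move=> i iS; rewrite -(ti_out inv iS).
  have := load_move_one o' i lo.
  have -> : (i == o) = false by apply: contraNF iS => /eqP->.
  have -> : (i == o') = false by apply: contraNF iS => /eqP->.
  by rewrite !addn0.
- move=> i ih; have := load_move_one o' i lo.
  have -> : (i == o) = false by apply: contraNF on2 => /eqP<-.
  rewrite addn0 => ->; apply: ltn_addr; apply: (ti_load inv).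
  by rewrite mem2 mem4 ih !orbT.
- move=> i iS; apply: (bound_meet _ _ (load_move_one o' i lo)).
  + by move/eqP->; rewrite -mem4.
  + by move/eqP->.
  + by rewrite -mem4 -mem2; apply: (ti_bound inv).
- move=> v vrt; rewrite -cats1 count_cat oddD (ti_degree inv vrt) mem1 mem3 /= addn0 oddb.
  have x2 : x \notin unzip1 h2 by move: x1; rewrite mem3 negb_or => /andP[].
  rewrite /cross /= [y == v]eq_sym [x == v]eq_sym -addbA; congr addb.
  case: (eqVneq v x) => [->|_]; last by case: (eqVneq v y) => [->|_]; rewrite ?(negPf y2) ?addbF.
  by rewrite (negPf xy) (negPf x2).
- rewrite -cats1 big_cat !big_cons /= big_nil yrt addn0.
  move: costh; rewrite (perm_big _ Q) big_cons /=.
  move: (connection_move_one dtri dsym o o' a) (dtri o x o') (dtri x y o').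
  by rewrite [d y o']dsym; clear; lia.
- by rewrite move_one_clients (ti_clients inv).
- by have := ti_root inv; rewrite mem1 mem3 !negb_or => /and3P[].
Qed.

Lemma token_pass l : elim_order l -> rt \notin [seq e.1 | e <- l] ->
  let st := foldl (token_step rt) (a0, tokens0) l in
  exists J, [/\ subseq J l, token_inv st.1 st.2 J
              & {in unzip1 st.2, forall t, t \notin [seq e.1 | e <- l]}].
Proof.
move=> el rtl.
(* The children of the treated edges [l1] hold no tokens and do not occur again, so tokens can
   survive only at roots of the forest. *)
suff main l1 l2 J a h : elim_order l2 -> rt \notin [seq e.1 | e <- l2] ->
    subseq J l1 -> token_inv a h J ->
    {in [seq e.1 | e <- l1], forall z,
       [/\ z \notin unzip1 h, z \notin [seq e.1 | e <- l2] & z \notin [seq e.2 | e <- l2]]} ->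
    let st := foldl (token_step rt) (a, h) l2 in
    exists J', [/\ subseq J' (l1 ++ l2), token_inv st.1 st.2 J'
              & {in unzip1 st.2, forall t, t \notin [seq e.1 | e <- l1 ++ l2]}].
  by have := main [::] l [::] a0 tokens0 el rtl isT token_inv0; apply.
elim: l2 l1 J a h {el rtl} => [|e l2 IH] l1 J a h /=.
  move=> _ _ sJ inv pos; exists J; rewrite cats0; split=> // t th.
  by apply/negP => /pos[]; rewrite th.
move=> /and4P[ne e1 e2 el]; rewrite inE negb_or => /andP[ert rtl] sJ inv pos.
have eW : e.1 \notin vias J.
  apply/mapP => -[f]; rewrite mem_filter => /andP[_ /(mem_subseq sJ) f1] ef.
  have := pos e.1; rewrite ef => /(_ (map_f _ f1))[_]; by rewrite -ef inE eqxx.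
have ert' : e.1 != rt by rewrite eq_sym.
have [[J' J'E inv'] sub] := token_step_inv inv ne ert' eW.
move: inv' sub; case: (token_step _ _ _) => a' h' /= inv' sub.
rewrite -cat_rcons; apply: (IH (rcons l1 e) J') => //.
  by case: J'E => ->; [apply: subseq_trans sJ _; apply: subseq_rcons |
                       rewrite -!cats1; apply: cat_subseq].
move=> z; rewrite map_rcons mem_rcons inE => /predU1P[->|z1].
  split=> //; apply/negP => /sub; rewrite inE mem_filter eqxx orbF.
  by rewrite (negPf ne).
have [zh] := pos z z1; rewrite !inE !negb_or => /andP[ze1 zl1] /andP[ze2 zl2]; split=> //.
by apply/negP => /sub; rewrite inE (negPf ze2) mem_filter (negPf zh) andbF.
Qed.

End TokenPass.

Lemma merges_root rt lab M lab' : merges rt lab M lab' -> lab rt = rt -> lab' rt = rt.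
Proof.
elim=> // {lab M lab'} lab e a b M lab' _ _ art _ IH rt0; apply: IH.
by rewrite /relabel /= rt0 eq_sym (negPf art).
Qed.

Lemma merges_join rt lab M lab' J : merges rt lab M lab' ->
  join rt lab [::] J -> join rt lab' [::] J.
Proof.
elim=> // {lab M lab'} lab e a b M lab' cr ab art _ IH jJ; apply: IH.
have neab : a != b by move: cr; rewrite /crossing; case: ab => -[-> ->] //; rewrite eq_sym.
by have := join_relabel neab jJ art; rewrite /merge_active /= andbF.
Qed.

Lemma elim_order_swap l u v : elim_order l -> (u, v) \in l -> (v, u) \notin l.
Proof.
elim: l => //= -[x y] l IH /and4P[/= xy x1 x2 el]; rewrite !inE.
case/predU1P=> [[-> ->]|uvl].
  rewrite negb_or xpair_eqE [y == x]eq_sym (negPf xy) /=.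
  by apply: contra x2 => /(map_f snd).
rewrite negb_or IH // andbT xpair_eqE; apply: contra x2 => /andP[/eqP<- _].
by apply: (map_f snd uvl).
Qed.

Lemma elim_order_uniq_edges l : elim_order l -> uniq l.
Proof.
by move=> /(elim_order_uniq 0)/andP[_]; apply: map_uniq.
Qed.

(** * The join found by the primal-dual method and its cost *)

Section Join.
Variables (rt : nat) (d : nat -> nat -> nat) (S : seq nat) (O : pred nat).
Variables (a0 : assignment) (E : seq edge) (c0 : edge -> nat).
Hypothesis dtri : forall x y z, d x z <= d x y + d y z.
Hypothesis dsym : forall x y, d x y = d y x.
Hypothesis d0 : forall x, d x x = 0.
Hypothesis uniqS : uniq S.
Hypothesis rtS : rt \notin S.
Hypothesis loadS : forall i, (0 < load a0 i) = (i \in S).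
Hypothesis c0sym : symmetric_weight c0.
Hypothesis Ene : {in E, forall e, e.1 != e.2}.

Definition wrong_facilities : seq nat := [seq i <- S | odd (load a0 i) != O i].
(** With doubled costs, the unit that rounding loses on an edge of positive cost is at most half of
    its cost. *)
Definition chosen_edges : seq edge :=
  gw rt [seq (e, e, 2 * c0 e) | e <- E] wrong_facilities.
Definition correct_parity : token_state :=
  foldl (token_step rt) (a0, tokens0 S O a0) (forest_of rt chosen_edges).

Lemma correct_parityP Jopt :
  {in Jopt, forall e, e.1 != e.2 -> e \in E} -> join rt id wrong_facilities Jopt ->
  exists J, [/\ token_inv rt d S O a0 correct_parity.1 [::] J,
    {in J, forall e, (e \in E) \/ ((e.2, e.1) \in E)}, {in J, forall e, e.1 != rt}
  & \sum_(e <- J) c0 e <= 4 * \sum_(e <- Jopt) c0 e].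
Proof.
move=> JE jJ; set A0 := wrong_facilities in jJ *.
have uA : uniq A0 by rewrite filter_uniq.
have rtA : rt \notin A0 by rewrite mem_filter (negPf rtS) andbF.
have crE : {in E, forall e, crossing id e} by [].
have [lab [A' [Y r]]] := gw_run rt (fun e => 2 * c0 e) A0 Ene.
rewrite -/chosen_edges in r; set M := chosen_edges in r.
have JE' : {in Jopt, forall e, crossing id e -> e \in E} by [].
have A'0 := run_inactive r uA rtA crE JE' jJ; rewrite {}A'0 in r.
have mg := run_merges r crE.
have [el cl rl rtl sums] := forest_ofP mg; set l := forest_of rt M in el cl rl rtl sums.
have [J [sJ inv pos]] := token_pass O dtri dsym d0 uniqS rtS loadS el rtl.
rewrite -/correct_parity in inv pos.
move: inv pos; rewrite -/l -/M -/(correct_parity); case E1: correct_parity => [a h] /= inv pos.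
(* A surviving token sits at the root [v] of a tree outside the class of [rt]. Adding to [J] an edge
   to [rt] for every wrong facility and every token makes all degrees off [rt] even, also after
   contraction. In the class of [v], the edges of [J] are internal and the wrong facilities are even
   in number, as no class is active at the end. So the tokens there would be even in number, but [v]
   is the only possible place for one. *)
have h0 : h = [::].
  apply/eqP; rewrite -size_eq0 -(size_map fst) size_eq0; apply/eqP.
  set H := unzip1 h in pos *; case HE: H => [//|v H'].
  have vH : v \in H by rewrite HE mem_head.
  have vrt : v != rt by apply: contraNneq (ti_root inv) => <-.
  have lrt : lab rt = rt := merges_root mg erefl.
  have lv : lab v != rt.
    apply: contraNneq vrt => lv; apply/eqP; apply: rl; rewrite ?lv ?lrt //; exact: pos.
  pose star (B : seq nat) : seq edge := [seq (x, rt) | x <- B].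
  have cstar lb (B : seq nat) x : lb rt = rt -> x != rt ->
      count (cross lb x) (star B) = count (fun z => lb z == x) B.
    move=> lb0 xrt; rewrite count_map; apply: eq_count => z /=.
    by rewrite /cross /= lb0 [rt == x]eq_sym (negPf xrt) addbF.
  have j0 : join rt id [::] (J ++ star A0 ++ star H).
    move=> x xrt; rewrite !count_cat !oddD (ti_degree inv xrt) !cstar //.
    rewrite !(count_uniq_mem x) ?(ti_pos inv) // !oddb mem_filter /wrong andbC -/H.
    by rewrite addbCA addbK addbb.
  have j1 : join rt id A0 (star A0).
    by move=> x xrt; rewrite cstar // (count_uniq_mem x) // oddb.
  have := merges_join mg j0 lv; rewrite !count_cat !oddD.
  have := run_join r crE j1 lv => ->.
  have -> : count (cross lab (lab v)) J = 0.
    apply/eqP; rewrite eqn0Ngt -has_count; apply/hasPn => e /(mem_subseq sJ) el'.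
    by rewrite /cross (eqP (allP cl e el')) addbb.
  rewrite cstar //= (eq_in_count (a2 := pred1 v)) ?(count_uniq_mem v) ?(ti_pos inv) ?vH //.
  move=> z zH /=; apply/eqP/eqP => [lz|-> //].
  by apply: rl => //; apply: pos.
rewrite {}h0 in inv.
(* Rerooting may have reversed the edges of [J] with respect to [M], so the selection must ignore
   directions. *)
pose p e := (e \in J) || ((e.2, e.1) \in J).
have psym u v : p (u, v) = p (v, u) by rewrite /p orbC.
have lJ : [seq e <- l | p e] = J.
  rewrite [RHS](elimT (subseq_uniqP (elim_order_uniq_edges el)) sJ).
  apply: eq_in_filter => -[u v] uvl; rewrite /p; case: (_ \in J) => //=.
  by apply: contraNF (elim_order_swap el uvl) => /(mem_subseq sJ).
have sumsJ g : symmetric_weight g -> \sum_(e <- M | p e) g e = \sum_(e <- J) g e.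
  move=> gS; rewrite -lJ big_filter !(big_mkcond p) /= sums // => u v.
  by rewrite psym gS.
exists J; split=> //.
- move=> e eJ; have : 0 < \sum_(f <- M) ((f == e) || (f == (e.2, e.1))).
    rewrite -sums; last first.
      move=> u v; case: e {eJ} => x y /=; rewrite !xpair_eqE.
      by rewrite orbC ![(u == _) && _]andbC.
    by rewrite (big_rem e) ?(mem_subseq sJ) //= eqxx.
  rewrite -count_sum -has_count => /hasP[f fM /orP[]/eqP fe].
    by left; rewrite -fe; apply: (run_sub r).
  by right; rewrite -fe; apply: (run_sub r).
- move=> e /(mem_subseq sJ) e1; apply: contraNneq rtl => <-; exact: map_f.
have ub : \sum_(e <- M | p e) 2 * c0 e <=
    2 * Y + count (fun e => p e && (0 < 2 * c0 e)) M.
  apply: (run_upper_bound r) => // x xrt.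
  rewrite count_filter count_sum.
  have -> : \sum_(e <- M) predI (cross id x) p e = \sum_(e <- M | p e) cross id x e.
    rewrite [RHS]big_mkcond; apply: eq_bigr => e _ /=.
    by case: (p e); rewrite ?andbF ?andbT.
  rewrite sumsJ; last by move=> u v; rewrite /cross /= addbC.
  by rewrite -count_sum (ti_degree inv xrt) in_nil addbF mem_filter /wrong andbC.
have lb := run_lower_bound r uA crE rtA JE' jJ.
have {}lb : Y <= 2 * \sum_(e <- Jopt) c0 e.
  apply: (leq_trans lb); rewrite -big_distrr /= leq_mul2l /=.
  by rewrite [leqRHS](bigID (crossing id)) /= leq_addr.
have : count (fun e => p e && (0 < 2 * c0 e)) M <= \sum_(e <- M | p e) c0 e.
  rewrite count_sum [leqRHS]big_mkcond; apply: leq_sum => e _.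
  by case: (p e) => //=; rewrite muln_gt0 /=; case: (c0 e).
move: ub; rewrite -big_distrr /= sumsJ // => ub cnt.
(* Twice the cost of [J] is at most [2 * Y] plus that cost itself, so the cost is at most [2 * Y];
   and [Y] is at most twice the cost of [Jopt] because the dual was built for doubled costs. *)
have := leq_trans ub (leq_add (leqnn _) cnt).
rewrite mul2n -addnn leq_add2r => /leq_trans; apply.
by rewrite -[4]/(2 * 2) -mulnA leq_mul2l.
Qed.

End Join.

Lemma big_pick (s : seq nat) x (G : nat -> nat) : uniq s -> x \in s ->
  \sum_(i <- s) (x == i) * G i = G x.
Proof.
move=> us xs; rewrite (bigD1_seq x) //= eqxx mul1n big1 ?addn0 // => i ix.
by rewrite eq_sym (negPf ix).
Qed.

(* Charging along a function: each [i] in [s] collects the terms sent to it. *)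
Lemma sum_fibers (D s : seq nat) (h : nat -> nat) (G : nat -> nat -> nat) : uniq s ->
  {in D, forall j, h j \in s} ->
  \sum_(j <- D) G (h j) j = \sum_(i <- s) \sum_(j <- D | h j == i) G i j.
Proof.
move=> us hs; rewrite [RHS](eq_bigr (fun i => \sum_(j <- D) (h j == i) * G i j)); last first.
  by move=> i _; rewrite big_mkcond; apply: eq_bigr => j _; case: eqP; rewrite ?mul1n.
rewrite exchange_big /= !big_seq; apply: eq_bigr => j jD.
by rewrite (big_pick (fun i => G i j)) // hs.
Qed.

Lemma sum_at_most_one (s : seq nat) (G : nat -> nat) b : uniq s ->
  {in s &, forall i k, 0 < G i -> 0 < G k -> i = k} ->
  {in s, forall i, G i <= b} -> \sum_(i <- s) G i <= b.
Proof.
elim: s => [|i s IH] /=; first by rewrite big_nil.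
case/andP=> ni us one le; rewrite big_cons; case: (posnP (G i)) => [->|Gi].
  apply: IH => // [k l ks ls|k ks]; last by apply: le; rewrite inE ks orbT.
  by apply: one; rewrite inE ?ks ?ls orbT.
rewrite big1_seq ?addn0 ?le ?mem_head // => k /andP[_ ks].
apply/eqP; rewrite eqn0Ngt; apply: contraNN ni => Gk.
by rewrite (one i k) ?mem_head // inE ks orbT.
Qed.

(** * Opening facilities regardless of parity *)

Section MettuPlaxton.
Variables (d : nat -> nat -> nat) (f : nat -> nat) (F D : seq nat).

Definition growth (i r : nat) : nat := sumn [seq r - d i j | j <- D].

(** A power of two, or 0, replaces the radius of Mettu and Plaxton, at which [growth] would equal
    [f i]. The bits only count the rounds: that many doublings exceed [f i] plus all distances,
    which is too large a radius as soon as there is a client. *)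
Definition radius (i : nat) : nat :=
  foldl (fun r _ => if growth i (r + r) <= f i then r + r else r)
    (if growth i 1 <= f i then 1 else 0)
    (bits (f i + sumn [seq d i j | j <- D])).

(** A facility is dropped according to its own radius, the larger of the two since [i] has the
    smallest. This gives both the covering distance and the separation by the maximum in
    [opened_spec]. *)
Definition open_step (st : seq nat * seq nat) : seq nat * seq nat :=
  if nilp st.1 then st
  else let i := argmin radius 0 st.1 in
    ([seq x <- st.1 | 4 * radius x < d i x], i :: st.2).

Definition opened_facilities : seq nat :=
  (foldl (fun st _ => open_step st) (F, [::]) F).2.

Definition nearest (j : nat) : nat := argmin (fun i => d i j) 0 opened_facilities.

Hypothesis dtri : forall x y z, d x z <= d x y + d y z.
Hypothesis dsym : forall x y, d x y = d y x.
Hypothesis d0 : forall x, d x x = 0.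
(* At most one client is at distance 0 from a facility, distances being
   integral and [d] coming from a metric. *)
Hypothesis growth1 : {in F, forall i, growth i 1 <= 1}.
Hypothesis uF : uniq F.

Lemma growthE i r : growth i r = \sum_(j <- D) (r - d i j).
Proof. by rewrite /growth sumnE big_map. Qed.

Lemma growth_radius i : growth i (radius i) <= f i.
Proof.
rewrite /radius; set r0 := (if _ then _ else _).
have : growth i r0 <= f i by rewrite /r0; case: ifP => // _; rewrite growthE big1.
elim: (bits _) r0 => //= _ s IH r le; apply: IH; case: ifP => //.
Qed.

Lemma radius_growth i : i \in F -> D != [::] -> f i <= growth i (2 * radius i).
Proof.
move=> iF nD; rewrite mul2n -addnn /radius; case: (leqP (growth i 1) (f i)) => [le1|gt1]; last first.
  by have -> : f i = 0 by have := growth1 iF; lia.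
set s := bits _; suff main (t : seq bool) k r : f i < growth i (r + r) \/ r = 2 ^ k ->
    let r' := foldl (fun r _ => if growth i (r + r) <= f i then r + r else r) r t in
    growth i r <= f i -> growth i r' <= f i /\ (f i < growth i (r' + r') \/ r' = 2 ^ (k + size t)).
  (* If every doubling succeeded, the radius exceeds [f i] plus all distances, and a single client
     already contributes more than [f i] to the growth. *)
  have [] // := main s 0 1 (or_intror erefl) le1; set r' := foldl _ _ _ => le' [/ltnW//|er].
  rewrite add0n in er; have : f i + sumn [seq d i j | j <- D] < r'.
    by rewrite er -[ltnLHS]bitsK bval_lt.
  move: le'; rewrite growthE; case E: D nD => [//|j D'] _; rewrite big_cons /=.
  by move: (sumn _) (\sum_(_ <- _) _); clear; lia.
elim: t k r => [|z t IH] k r kr /= le; first by rewrite addn0.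
rewrite addnS -addSn; apply: IH; last by case: ifP.
case: (leqP (growth i (r + r)) (f i)) => [le2|lt]; last by left.
by right; case: kr => [|->]; [lia | rewrite addnn -mul2n expnS].
Qed.

Lemma opened_spec :
  [/\ uniq opened_facilities, {subset opened_facilities <= F},
      {in F, forall x, exists2 i, i \in opened_facilities & radius i <= radius x /\ d i x <= 4 * radius x}
    & {in opened_facilities &, forall i k, i != k -> 4 * maxn (radius i) (radius k) < d i k}].
Proof.
pose inv (R S : seq nat) :=
  [/\ uniq S, {subset S <= F}, {subset R <= F}
   & [/\ {in F, forall x, x \notin R -> exists2 i, i \in S & radius i <= radius x /\ d i x <= 4 * radius x},
         {in S & R, forall i x, radius i <= radius x /\ 4 * radius x < d i x}
       & {in S &, forall i k, i != k -> 4 * maxn (radius i) (radius k) < d i k}]].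
suff main (s R S : seq nat) : size R <= size s -> inv R S ->
    inv [::] (foldl (fun st _ => open_step st) (R, S) s).2.
  have [] := main F F [::] (leqnn _); first by split=> //; split=> // x ->.
  move=> uS SF _ [cov _ sep]; split=> // x xF.
  exact: cov.
elim: s R S => [|z s IH] R S; first by rewrite leqn0 size_eq0 => /eqP->.
case: (eqVneq R [::]) => [-> _ invS|nR szR invS] /=; first exact: (IH [::]).
have -> : open_step (R, S) =
    ([seq x <- R | 4 * radius x < d (argmin radius 0 R) x], argmin radius 0 R :: S).
  by rewrite /open_step /=; case: nilP nR => // ->.
have [] := argminP radius 0 nR; set i := argmin _ _ _ => iR imin.
case: invS => uS SF RF [cov near sep].
have niS : i \notin S.
  apply/negP => iS; have [_] := near i i iS iR; by rewrite d0.
apply: IH.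
  rewrite -ltnS; apply: leq_trans szR; rewrite size_filter ltn_neqAle count_size andbT.
  by rewrite -all_count; apply/allPn; exists i => //; rewrite d0.
split=> [|x|x|]; rewrite /= ?niS //.
- by rewrite inE => /predU1P[->|/SF //]; apply: RF.
- by rewrite mem_filter => /andP[_ /RF].
split=> [x xF|k x|k l].
- rewrite mem_filter negb_and => xR; case: (boolP (x \in R)) xR => [xR|nxR _]; last first.
    by have [k kS kx] := cov x xF nxR; exists k; rewrite // inE kS orbT.
  by rewrite orbF -leqNgt => le; exists i; rewrite ?mem_head //; split=> //; apply: imin.
- rewrite inE mem_filter => /predU1P[->|kS] /andP[lt xR]; last exact: near.
  by split=> //; apply: imin.
- rewrite !inE => /predU1P[->|kS] /predU1P[->|lS]; rewrite ?eqxx // => kl.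
  + by have [le lt] := near l i lS iR; rewrite dsym (maxn_idPl le).
  + by have [le lt] := near k i kS iR; rewrite (maxn_idPr le).
  + exact: sep.
Qed.

(** * Charging the greedy solution to an arbitrary assignment *)

Section Comparison.
Variables (Sopt : seq nat) (so : nat -> nat).
Hypotheses (uSopt : uniq Sopt) (SoptF : {subset Sopt <= F}).
Hypothesis soS : {in D, forall j, so j \in Sopt}.

Definition opt_cost : nat := \sum_(i <- Sopt) f i + \sum_(j <- D) d (so j) j.

Let beta (j : nat) : nat := maxn (radius (so j)) (d (so j) j).

(** [beta] plays the role of a dual variable. Its excess over the connection distances, summed over
    the clients of one facility [i], is part of [growth i (radius i)], which [f i] covers. *)
Lemma sum_beta : \sum_(j <- D) beta j <= opt_cost.
Proof.
apply: (@leq_trans (\sum_(j <- D) ((radius (so j) - d (so j) j) + d (so j) j))).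
  by apply: leq_sum => j _; rewrite /beta; lia.
rewrite big_split leq_add2r (sum_fibers (fun i j => radius i - d i j) uSopt soS).
apply: leq_sum => i _; apply: leq_trans (growth_radius i); rewrite growthE.
by rewrite [leqRHS](bigID (fun j => so j == i)) leq_addr.
Qed.

Lemma cover_beta j : j \in D -> exists2 i, i \in opened_facilities &
  radius i <= beta j /\ d i j <= 5 * beta j.
Proof.
have [_ _ cov _] := opened_spec; move=> jD.
have [i iS [le1 le2]] := cov (so j) (SoptF (soS jD)).
by exists i => //; rewrite /beta; have := dtri i (so j) j; split; lia.
Qed.

Lemma nearest_opened j : j \in D -> nearest j \in opened_facilities.
Proof.
move=> jD; have [i iS _] := cover_beta jD.
by have [] := @argminP _ (fun i => d i j) 0 opened_facilities; first by case: (opened_facilities) iS.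
Qed.

Lemma nearest_cost : \sum_(j <- D) d (nearest j) j <= 5 * opt_cost.
Proof.
apply: leq_trans (leq_mul (leqnn 5) sum_beta); rewrite big_distrr /= !big_seq.
apply: leq_sum => j jD; have [i iS [_ le]] := cover_beta jD; apply: leq_trans le.
have [|_] := @argminP _ (fun i => d i j) 0 opened_facilities; last exact.
by case: (opened_facilities) iS.
Qed.

(** By [radius_growth], the clients within [2 * radius i] can pay for [f i]. The separation of the
    opened facilities makes these neighbourhoods disjoint, so every client pays for at most one of
    them. *)
Lemma opened_cost : D != [::] -> \sum_(i <- opened_facilities) f i <= 5 * opt_cost.
Proof.
move=> nD; have [uS SF _ sep] := opened_spec.
apply: leq_trans (leq_mul (leqnn 5) sum_beta); rewrite big_distrr /=.
apply: (@leq_trans (\sum_(i <- opened_facilities) \sum_(j <- D) (2 * radius i - d i j))).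
  rewrite !big_seq; apply: leq_sum => i /SF iF; rewrite -growthE.
  exact: radius_growth.
rewrite exchange_big /= !big_seq; apply: leq_sum => j jD.
apply: sum_at_most_one => // [i k iS kS|i iS].
  rewrite !subn_gt0 => lti ltk; apply/eqP; case: eqVneq => // ik.
  by have := sep i k iS kS ik; have := dtri i j k; rewrite [d j k]dsym; lia.
(* [i1] is the opened facility near [j]. If the paying facility [i] is another one, then [4 * radius
   i < d i i1 <= d i j + 5 * beta j] bounds the payment. *)
have [i1 i1S [le1 le2]] := cover_beta jD; case: (eqVneq i i1) => [->|ne]; first lia.
by have := sep i i1 iS i1S ne; have := dtri i j i1; rewrite [d j i1]dsym; lia.
Qed.

End Comparison.

End MettuPlaxton.

Lemma sum_subset (X L : seq nat) (f : nat -> nat) : uniq X -> {subset X <= L} ->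
  \sum_(x <- X) f x <= \sum_(x <- L) f x.
Proof.
elim: X L => [|x X IH] L; first by rewrite big_nil.
move=> /= /andP[nx uX] sub; rewrite big_cons [leqRHS](big_rem x) /=; last by apply: sub; rewrite mem_head.
rewrite leq_add2l; apply: IH => // y yX.
have : y \in L by apply: sub; rewrite inE yX orbT.
rewrite (perm_mem (perm_to_rem (sub x (mem_head _ _)))) inE => /predU1P[yx|//].
by rewrite -yx yX in nx.
Qed.

Lemma move_one_none i k a : load a i = 0 -> move_one i k a = a.
Proof.
rewrite /load; elim: a => //= p a IH; case: ifP => //= _ /eqP.
by rewrite add0n => /eqP/IH->.
Qed.

(** * From joins to feasible assignments *)

Section Closing.
Variables (rt : nat) (d : nat -> nat -> nat) (f : nat -> nat) (F S : seq nat) (O : pred nat).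
Variable a0 : assignment.

(** A facility being closed gives away an even number of clients, which preserves the parity of the
    target. A closed odd target is excluded because it would become open with an even load. *)
Definition targets (i : nat) : seq nat :=
  [seq q : nat <- F | (q != i) && ((q \in S) || ~~ O q)].
Definition reopening (q : nat) : nat := if q \in S then 0 else f q.
(** Prices use the first loads, because they must be known before the join, which changes the loads,
    is computed. *)
Definition penalty_to (i q : nat) : nat := load a0 i * d i q + reopening q.
Definition target (i : nat) : nat := argmin (penalty_to i) 0 (targets i).
Definition toggle_cost (i : nat) : nat :=
  if i \in S then penalty_to i (target i) else f i.
Definition toggleable (i : nat) : bool := O i && ((i \notin S) || ~~ nilp (targets i)).
Definition join_edges : seq edge :=
  [seq e : edge <- flatten [seq [seq (i, k) | k <- F] | i <- F] | e.1 != e.2]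
  ++ [seq (i, rt) | i <- F & toggleable i].
Definition join_cost (e : edge) : nat :=
  if e.2 == rt then toggle_cost e.1
  else if e.1 == rt then toggle_cost e.2 else d e.1 e.2.

(* An odd facility left with an even number of clients has to be closed. *)
Definition closing (a : assignment) (i : nat) : bool :=
  [&& i \in S, O i & ~~ odd (load a i)].
(** If the target is to be closed as well, moving one client makes both loads odd and both
    facilities stay open; if [i] is already empty, this move does nothing. *)
Definition close_step (a : assignment) (i : nat) : assignment :=
  if closing a i then
    if closing a (target i) then move_one i (target i) a else move_all i (target i) a
  else a.

Hypothesis dtri : forall x y z, d x z <= d x y + d y z.
Hypothesis dsym : forall x y, d x y = d y x.
Hypothesis uF : uniq F.
Hypothesis rtF : rt \notin F.
Hypothesis uS : uniq S.
Hypothesis SF : {subset S <= F}.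
Hypothesis loadS : forall i, (0 < load a0 i) = (i \in S).

Lemma rtS : rt \notin S. Proof. by apply: contra rtF => /SF. Qed.

Lemma join_cost_sym : symmetric_weight join_cost.
Proof.
by move=> u v; rewrite /join_cost /= dsym; case: (eqVneq u rt) => [e1|_]; case: (eqVneq v rt) => [e2|_]; rewrite ?e1 ?e2.
Qed.

Lemma mem_join_edges i k : i \in F -> k \in F -> i != k -> (i, k) \in join_edges.
Proof.
move=> iF kF ik; rewrite mem_cat mem_filter /= ik; apply/orP; left.
by apply/flattenP; exists [seq (i, k) | k <- F]; apply: map_f.
Qed.

Lemma mem_join_toggle i : ((i, rt) \in join_edges) = (i \in F) && toggleable i.
Proof.
rewrite mem_cat mem_filter; apply/orP/andP => [[/andP[_]|]|[iF ti]].
- by case/flattenP => s /mapP[j _ ->] /mapP[k kF [_ e]]; move: rtF; rewrite e kF.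
- by case/mapP => j; rewrite mem_filter => /andP[tj jF] [->].
- by right; apply: (map_f (fun i => (i, rt))); rewrite mem_filter ti.
Qed.

Lemma join_edges_src e : e \in join_edges -> e.1 \in F.
Proof.
rewrite mem_cat mem_filter => /orP[/andP[_ /flattenP[s /mapP[j jF ->]]]|].
  by case/mapP => k _ ->.
by case/mapP => j; rewrite mem_filter => /andP[_ jF] ->.
Qed.

Lemma join_edges_ne : {in join_edges, forall e, e.1 != e.2}.
Proof.
move=> e; rewrite mem_cat => /orP[|/mapP[j]]; rewrite mem_filter => /andP[] //.
by move=> _ jF -> /=; apply: contraNneq rtF => <-.
Qed.

Lemma targetP i : ~~ nilp (targets i) ->
  [/\ target i \in F, target i != i, (target i \in S) || ~~ O (target i)
    & {in targets i, forall q, penalty_to i (target i) <= penalty_to i q}].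
Proof.
move=> ne; have [|] := @argminP _ (penalty_to i) 0 (targets i); first by case: (targets i) ne.
by rewrite -/(target i) mem_filter => /andP[/andP[-> ->] ->].
Qed.

Section Run.
Variables (a1 : assignment) (J : seq edge).
Hypothesis inv : token_inv rt d S O a0 a1 [::] J.
Hypothesis JE : {in J, forall e, (e \in join_edges) \/ ((e.2, e.1) \in join_edges)}.
Hypothesis Jrt : {in J, forall e, e.1 != rt}.

Lemma mem_vias i : (i \in vias rt J) = ((i, rt) \in J).
Proof.
apply/mapP/idP => [[[x y]]|iJ]; first by rewrite mem_filter /= => /andP[/eqP-> xJ] ->.
by exists (i, rt) => //; rewrite mem_filter eqxx.
Qed.

Lemma vias_toggleable i : i \in vias rt J -> (i \in F) && toggleable i.
Proof.
rewrite mem_vias => iJ; case: (JE iJ); first by rewrite mem_join_toggle.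
by move=> /join_edges_src /= rF; move: rtF; rewrite rF.
Qed.

Lemma closing_via i : closing a1 i ->
  [/\ i \in vias rt J, ~~ nilp (targets i) & load a1 i <= 3 * load a0 i].
Proof.
case/and3P => iS Oi ev; have iW : i \in vias rt J.
  by move: ev; rewrite (ti_parity inv iS) Oi /=; case: (_ \in vias _ _).
split=> //; first by have /andP[_ /andP[_]] := vias_toggleable iW; rewrite iS.
(* The load has grown by at most two and was positive in the first assignment, hence the factor
   3. *)
by have := ti_bound inv iS; have := loadS i; rewrite iS iW /=; clear; lia.
Qed.

(** [Z] lists the treated facilities: those among them that still satisfy [closing] are empty. A
    facility satisfying [closing] did so from the start and has not gained clients, so its price
    computed from [a1] remains valid. *)
Definition close_inv (Z : seq nat) (a : assignment) : Prop :=
  [/\ forall i, closing a i -> closing a1 i /\ load a i <= load a1 i,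
      {in Z, forall i, closing a i -> load a i = 0},
      forall i, ~~ closing a i -> load a i = 0 \/ odd (load a i) = O i,
      forall i, 0 < load a i -> [\/ i \in S, i \in vias rt J
        | i \in [seq target k | k <- Z & closing a1 k]]
    & connection d a <= connection d a1 +
        \sum_(k <- Z | closing a1 k) load a1 k * d k (target k)] /\
  unzip1 a = unzip1 a0.

Lemma close_inv0 : close_inv [::] a1.
Proof.
split; last exact: ti_clients inv.
split=> // [i ncl|i gt0|]; last by rewrite big_nil addn0.
  case: (boolP (i \in S)) ncl => iS ncl.
    right; rewrite (ti_parity inv iS) in_nil addbF.
    case: (boolP (i \in vias rt J)) => [iW|_]; last by rewrite addbF.
    move: ncl; rewrite /closing iS (ti_parity inv iS) iW in_nil /=.
    by have /andP[_ /andP[-> _]] := vias_toggleable iW.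
  rewrite (ti_out inv iS); case: (boolP (i \in vias rt J)) => [iW|_]; [right | by left].
  by have /andP[_ /andP[-> _]] := vias_toggleable iW.
case: (boolP (i \in S)) gt0 => iS; first by constructor 1.
by rewrite (ti_out inv iS) lt0b; constructor 2.
Qed.

Lemma close_step_inv Z a i : i \notin Z -> close_inv Z a ->
  close_inv (rcons Z i) (close_step a i).
Proof.
move=> iZ [[K1 K2 K3 K4 K5] K6]; rewrite /close_step.
have sub k : k \in [seq target k | k <- Z & closing a1 k] ->
    k \in [seq target k | k <- rcons Z i & closing a1 k].
  move=> /mapP[z zZ ->]; apply: map_f; move: zZ; rewrite !mem_filter mem_rcons inE.
  by case/andP => -> ->; rewrite orbT.
have K4' b : (forall k, 0 < load b k -> 0 < load a k \/ k \in S) ->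
    forall k, 0 < load b k -> [\/ k \in S, k \in vias rt J
      | k \in [seq target k | k <- rcons Z i & closing a1 k]].
  by move=> h k /h[/K4[]|]; [constructor 1 | constructor 2 | move/sub; constructor 3 | constructor 1].
have K5' : connection d a + (if closing a1 i then load a1 i * d i (target i) else 0) <=
    connection d a1 + \sum_(k <- rcons Z i | closing a1 k) load a1 k * d k (target k).
  by rewrite -cats1 big_cat big_cons big_nil /=; move: K5; case: ifP => _; clear; lia.
case: ifP => [cli|/negbT ncli]; last first.
  split=> //; split=> //.
  - move=> k; rewrite mem_rcons inE => /predU1P[->|]; last exact: K2.
    by rewrite (negPf ncli).
  - by apply: K4' => k; left.
  - by apply: leq_trans K5'; apply: leq_addr.
have [cl1 le1] := K1 i cli; have [_ /targetP[qF qi qS _] _] := closing_via cl1.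
set q := target i in qF qi qS K5' *; rewrite cl1 in K5'.
have iq : i != q by rewrite eq_sym.
have /and3P[iS Oi evi] := cli.
case: ifP => [clq|/negbT nclq].
  have /and3P[qS' Oq evq] := clq.
  case: (posnP (load a i)) => [l0|gt0].
    rewrite move_one_none //; split=> //; split=> //.
    - by move=> k; rewrite mem_rcons inE => /predU1P[->|]; [|exact: K2].
    - by apply: K4' => k; left.
    - by apply: leq_trans K5'; apply: leq_addr.
  have lk k : load (move_one i q a) k + (k == i) = load a k + (k == q).
    exact: load_move_one.
  have oddk k : odd (load (move_one i q a) k) = odd (load a k) (+) (k == i) (+) (k == q).
    exact: odd_load_move_one.
  have ncl k : closing (move_one i q a) k -> [/\ k != i, k != q & closing a k].
    rewrite /closing oddk => /and3P[kS Ok]; case: (eqVneq k i) => [->|ki].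
      by rewrite (negPf evi) (negPf iq).
    case: (eqVneq k q) => [->|kq]; first by rewrite (negPf evq).
    by rewrite !addbF kS Ok.
  split; last by rewrite move_one_clients.
  split.
  - move=> k /ncl[ki kq clk]; have [? le] := K1 k clk; split=> //.
    by have := lk k; rewrite (negPf ki) (negPf kq) !addn0 => ->.
  - move=> k; rewrite mem_rcons inE => /predU1P[->|kZ] /ncl[ki kq clk]; first by rewrite eqxx in ki.
    by have := lk k; rewrite (negPf ki) (negPf kq) !addn0 => ->; apply: K2.
  - move=> k; case: (eqVneq k i) => [->|ki]; first by right; rewrite oddk eqxx (negPf iq) (negPf evi) Oi.
    case: (eqVneq k q) => [->|kq]; first by right; rewrite oddk eqxx (negPf qi) (negPf evq) Oq.
    have := lk k; rewrite (negPf ki) (negPf kq) !addn0 => lkE; rewrite /closing lkE.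
    exact: K3.
  - apply: K4' => k; case: (eqVneq k q) => [-> _|kq gt]; [by right | left].
    by move: gt (lk k); rewrite (negPf kq); clear; lia.
  - apply: leq_trans K5'; apply: leq_trans (connection_move_one dtri dsym _ _ _) _.
    by rewrite leq_add2l leq_pmull // (leq_trans gt0).
have lk k : load (move_all i q a) k =
    if k == i then 0 else if k == q then load a k + load a i else load a k.
  exact: load_move_all.
have clk k : closing (move_all i q a) k = closing a k.
  rewrite /closing lk; case: (eqVneq k i) => [->|_]; first by rewrite evi.
  by case: (eqVneq k q) => [->|//]; rewrite oddD (negPf evi) addbF.
split; last by rewrite move_all_clients.
split.
- move=> k; rewrite clk => ck; have [? le] := K1 k ck; split=> //.
  rewrite lk; case: eqP => // _; case: eqP => // kq.
  by rewrite -kq ck in nclq.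
- move=> k; rewrite mem_rcons inE clk lk => /predU1P[->|kZ] ck; first by rewrite eqxx.
  case: eqP => // _; case: eqP => [kq|_]; last exact: K2.
  by rewrite -kq ck in nclq.
- move=> k; rewrite clk lk => nk; case: eqP => [_|_]; first by left.
  case: eqP => [kq|_]; last exact: K3.
  right; rewrite oddD (negPf evi) addbF kq.
  case: (K3 q nclq) => [l0|//]; rewrite l0 /=.
  by case/orP: qS => [q1|/negPf-> //]; move: nclq; rewrite /closing q1 l0 /= andbT => /negPf.
- move=> k; rewrite lk; case: eqP => // _; case: eqP => [-> _|_ /K4[]].
  + by constructor 3; apply: map_f; rewrite mem_filter cl1 mem_rcons mem_head.
  + by constructor 1.
  + by constructor 2.
  + by move/sub; constructor 3.
- apply: leq_trans K5'; apply: leq_trans (connection_move_all dtri dsym _ _ _) _.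
  by rewrite leq_add2l leq_mul2r le1 orbT.
Qed.

(** The facilities of [S] are already paid for, toggled facilities outside [S] are paid for by their
    root edges, and targets outside [S] by the reopening part of a penalty. The factor 3 is due to
    the distance part of the penalties, where loads have grown. *)
Lemma closing_spec : let a := foldl close_step a1 S in
  [/\ unzip1 a = unzip1 a0, forall i, load a i = 0 \/ odd (load a i) = O i,
      forall i, 0 < load a i -> i \in F
    & connection d a + \sum_(i <- F | 0 < load a i) f i <=
      connection d a0 + \sum_(i <- S) f i + 3 * \sum_(e <- J) join_cost e].
Proof.
suff main s Z a : close_inv Z a -> uniq (Z ++ s) -> close_inv (Z ++ s) (foldl close_step a s).
  move=> a; have [[K1 K2 K3 K4 K5] K6] := main S [::] a1 close_inv0 uS.
  rewrite -/a /= in K1 K2 K3 K4 K5 K6; split=> //.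
  - move=> i; case: (boolP (closing a i)) => [cl|]; last exact: K3.
    by left; apply: K2 => //; case/and3P: cl.
  - move=> i /K4[/SF//|/vias_toggleable/andP[]//|/mapP[k]].
    by rewrite mem_filter => /andP[/closing_via[_ /targetP[]]] ? ? ? ? _ _ ->.
  set C := [seq k <- S | closing a1 k].
  have fX : \sum_(i <- F | 0 < load a i) f i <=
      \sum_(i <- S) f i + \sum_(i <- vias rt J | i \notin S) f i
      + \sum_(k <- C) reopening (target k).
    rewrite -big_filter.
    have -> : \sum_(k <- C) reopening (target k) =
        \sum_(q <- [seq target k | k <- C] | q \notin S) f q.
      rewrite big_map [RHS]big_mkcond; apply: eq_bigr => k _.
      by rewrite /reopening; case: ifP.
    rewrite -[X in _ + X + _]big_filter -[X in _ + X]big_filter -!big_cat /=.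
    apply: sum_subset; first exact: filter_uniq.
    move=> i; rewrite mem_filter !mem_cat !mem_filter => /andP[/K4 h _].
    by case: (boolP (i \in S)) h => //= iS [//|->|->]; rewrite ?orbT.
  have cA : connection d a <= connection d a1 + 3 * \sum_(k <- C) load a0 k * d k (target k).
    apply: (leq_trans K5); rewrite leq_add2l big_distrr /= -big_filter -/C.
    apply: leq_sum_seq => k; rewrite mem_filter => /andP[/closing_via[_ _ le] _] _.
    by rewrite mulnA leq_mul2r le orbT.
  have cW : \sum_(k <- C) (load a0 k * d k (target k) + reopening (target k)) <=
      \sum_(i <- vias rt J | i \in S) toggle_cost i.
    apply: (@leq_trans (\sum_(k <- C) toggle_cost k)).
      rewrite !big_seq; apply: leq_sum => k; rewrite [k \in C]mem_filter => /andP[_ kS].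
      by rewrite /toggle_cost kS.
    rewrite -[leqRHS]big_filter; apply: sum_subset; first exact: filter_uniq.
    move=> k; rewrite [k \in C]mem_filter => /andP[cl kS].
    by rewrite mem_filter kS; case: (closing_via cl).
  have cJ : \sum_(e <- J) join_cost e = \sum_(e <- J | e.2 != rt) d e.1 e.2
      + (\sum_(i <- vias rt J | i \in S) toggle_cost i + \sum_(i <- vias rt J | i \notin S) f i).
    rewrite (bigID (fun e => e.2 == rt)) /= addnC; congr addn.
      rewrite big_seq_cond [RHS]big_seq_cond; apply: eq_bigr => e /andP[eJ ert].
      by rewrite /join_cost (negPf ert) (negPf (Jrt eJ)).
    rewrite -big_filter [LHS](_ : _ = \sum_(i <- vias rt J) toggle_cost i).
      rewrite (bigID (mem S)) /=; congr addn; apply: eq_bigr => i /negPf iS.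
      by rewrite /toggle_cost iS.
    rewrite big_map big_seq [RHS]big_seq; apply: eq_bigr => e; rewrite mem_filter => /andP[ert _].
    by rewrite /join_cost ert.
  have := ti_cost inv; rewrite big_nil addn0 cJ.
  move: cW fX cA; rewrite big_split /=.
  set s1 := \sum_(k <- C) load a0 k * _; set s2 := \sum_(k <- C) _.
  set s3 := \sum_(i <- vias rt J | i \in S) _; set s4 := \sum_(i <- vias rt J | _) _.
  set s5 := \sum_(i <- S) _; set s6 := \sum_(i <- F | _) _; set s7 := \sum_(e <- J | _) _.
  set x1 := connection d a; set x2 := connection d a1; set x3 := connection d a0.
  by clear; lia.
elim: s Z a => [|i s IH] Z a inv0 /=; first by rewrite cats0.
rewrite -cat_rcons => us; apply: IH => //; apply: close_step_inv => //.
by move: us; rewrite cat_uniq rcons_uniq => /andP[/andP[]].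
Qed.

End Run.
End Closing.

(** * A cheap join from the optimum *)

Section OptimalJoin.
Variables (rt : nat) (d : nat -> nat -> nat) (f : nat -> nat) (F S D : seq nat) (O : pred nat).
Variables (s1 so : nat -> nat) (Sopt : seq nat).

Definition initial_assignment : assignment := [seq (j, s1 j) | j <- D].
Notation a0 := initial_assignment.

Hypothesis dtri : forall x y z, d x z <= d x y + d y z.
Hypothesis dsym : forall x y, d x y = d y x.
Hypothesis rtF : rt \notin F.
Hypothesis uS : uniq S.
Hypothesis SF : {subset S <= F}.
Hypothesis loadS : forall i, (0 < load a0 i) = (i \in S).
Hypothesis uSopt : uniq Sopt.
Hypothesis SoptF : {subset Sopt <= F}.
Hypothesis soS : {in D, forall j, so j \in Sopt}.
Hypothesis so_parity : {in Sopt, forall i, odd (count (fun j => so j == i) D) = O i}.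

Definition closed_in_opt : seq nat := [seq i <- S | O i && (i \notin Sopt)].
Notation P := closed_in_opt.
Definition served (i : nat) : seq nat := [seq j <- D | s1 j == i].
Definition closest_client (i : nat) : nat := argmin (fun j => d i (so j)) 0 (served i).
Definition refuge (i : nat) : nat := so (closest_client i).
Definition leader (x : nat) : nat :=
  argmin (fun i => d i x) 0 [seq i <- P | refuge i == x].
(* The optimum may close [i] into an odd facility [refuge i] that we do not
   open: for the nearest such [i], edges (i, root) and (refuge i, root) are
   replaced by (i, refuge i). *)
Definition swaps (i : nat) : bool :=
  [&& O (refuge i), refuge i \notin S & i == leader (refuge i)].
Definition swapped (x : nat) : bool := has (fun i => swaps i && (refuge i == x)) P.

(** In the first part, the degree of a facility has the parity of the sum of its loads in both
    assignments. This is what is required, except at odd facilities open on one side only. Each of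
    these gets one extra edge: to the root, or to its partner in a swap. *)
Definition opt_join : seq edge :=
  [seq (s1 j, so j) | j <- D] ++
  [seq (i, rt) | i <- P & ~~ swaps i] ++
  [seq (i, refuge i) | i <- P & swaps i] ++
  [seq (x, rt) | x <- Sopt & [&& O x, x \notin S & ~~ swapped x]].

Lemma loadE i : load a0 i = count (fun j => s1 j == i) D.
Proof. by rewrite /load count_map. Qed.

Lemma closed_in_optP i : i \in P ->
  [/\ i \in S, O i, i \notin Sopt & 0 < load a0 i].
Proof. by rewrite mem_filter loadS => /andP[/andP[-> ->] ->]. Qed.

Lemma served_neq0 i : i \in S -> served i != [::].
Proof. by rewrite -loadS loadE -size_filter -/(served i); case: (served i). Qed.

Lemma refuge_opt i : i \in S -> refuge i \in Sopt.
Proof.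
move=> iS; have [+ _] := argminP (fun j => d i (so j)) 0 (served_neq0 iS).
by rewrite mem_filter => /andP[_]; apply: soS.
Qed.

(** A minimum is at most the average: [refuge i] is the nearest to [i] among the optimal facilities
    of its clients. *)
Lemma refuge_cost i : i \in S -> load a0 i * d i (refuge i) <= \sum_(j <- D | s1 j == i) d i (so j).
Proof.
move=> iS; have [_ le] := argminP (fun j => d i (so j)) 0 (served_neq0 iS).
rewrite loadE -sum1_count big_distrl /= -big_filter -[leqRHS]big_filter.
by rewrite !big_seq; apply: leq_sum => j jD; rewrite mul1n; apply: le.
Qed.

Lemma leaderP i : i \in P -> let k := leader (refuge i) in
  [/\ k \in P, refuge k = refuge i & d k (refuge i) <= d i (refuge i)].
Proof.
move=> iP; have iG : i \in [seq k <- P | refuge k == refuge i] by rewrite mem_filter eqxx.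
have [|in1 le] := @argminP _ (fun k => d k (refuge i)) 0 [seq k <- P | refuge k == refuge i].
  by case: filter iG.
by move: in1; rewrite -/(leader (refuge i)) mem_filter => /andP[/eqP e kP]; split=> //; apply: le.
Qed.

Lemma refuge_neq i : i \in P -> refuge i != i.
Proof.
by case/closed_in_optP => iS _ nS _; apply: contraNneq nS => <-; apply: refuge_opt.
Qed.

(** Three targets occur. A refuge in [S] is used directly. Otherwise the leader reopens the refuge,
    which is even since the leader does not swap, and the others move to the leader, at most twice
    as far away as the refuge. So each optimal facility is reopened for one leader only. *)
Lemma closed_targets i : i \in P -> ~~ swaps i ->
  [/\ i \in F, ~~ nilp (targets F S O i)
    & penalty_to d f S a0 i (target d f F S O a0 i) <=
      2 * (load a0 i * d i (refuge i)) + (i == leader (refuge i)) * f (refuge i)].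
Proof.
move=> iP nsw; have [iS Oi nS _] := closed_in_optP iP; set x := refuge i.
have xO := refuge_opt iS; have xi := refuge_neq iP.
have [kP kx dk] := leaderP iP; set k := leader _ in kP kx dk *.
have [kS Ok _ _] := closed_in_optP kP.
suff [q qT le] : exists2 q, q \in targets F S O i & penalty_to d f S a0 i q <=
      2 * (load a0 i * d i x) + (i == k) * f x.
  have ne : ~~ nilp (targets F S O i) by case: targets qT.
  split=> //; first exact: SF.
  by have [_ _ _ min] := targetP d f a0 ne; apply: leq_trans (min q qT) le.
case: (boolP (x \in S)) => xS.
  exists x; first by rewrite mem_filter xi xS SoptF.
  rewrite /penalty_to /reopening xS addn0; apply: leq_trans (leq_addr _ _).
  exact: leq_pmull.
case: (eqVneq i k) => [ik|ik].
  exists x; last by rewrite /penalty_to /reopening (negPf xS) mul1n leq_add2r leq_pmull.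
  rewrite mem_filter xi (SoptF xO) (negPf xS) /= andbT; apply: contra nsw => Ox.
  by rewrite /swaps Ox xS -/k -ik eqxx.
exists k; first by rewrite mem_filter eq_sym ik kS SF.
rewrite /penalty_to /reopening kS mul0n !addn0 mulnCA leq_mul2l.
by rewrite mul2n -addnn (leq_trans (dtri i x k)) ?orbT // leq_add2l dsym.
Qed.

Lemma opt_join_edges : {in opt_join, forall e, e.1 != e.2 ->
  e \in join_edges rt F S O}.
Proof.
move=> e eJ ne; rewrite !mem_cat in eJ; case/or4P: eJ ne => /mapP[i].
- move=> iD -> /= ne; apply: mem_join_edges => //; last by apply: SoptF; apply: soS.
  by apply: SF; rewrite -loadS loadE -has_count; apply/hasP; exists i.
- rewrite mem_filter => /andP[nsw iP] -> _; have [iF nT _] := closed_targets iP nsw.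
  have [iS Oi _ _] := closed_in_optP iP.
  by rewrite mem_join_toggle // iF /toggleable Oi nT orbT.
- rewrite mem_filter => /andP[_ /closed_in_optP[iS _ _ _]] -> ne.
  by apply: mem_join_edges => //; [apply: SF | apply: SoptF; apply: refuge_opt].
- rewrite mem_filter => /andP[/and3P[Ox xS _] xO] -> _.
  by rewrite mem_join_toggle // (SoptF xO) /toggleable Ox xS.
Qed.

Lemma count_swaps x : count (fun i => swaps i && (refuge i == x)) P = swapped x.
Proof.
apply/eqP; rewrite eqn_leq; apply/andP; split; last first.
  by rewrite /swapped has_count; case: count.
rewrite /swapped; case: hasP => [_|no] /=; last first.
  by rewrite leqn0 eqn0Ngt -has_count; apply/hasP.
apply: (@leq_trans (count (pred1 (leader x)) P)).
  by apply: sub_count => i /andP[/and3P[_ _ /eqP il] /eqP ix]; rewrite /= il ix.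
by rewrite count_uniq_mem ?filter_uniq //; case: (_ \in _).
Qed.

Lemma opt_join_parity : join rt id [seq i <- S | odd (load a0 i) != O i] opt_join.
Proof.
move=> v vrt.
have star (s : seq nat) : uniq s ->
    count (cross id v) [seq (i, rt) | i <- s] = (v \in s).
  move=> us; rewrite count_map -(count_uniq_mem v us); apply: eq_count => i /=.
  by rewrite /cross /= [rt == v]eq_sym (negPf vrt) addbF.
have c1 : odd (count (cross id v) [seq (s1 j, so j) | j <- D]) =
    odd (load a0 v) (+) odd (count (fun j => so j == v) D).
  by rewrite loadE count_map -odd_count_addb.
have c2 : count (cross id v) [seq (i, refuge i) | i <- P & swaps i] =
    (swaps v && (v \in P)) + swapped v.
  have -> : (swaps v && (v \in P) : nat) = count (pred1 v) [seq i <- P | swaps i].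
    rewrite [RHS]count_uniq_mem; last by do 2?apply: filter_uniq.
    by rewrite [in RHS]mem_filter.
  rewrite -count_swaps count_map !(count_filter _ swaps) !count_sum -big_split.
  rewrite big_seq [RHS]big_seq; apply: eq_bigr => i iP /=.
  rewrite /cross /=; case: (swaps i); rewrite ?andbF ?andbT //=.
  by case: (eqVneq i v) (refuge_neq iP) => [->|_] /=; [move/negPf-> | case: (_ == v)].
rewrite !count_cat !oddD c1 c2 !star ?(filter_uniq, uS) // oddD !oddb.
have mP : (v \in P) = [&& v \in S, O v & v \notin Sopt] by rewrite mem_filter andbC.
have -> : (v \in [seq i <- P | ~~ swaps i]) = ~~ swaps v && (v \in P) by rewrite mem_filter.
have -> : (v \in [seq x <- Sopt | [&& O x, x \notin S & ~~ swapped x]]) =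
  [&& O v, v \notin S & ~~ swapped v] && (v \in Sopt) by rewrite mem_filter.
rewrite {}mP mem_filter; set sw := swapped v.
have swP : sw -> [/\ v \in Sopt, O v & v \notin S].
  by case/hasP => i /closed_in_optP[iS _ _ _] /andP[/and3P[]] + + _ /eqP <-; rewrite refuge_opt.
case: (boolP (v \in Sopt)) => vO.
  rewrite (so_parity vO) !andbF /=.
  case: (boolP (v \in S)) => vS.
    have -> : sw = false by apply/negP => /swP[_ _]; rewrite vS.
    by rewrite !andbF /= !addbF; case: (odd _); case: (O v).
  have -> : load a0 v = 0 by apply/eqP; rewrite eqn0Ngt loadS.
  case: (boolP sw) => [/swP[_ -> _]|_] //=.
  by rewrite ?andbT ?andbF ?addbF; case: (O v).
have -> : sw = false by apply/negP => /swP[]; rewrite (negPf vO).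
have -> : count (fun j => so j == v) D = 0.
  apply/eqP; rewrite eqn0Ngt -has_count; apply/hasPn => j jD.
  by apply: contraNneq vO => <-; apply: soS.
case: (boolP (v \in S)) => vS.
  by rewrite /= !andbT !addbF; case: (swaps v); case: (odd _); case: (O v).
have -> : load a0 v = 0 by apply/eqP; rewrite eqn0Ngt loadS.
by rewrite /= !andbF.
Qed.

Let X : nat := \sum_(j <- D) d (s1 j) (so j).

Lemma sum_refuge : \sum_(i <- P) load a0 i * d i (refuge i) <= X.
Proof.
apply: (@leq_trans (\sum_(i <- S) load a0 i * d i (refuge i))).
  apply: sum_subset; first exact: filter_uniq.
  by move=> i; rewrite mem_filter => /andP[].
have s1S : {in D, forall j, s1 j \in S}.
  by move=> j jD; rewrite -loadS loadE -has_count; apply/hasP; exists j.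
rewrite /X (sum_fibers (fun i j => d i (so j)) uS s1S) !big_seq.
by apply: leq_sum => i iS; apply: refuge_cost.
Qed.

(** The client edges cost [X], the closings [2 * X] plus one opening cost per refuge, the swaps [X],
    and the facilities opened by the optimum alone at most the opening costs once more. *)
Lemma opt_join_cost : \sum_(e <- opt_join) join_cost rt d f F S O a0 e <=
  4 * X + 2 * \sum_(x <- Sopt) f x.
Proof.
have rtn i : i \in F -> (i == rt) = false by apply: contraTF => /eqP->.
rewrite !big_cat !big_map /=.
have p1 : \sum_(j <- D) join_cost rt d f F S O a0 (s1 j, so j) = X.
  rewrite /X big_seq [RHS]big_seq; apply: eq_bigr => j jD.
  have s1S : s1 j \in S by rewrite -loadS loadE -has_count; apply/hasP; exists j.
  by rewrite /join_cost /= (rtn _ (SF s1S)) (rtn _ (SoptF (soS jD))).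
have p2 : \sum_(i <- [seq i <- P | ~~ swaps i]) join_cost rt d f F S O a0 (i, rt) <=
    2 * X + \sum_(x <- Sopt) f x.
  apply: (@leq_trans (\sum_(i <- P) (2 * (load a0 i * d i (refuge i))
                        + (i == leader (refuge i)) * f (refuge i)))).
    rewrite big_filter [leqRHS](bigID (fun i => ~~ swaps i)) /=.
    apply: leq_trans (leq_addr _ _); apply: leq_sum_seq => i iP nsw.
    have [_ _ le] := closed_targets iP nsw; have [iS _ _ _] := closed_in_optP iP.
    by rewrite /join_cost /= eqxx /toggle_cost iS.
  rewrite big_split /= -big_distrr /= leq_add //.
    by rewrite leq_mul2l sum_refuge.
  have rS : {in P, forall i, refuge i \in Sopt}.
    by move=> i /closed_in_optP[iS _ _ _]; apply: refuge_opt.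
  rewrite (sum_fibers (fun x i => (i == leader x) * f x) uSopt rS).
  apply: leq_sum => x _; rewrite -big_filter.
  apply: sum_at_most_one; rewrite ?filter_uniq //; last by move=> i _; case: eqP; rewrite ?mul1n.
  by move=> i k _ _; case: eqP => // -> _; case: eqP => // ->.
have p3 : \sum_(i <- [seq i <- P | swaps i]) join_cost rt d f F S O a0 (i, refuge i) <= X.
  apply: leq_trans sum_refuge; rewrite big_filter [leqRHS](bigID swaps) /=.
  apply: leq_trans (leq_addr _ _); apply: leq_sum_seq => i iP _.
  have [iS _ _ l0] := closed_in_optP iP.
  by rewrite /join_cost /= (rtn _ (SF iS)) (rtn _ (SoptF (refuge_opt iS))) leq_pmull.
have p4 : \sum_(x <- [seq x <- Sopt | [&& O x, x \notin S & ~~ swapped x]])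
    join_cost rt d f F S O a0 (x, rt) <= \sum_(x <- Sopt) f x.
  rewrite big_filter [leqRHS](bigID (fun x => [&& O x, x \notin S & ~~ swapped x])) /=.
  apply: leq_trans (leq_addr _ _); apply: leq_sum => x /and3P[_ xS _].
  by rewrite /join_cost /= eqxx /toggle_cost (negPf xS).
rewrite p1; apply: leq_trans (leq_add (leqnn X) (leq_add p2 (leq_add p3 p4))) _.
by move: X (\sum_(x <- Sopt) f x); clear; lia.
Qed.

End OptimalJoin.

(** * The complete algorithm on integral data *)

Section Solve.
Variables (rt : nat) (d : nat -> nat -> nat) (f : nat -> nat) (F D : seq nat) (O : pred nat).

(** Opened facilities without clients are dropped, so that [S] is exactly the set of positive loads,
    as the bounds on closing require. *)
Definition used_facilities : seq nat :=
  [seq i : nat <- opened_facilities d f F D | has (fun j => nearest d f F D j == i) D].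
Definition first_assignment : assignment := initial_assignment D (nearest d f F D).
Definition parity_assignment : assignment :=
  (correct_parity rt used_facilities O first_assignment
     (join_edges rt F used_facilities O)
     (join_cost rt d f F used_facilities O first_assignment)).1.
Definition solve : assignment :=
  foldl (close_step d f F used_facilities O first_assignment) parity_assignment
    used_facilities.

Hypothesis dtri : forall x y z, d x z <= d x y + d y z.
Hypothesis dsym : forall x y, d x y = d y x.
Hypothesis d0 : forall x, d x x = 0.
Hypothesis growth1 : {in F, forall i, growth d D i 1 <= 1}.
Hypothesis uF : uniq F.
Hypothesis rtF : rt \notin F.

Variables (Sopt : seq nat) (so : nat -> nat).
Hypotheses (uSopt : uniq Sopt) (SoptF : {subset Sopt <= F}).
Hypothesis soS : {in D, forall j, so j \in Sopt}.
Hypothesis so_parity : {in Sopt, forall i, odd (count (fun j => so j == i) D) = O i}.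

(** Let [B] be the cost compared with. The first connections and openings cost at most [5 * B] each.
    As [X <= 6 * B], some join costs at most [4 * 6 * B + 2 * B = 26 * B]; the join found costs at
    most 4 times as much and enters with factor 3, so the constant is [5 + 5 + 3 * 4 * 26 = 322]. *)
Lemma solve_spec :
  [/\ unzip1 solve = D, forall i, load solve i = 0 \/ odd (load solve i) = O i,
      forall i, 0 < load solve i -> i \in F
    & connection d solve + \sum_(i <- F | 0 < load solve i) f i <=
      322 * opt_cost d f D Sopt so].
Proof.
set s1 := nearest d f F D; set S := used_facilities; set a0 := first_assignment.
have [uO OF _ _] := opened_spec f F D dsym d0.
have uS : uniq S by apply: filter_uniq.
have SF : {subset S <= F} by move=> i; rewrite mem_filter => /andP[_ /OF].
have loadS i : (0 < load a0 i) = (i \in S).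
  rewrite mem_filter loadE -has_count andbC; case: hasP => [[j jD /eqP <-]|]; last by rewrite andbF.
  by rewrite (nearest_opened f dtri dsym d0 uF uSopt SoptF soS).
have rS := rtS rtF SF.
have [J [inv JE Jrt leJ]] := correct_parityP dtri dsym d0 uS rS loadS
  (join_cost_sym rt f F S O a0 dsym) (join_edges_ne rtF)
  (opt_join_edges f dtri dsym rtF SF loadS SoptF soS)
  (opt_join_parity d uS loadS uSopt soS so_parity).
have [cl par inF cost] := closing_spec f dtri dsym uF rtF uS SF loadS inv JE Jrt.
have cl0 : unzip1 a0 = D by rewrite /unzip1 -map_comp map_id.
split=> //; first by rewrite /solve cl.
apply: (leq_trans cost); set B := opt_cost d f D Sopt so.
have c1 : connection d a0 <= 5 * B.
  rewrite /connection big_map; exact: nearest_cost.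
have c2 : \sum_(i <- S) f i <= 5 * B.
  case: (eqVneq D [::]) => [D0|D0].
    have -> : S = [::] by rewrite /S /used_facilities D0; elim: opened_facilities.
    by rewrite big_nil.
  apply: leq_trans (opened_cost f dtri dsym d0 growth1 uF uSopt SoptF soS D0).
  by rewrite big_filter [leqRHS](bigID (fun i => has (fun j => s1 j == i) D)) /= leq_addr.
have c3 := opt_join_cost f O dtri dsym rtF uS SF loadS uSopt SoptF soS.
set X := \sum_(j <- D) d (s1 j) (so j) in c3.
have c4 : X <= 6 * B.
  apply: (@leq_trans (\sum_(j <- D) (d (s1 j) j + d (so j) j))).
    by apply: leq_sum => j _; rewrite [d (so j) j]dsym; apply: dtri.
  rewrite big_split /= mulSn addnC leq_add //; first exact: leq_addl.
  exact: nearest_cost.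
have c5 : \sum_(x <- Sopt) f x <= B by apply: leq_addr.
move: leJ c1 c2 c3 c4 c5; set y1 := \sum_(e <- J) _; set y2 := \sum_(e <- opt_join _ _ _ _ _ _ _ _) _.
move: (connection d a0) (\sum_(i <- S) f i) X (\sum_(x <- Sopt) f x) B y1 y2.
by clear; lia.
Qed.

End Solve.

(** * Running time *)

Lemma polytime_nat_of_bool (X : etype) (b : X -> bool) :
  polytime b -> polytime (fun x => nat_of_bool (b x)).
Proof.
move=> pb; apply: (@polytime_ext _ _ (fun x => if b x then 1 else 0)) => [x|]; last by ptime.
by case: (b x).
Qed.
#[global] Hint Resolve polytime_nat_of_bool : polytime.

Section Assignments.
Variable X : etype.
Implicit Types (a : X -> seq (nat * nat)) (i k : X -> nat).

Lemma polytime_load a i :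
  polytime a -> polytime i -> polytime (fun x => load (a x) (i x)).
Proof. by apply: polytime_comp2; rewrite /load; ptime. Qed.

Lemma polytime_move_all i k a : polytime i -> polytime k -> polytime a ->
  polytime (fun x => move_all (i x) (k x) (a x)).
Proof. by apply: polytime_comp3; rewrite /move_all; ptime. Qed.

(** Recursive functions are recast as left folds to be timed; the flag tells whether the client has
    been moved. *)
Lemma move_one_foldl (i k : nat) (a : assignment) : move_one i k a =
  (foldl (fun (s : bool * assignment) p =>
     if s.1 then (true, rcons s.2 p)
     else if p.2 == i then (true, rcons s.2 (p.1, k)) else (false, rcons s.2 p))
   (false, [::]) a).2.
Proof.
set step := (fun s p => _); suff main b o : (foldl step (b, o) a).2 =
    o ++ if b then a else move_one i k a by rewrite main.
elim: a b o => [|p a IH] b o /=; first by rewrite if_same cats0.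
rewrite {2}/step /=; case: b => /=; first by rewrite IH cat_rcons.
by case: ifP => _; rewrite IH cat_rcons.
Qed.

Lemma polytime_move_one i k a : polytime i -> polytime k -> polytime a ->
  polytime (fun x => move_one (i x) (k x) (a x)).
Proof.
apply: polytime_comp3; apply: (polytime_ext (fun p => esym (move_one_foldl p.1 p.2.1 p.2.2))).
apply: polytime_snd; apply: (@polytime_foldl_add _ _ _
  (fun x (s : bool * seq (nat * nat)) p => if s.1 then (true, rcons s.2 p)
     else if p.2 == x.1 then (true, rcons s.2 (p.1, x.2.1)) else (false, rcons s.2 p))
  (fun x => x.2.2) (fun=> (false, [::])) _ _ _ (fun p => sz p.1 + sz p.2 + 5)); try ptime.
- apply: poly_boundedD (poly_bounded_const _ _).
  by apply: poly_boundedD; apply: polytime_sz; ptime.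
- move=> [i' [k' a']] [b o] [j c]; rewrite !sz_pair /=.
  have := sz_bool true; have := sz_bool false; case: b => /=; last case: ifP => _;
    by rewrite !sz_pair sz_rcons !sz_pair /=; lia.
Qed.

End Assignments.
#[global] Hint Resolve polytime_load polytime_move_one polytime_move_all : polytime.

Section Forests.
Variable X : etype.
Implicit Types (l : X -> seq (nat * nat)) (v : X -> nat).

(** Kept and reversed edges need separate accumulators: the former keep their order, while the
    latter are consed, since the first edge reversed must come last. *)
Lemma reroot_foldl (v : nat) (l : seq edge) : reroot v l =
  let s := foldl (fun (s : nat * (seq edge * seq edge)) (e : edge) =>
     if e.1 == s.1 then (e.2, (s.2.1, (e.2, s.1) :: s.2.2)) else (s.1, (rcons s.2.1 e, s.2.2)))
   (v, ([::], [::])) l in s.2.1 ++ s.2.2.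
Proof.
set step := (fun s e => _); suff main o t : let s := foldl step (v, (o, t)) l in
    s.2.1 ++ s.2.2 = o ++ reroot v l ++ t by rewrite /= main cats0.
elim: l v o t => [|[x y] l IH] v o t //=.
rewrite {2 4}/step /=; case: (eqVneq x v) => [xv|_] /=; rewrite IH ?xv cat_rcons //.
Qed.

Lemma polytime_reroot v l : polytime v -> polytime l ->
  polytime (fun x => reroot (v x) (l x)).
Proof.
apply: polytime_comp2; apply: (polytime_ext (fun p => esym (reroot_foldl p.1 p.2))) => /=.
have pf : polytime (fun x : nat * seq (nat * nat) =>
    foldl (fun (s : nat * (seq edge * seq edge)) (e : edge) =>
     if e.1 == s.1 then (e.2, (s.2.1, (e.2, s.1) :: s.2.2)) else (s.1, (rcons s.2.1 e, s.2.2)))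
     (x.1, ([::], [::])) x.2).
  apply: (@polytime_foldl_measure _ _ _ (fun _ (s : nat * (seq (nat * nat) * seq (nat * nat))) (e : nat * nat) =>
     if e.1 == s.1 then (e.2, (s.2.1, (e.2, s.1) :: s.2.2)) else (s.1, (rcons s.2.1 e, s.2.2)))
     (fun x => x.2) (fun x => (x.1, ([::], [::]))) _ _ _
     (fun s => sz s.1 + sz s.2.1 + sz s.2.2) 4 (fun p => 2 * sz p.2 + 3)); try ptime.
  - by case=> w [o t]; rewrite !sz_pair /=; lia.
  - by case=> w [o t]; rewrite !sz_pair /=; lia.
  - apply: poly_boundedD (poly_bounded_const _ _).
    by apply: poly_boundedM (poly_bounded_const _ _) _; apply: polytime_sz; ptime.
  - move=> _ [w [o t]] [x y] /=; rewrite sz_pair /=.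
    by case: ifP => _ /=; rewrite ?sz_cons ?sz_rcons !sz_pair; lia.
by apply: polytime_cat; do 2?[apply: polytime_fst | apply: polytime_snd]; apply: pf.
Qed.

End Forests.
#[global] Hint Resolve polytime_reroot : polytime.

Lemma sz_reroot v (l : seq (nat * nat)) : sz (reroot v l : seq (nat * nat)) = sz l.
Proof.
elim: l v => //= -[x y] l IH v; case: eqP => [/= <-|_].
  by rewrite sz_rcons sz_cons IH !sz_pair [sz y + _]addnC.
by rewrite !sz_cons IH.
Qed.

Section LinkForests.
Variable X : etype.

Lemma polytime_forest_of (rt : X -> nat) (M : X -> seq (nat * nat)) :
  polytime rt -> polytime M -> polytime (fun x => forest_of (rt x) (M x)).
Proof.
move=> prt pM; rewrite /forest_of; apply: polytime_reroot => //.
apply: (@polytime_foldl_add _ _ _ (fun _ (l : seq (nat * nat)) e => link l e : seq (nat * nat))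
   M (fun=> [::]) _ _ _ (fun p => sz p.2 + 1)); try ptime.
- by rewrite /link; ptime.
- by apply: poly_boundedD (poly_bounded_const _ _); apply: polytime_sz; ptime.
- move=> z l [x y]; rewrite /link sz_rcons !sz_reroot !sz_pair /=; lia.
Qed.

End LinkForests.
#[global] Hint Resolve polytime_forest_of : polytime.

Section Growing.
Variable X : etype.

Lemma polytime_relabel (a b i : X -> nat) : polytime a -> polytime b -> polytime i ->
  polytime (fun x => relabel (a x) (b x) (i x)).
Proof. by move=> pa pb pi; rewrite /relabel; ptime. Qed.

Lemma polytime_merge_active (rt a b : X -> nat) (A : X -> seq nat) :
  polytime rt -> polytime a -> polytime b -> polytime A ->
  polytime (fun x => merge_active (rt x) (a x) (b x) (A x)).
Proof.
move=> prt pa pb pA; rewrite /merge_active.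
apply: polytime_cat; first by ptime.
apply: (@polytime_comp3 _ _ _ _ _ (fun a b (A : seq nat) => [seq x : nat <- A | (x != a) && (x != b)])) => //.
ptime.
Qed.

Lemma polytime_cacts (A : X -> seq nat) (e : X -> nat * nat * (nat * nat) * nat) :
  polytime A -> polytime e -> polytime (fun x => cacts (A x) (e x)).
Proof. by move=> pA pe; rewrite /cacts; ptime. Qed.

Lemma polytime_gw_src (rt : X -> nat) (e : X -> nat * nat * (nat * nat) * nat) :
  polytime rt -> polytime e -> polytime (fun x => gw_src (rt x) (e x)).
Proof. by move=> prt pe; rewrite /gw_src; ptime. Qed.

Lemma polytime_gw_dst (rt : X -> nat) (e : X -> nat * nat * (nat * nat) * nat) :
  polytime rt -> polytime e -> polytime (fun x => gw_dst (rt x) (e x)).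
Proof. by move=> prt pe; rewrite /gw_dst; ptime. Qed.

End Growing.
#[global] Hint Resolve polytime_relabel polytime_merge_active polytime_cacts
  polytime_gw_src polytime_gw_dst : polytime.

Section EdgeGrowth.
Variable X : etype.

Lemma polytime_gw_growth (A : X -> seq nat) (e : X -> nat * nat * (nat * nat) * nat) :
  polytime A -> polytime e -> polytime (fun x => gw_growth (A x) (e x)).
Proof. by move=> pA pe; rewrite /gw_growth; ptime. Qed.

End EdgeGrowth.
#[global] Hint Resolve polytime_gw_growth : polytime.

Section Contractions.
Variable X : etype.

Lemma polytime_gw_next (A : X -> seq nat) (E : X -> seq (nat * nat * (nat * nat) * nat)) :
  polytime A -> polytime E -> polytime (fun x => gw_next (A x) (E x)).
Proof. by apply: polytime_comp2; rewrite /gw_next; ptime. Qed.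

Lemma polytime_gw_contract (rt : X -> nat) (e : X -> nat * nat * (nat * nat) * nat)
    (A : X -> seq nat) (E : X -> seq (nat * nat * (nat * nat) * nat)) :
  polytime rt -> polytime e -> polytime A -> polytime E ->
  polytime (fun x => gw_contract (rt x) (e x) (A x) (E x)).
Proof.
move=> prt pe pA pE.
apply: (@polytime_comp3 _ _ _ _ _ (fun (q : nat * (nat * nat * (nat * nat) * nat))
  (A : seq nat) (E : seq (nat * nat * (nat * nat) * nat)) => gw_contract q.1 q.2 A E)
  (fun x => (rt x, e x))) => //; last by ptime.
rewrite /gw_contract /gw_update /cedge; ptime.
Qed.

End Contractions.
#[global] Hint Resolve polytime_gw_next polytime_gw_contract : polytime.

Lemma sz_filter (U : etype) (p : pred U) (s : seq U) : sz (filter p s) <= sz s.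
Proof. by elim: s => //= u s IH; case: ifP => _; rewrite ?sz_cons; lia. Qed.

Lemma polytime_odd (X : etype) (n : X -> nat) : polytime n -> polytime (fun x => odd (n x)).
Proof.
move=> pn; apply: (@polytime_ext _ _ (fun x => head false (bits (n x)))); last by ptime.
by move=> x; rewrite bitsE; case: eqP => // ->.
Qed.
#[global] Hint Resolve polytime_odd : polytime.

Section GW.
Variable X : etype.

Definition cedge_sum (e : cedge) : nat :=
  e.1.1.1 + e.1.1.2 + e.1.2.1 + e.1.2.2 + e.2.
Definition cedge_le (N : nat) (e : cedge) : bool :=
  [&& e.1.1.1 <= N, e.1.1.2 <= N, e.1.2.1 <= N, e.1.2.2 <= N & e.2 <= N].

Lemma sz_cedge_le N (e : nat * nat * (nat * nat) * nat) : cedge_le N e ->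
  sz e <= 20 * sz N + 9.
Proof.
case: e => [[[u v] [u' v']] c] /and5P[/= h1 h2 h3 h4 h5]; rewrite !sz_pair /=.
move: (leq_sz_nat h1) (leq_sz_nat h2) (leq_sz_nat h3) (leq_sz_nat h4) (leq_sz_nat h5).
by clear; lia.
Qed.

Lemma gw_update_le N eps (A : seq nat) (g e : cedge) rt : cedge_le N g -> cedge_le N e ->
  cedge_le N (gw_update eps (gw_src rt g) (gw_dst rt g) A e).
Proof.
case/and5P=> _ _ g1 g2 _ /and5P[e1 e2 e3 e4 e5].
have leb : gw_dst rt g <= N by rewrite /gw_dst; case: ifP.
rewrite /cedge_le /= e1 e2 (leq_trans (leq_subr _ _) e5) andbT /=.
by rewrite /relabel; apply/andP; split; case: ifP.
Qed.

Lemma polytime_gw_step (rt : X -> nat)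
    (st : X -> seq (nat * nat * (nat * nat) * nat) * (seq nat * seq (nat * nat))) :
  polytime rt -> polytime st -> polytime (fun x => gw_step (rt x) (st x)).
Proof. by apply: polytime_comp2; rewrite /gw_step /gw_state /cedge; cbv zeta; ptime. Qed.

End GW.

Section GWLoop.
Variable X : etype.

Lemma polytime_gw (rt : X -> nat) (E : X -> seq (nat * nat * (nat * nat) * nat))
    (A : X -> seq nat) :
  polytime rt -> polytime E -> polytime A -> polytime (fun x => gw (rt x) (E x) (A x)).
Proof.
move=> prt pE pA; rewrite /gw; do 2?apply: polytime_snd.
(* [N] bounds all numbers in the initial edges, hence all later ones, since labels are only copied
   and residual costs only decrease. Only the active list and the output grow, by a bounded amount
   per step. *)
pose N x := sumn [seq cedge_sum e | e <- E x].
have pN : polytime N by rewrite /N /cedge_sum; apply: polytime_sumn; apply: polytime_map => //; ptime.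
have bN := polytime_sz pN.
pose Inv x (st : gw_state) := size st.1 <= size (E x) /\ all (cedge_le (N x)) st.1.
apply: (@polytime_foldl_gen X _ _ (fun x (st : seq (nat * nat * (nat * nat) * nat) *
    (seq nat * seq (nat * nat))) _ => gw_step (rt x) st) E (fun x => (E x, (A x, [::])))
  _ _ _ Inv (fun st => sz st.2.1 + sz st.2.2)
  (fun x => sz (E x) * (20 * sz (N x) + 10) + 3 + sz (A x)) 1
  (fun p => 12 * sz (N p.1) + 10)); try ptime.
- apply: polytime_gw_step; last by ptime.
  by apply: (polytime_comp prt); ptime.
- move=> x; split=> //=; apply/allP => e eE.
  have : cedge_sum e <= N x.
    by rewrite /N sumnE big_map (big_rem e) //= leq_addr.
  by rewrite /cedge_le /cedge_sum => le; do ?[apply/andP; split]; lia.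
- move=> x st _ [szE leE]; rewrite /gw_step; case: ifP => [//|/negbT nc]; split=> /=.
    by apply: leq_trans szE; rewrite size_filter -(size_map (gw_update
     (gw_growth st.2.1 (gw_next st.2.1 st.1)) (gw_src (rt x) (gw_next st.2.1 st.1))
         (gw_dst (rt x) (gw_next st.2.1 st.1)) st.2.1) st.1) count_size.
  have gE : gw_next st.2.1 st.1 \in st.1.
    have [|+ _] := @argminP _ (gw_growth st.2.1) (0, 0, (0, 0), 0) [seq e <- st.1 | 0 < cacts st.2.1 e].
      by case: filter nc.
    by rewrite mem_filter => /andP[].
  apply/allP => f; rewrite mem_filter => /andP[_ /mapP[e eE ->]].
  by apply: gw_update_le; apply: (allP leE).
- apply: poly_boundedD; first apply: poly_boundedD (poly_bounded_const _ _).
    apply: poly_boundedM (polytime_sz pE) _; apply: poly_boundedD (poly_bounded_const _ _).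
    exact: poly_boundedM (poly_bounded_const _ _) bN.
  exact: polytime_sz.
- apply: poly_boundedD (poly_bounded_const _ _).
  apply: poly_boundedM (poly_bounded_const _ _) _.
  by apply: polytime_sz; apply: (polytime_comp pN); ptime.
- by move=> x /=; rewrite sz_nil; lia.
- move=> x st u [szE leE]; rewrite /gw_step /=; case: ifP => [_|/negbT nc /=].
    by rewrite leq_addr.
  set g := gw_next _ _.
  have gE : g \in st.1.
    have [|+ _] := @argminP _ (gw_growth st.2.1) (0, 0, (0, 0), 0) [seq e <- st.1 | 0 < cacts st.2.1 e].
      by case: filter nc.
    by rewrite mem_filter => /andP[].
  have /and5P[g1 g2 g3 g4 g5] := allP leE g gE.
  have gd : gw_dst (rt x) g <= N x by rewrite /gw_dst; case: ifP.
  have m1 : sz (merge_active (rt x) (gw_src (rt x) g) (gw_dst (rt x) g) st.2.1) <=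
      sz (gw_dst (rt x) g) + 2 + sz st.2.1.
    apply: leq_trans (sz_cat _ _) _; apply: leq_add; last exact: sz_filter.
    by case: ifP => _; rewrite ?sz_cons ?sz_nil; lia.
  have m2 : sz (rcons st.2.2 g.1.1) = (sz g.1.1 + sz st.2.2).+1 := sz_rcons _ _.
  have m3 : sz g.1.1 = (sz g.1.1.1 + sz g.1.1.2).+1 by case: (g.1.1).
  have pure a' a b m' m e y v n : a' <= b + 2 + a -> m' = (e + m).+1 -> e = (y + v).+1 ->
      y <= 4 * n + 1 -> v <= 4 * n + 1 -> b <= 4 * n + 1 -> a' + m' <= a + m + (12 * n + 10).
    by clear; lia.
  exact: pure m1 m2 m3 (leq_sz_nat g1) (leq_sz_nat g2) (leq_sz_nat gd).
- move=> x [E' [A' M']] [szE leE] /=.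
  have : sz E' <= size E' * (20 * sz (N x) + 9).+1 + 1.
    by apply: sz_seq_le; apply: sub_all leE => e /sz_cedge_le.
  rewrite /= in szE; move: szE (size_le_sz (E x)); rewrite !sz_pair /= => le1 le2 le3.
  have le4 : size E' * (20 * sz (N x) + 9).+1 <= sz (E x) * (20 * sz (N x) + 10).
    by apply: leq_mul; [apply: leq_trans le1 le2 | rewrite [leqRHS]addnS].
  have pure e t y m c w : t <= c -> e <= t + 1 ->
      (e + (y + m).+1).+1 <= c + 3 + w + 1 * (y + m).
    by clear; lia.
  exact: pure le4 le3.
Qed.

End GWLoop.
#[global] Hint Resolve polytime_gw : polytime.

Section Tokens.
Variable X : etype.
Implicit Types (h : X -> seq (nat * nat)) (i : X -> nat).

Lemma polytime_tokens_at i h : polytime i -> polytime h ->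
  polytime (fun x => tokens_at (i x) (h x)).
Proof. by apply: polytime_comp2; rewrite /tokens_at; ptime. Qed.

Lemma polytime_tokens_off i h : polytime i -> polytime h ->
  polytime (fun x => tokens_off (i x) (h x)).
Proof. by apply: polytime_comp2; rewrite /tokens_off; ptime. Qed.

End Tokens.
#[global] Hint Resolve polytime_tokens_at polytime_tokens_off : polytime.

Lemma sz_tokens (x : nat) (h : seq (nat * nat)) : ~~ nilp (tokens_at x h) ->
  sz (origin_at x h) + sz (tokens_off x h) <= sz h.
Proof.
rewrite /origin_at /tokens_at /tokens_off; elim: h => //= -[y o] h IH /=.
case: (eqVneq y x) => [_ _|_ ne] /=.
  have := sz_filter (fun t : nat * nat => t.1 != x) h.
  by rewrite sz_cons sz_pair /=; clear; lia.
by have := IH ne; rewrite /= !sz_cons; clear; lia.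
Qed.

Lemma sz_move_one i k (a : seq (nat * nat)) : sz (move_one i k a : seq (nat * nat)) <= sz a + sz k.
Proof.
elim: a => [|[j c] a IH] /=; first by rewrite leq_addr.
by case: ifP => _; rewrite !sz_cons ?sz_pair /=; move: IH; clear; lia.
Qed.

Section TokenPassTime.
Variable X : etype.

Lemma polytime_token_pass (rt : X -> nat) (a h l : X -> seq (nat * nat)) :
  polytime rt -> polytime a -> polytime h -> polytime l ->
  polytime (fun x => foldl (token_step (rt x)) (a x, h x) (l x)).
Proof.
move=> prt pa ph pl.
apply: (@polytime_foldl_add X _ _ (fun x (st : seq (nat * nat) * seq (nat * nat))
   (e : nat * nat) => token_step (rt x) st e) l (fun x => (a x, h x)) _ _ _
   (fun p => sz p.2 + 2)); try ptime.
- have prt' : polytime (fun p : X * (seq (nat * nat) * seq (nat * nat) * (nat * nat)) => rt p.1).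
    by apply: (polytime_comp prt); ptime.
  rewrite /token_step /origin_at /token_state /edge /assignment; cbv zeta; ptime.
- by apply: poly_boundedD (poly_bounded_const _ _); apply: polytime_sz; ptime.
move=> x [b k] [y z]; rewrite /token_step /=; case: ifP => [_|/negbT n1]; first by rewrite leq_addr.
have t1 := sz_tokens n1; case: ifP => _; last case: ifP => [_|/negbT n2].
- rewrite !sz_pair /=; have := sz_move_one (origin_at y k) y b.
  by move: t1; clear; lia.
- by rewrite !sz_pair sz_cons sz_pair /=; move: t1; clear; lia.
- have t2 := sz_tokens n2; rewrite !sz_pair /=.
  have := sz_move_one (origin_at y k) (origin_at z (tokens_off y k)) b.
  by move: t1 t2; clear; lia.
Qed.

End TokenPassTime.
#[global] Hint Resolve polytime_token_pass : polytime.

Lemma sz_mem (i : nat) (s : seq nat) : i \in s -> sz i <= sz s.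
Proof.
elim: s => //= k s IH; rewrite inE sz_cons => /predU1P[->|/IH]; clear; lia.
Qed.

(* In this section a family of functions is polynomial-time when all its
   composites with polynomial-time functions are. *)
Section FacilityLocation.
Variables (X : etype) (d : X -> nat -> nat -> nat) (f : X -> nat -> nat).
Variables (F D : X -> seq nat).
Hypothesis pd : forall (Y : etype) (x : Y -> X) (i k : Y -> nat),
  polytime x -> polytime i -> polytime k -> polytime (fun y => d (x y) (i y) (k y)).
Hypothesis pf : forall (Y : etype) (x : Y -> X) (i : Y -> nat),
  polytime x -> polytime i -> polytime (fun y => f (x y) (i y)).
Hypothesis pF : forall (Y : etype) (x : Y -> X), polytime x -> polytime (fun y => F (x y)).
Hypothesis pD : forall (Y : etype) (x : Y -> X), polytime x -> polytime (fun y => D (x y)).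

Lemma polytime_growth (Y : etype) (x : Y -> X) (i r : Y -> nat) :
  polytime x -> polytime i -> polytime r ->
  polytime (fun y => growth (d (x y)) (D (x y)) (i y) (r y)).
Proof.
apply: (polytime_comp3 (op := fun x i r => growth (d x) (D x) i r)).
by rewrite /growth; ptime.
Qed.

Lemma polytime_radius (Y : etype) (x : Y -> X) (i : Y -> nat) :
  polytime x -> polytime i ->
  polytime (fun y => radius (d (x y)) (f (x y)) (D (x y)) (i y)).
Proof.
apply: (polytime_comp2 (op := fun x i => radius (d x) (f x) (D x) i)); rewrite /radius.
apply: (@polytime_foldl_nat _ _ (fun (p : X * nat) r (_ : bool) =>
   if growth (d p.1) (D p.1) p.2 (r + r) <= f p.1 p.2 then r + r else r) _ _ (fun=> 1)).
- by have := polytime_growth; ptime.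
- ptime.
- by have := polytime_growth; ptime.
- exact: poly_bounded_const.
- move=> p r _; case: ifP => _; last exact: leq_addr.
  by rewrite -[1]/(up_log 2 2); apply: log_leM; clear; lia.
Qed.

Lemma polytime_opened (Y : etype) (x : Y -> X) : polytime x ->
  polytime (fun y => opened_facilities (d (x y)) (f (x y)) (F (x y)) (D (x y))).
Proof.
apply: (polytime_comp (g := fun x => opened_facilities (d x) (f x) (F x) (D x))) => {Y x}.
have pF0 := pF (polytime_id X); rewrite /opened_facilities; apply: polytime_snd.
apply: (@polytime_foldl_gen X _ _
   (fun x (st : seq nat * seq nat) (_ : nat) => open_step (d x) (f x) (D x) st)
   F (fun x => (F x, [::])) _ _ _ (fun x st => {subset st.1 <= F x})
   (fun st => sz st.1 + sz st.2) (fun x => sz (F x) + 1) 1 (fun p => sz (F p.1) + 1)).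
- by have := polytime_radius; rewrite /open_step; cbv zeta; ptime.
- ptime.
- ptime.
- by move=> x z.
- move=> x [R S] u /= sub; rewrite /open_step /=; case: ifP => //= _ z.
  by rewrite mem_filter => /andP[_ /sub].
- by apply: poly_boundedD (poly_bounded_const _ _); apply: polytime_sz.
- apply: poly_boundedD (poly_bounded_const _ _); apply: polytime_sz.
  by apply: pF; ptime.
- by move=> x /=; rewrite sz_nil.
- move=> x [R S] u /= sub; rewrite /open_step /=; case: ifP => [_|/negbT nR] /=.
    by rewrite leq_addr.
  set i := argmin _ _ _.
  have iR : i \in R.
    by have [|] := @argminP _ (radius (d x) (f x) (D x)) 0 R; first by case: (R) nR.
  have pure a b c e g : a <= b -> c <= g -> a + (c + e).+1 <= b + e + (g + 1).
    by clear; lia.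
  exact: pure (@sz_filter nat_etype _ R) (sz_mem (sub i iR)).
- by move=> x [R S] _; rewrite sz_pair /=; clear; lia.
Qed.

Lemma polytime_nearest (Y : etype) (x : Y -> X) (j : Y -> nat) :
  polytime x -> polytime j ->
  polytime (fun y => nearest (d (x y)) (f (x y)) (F (x y)) (D (x y)) (j y)).
Proof.
apply: (polytime_comp2 (op := fun x j => nearest (d x) (f x) (F x) (D x) j)).
by have := polytime_opened; rewrite /nearest; ptime.
Qed.

Lemma polytime_used (Y : etype) (x : Y -> X) : polytime x ->
  polytime (fun y => used_facilities (d (x y)) (f (x y)) (F (x y)) (D (x y))).
Proof.
apply: (polytime_comp (g := fun x => used_facilities (d x) (f x) (F x) (D x))).
by have := polytime_opened; have := polytime_nearest; rewrite /used_facilities; ptime.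
Qed.

Lemma polytime_first_assignment (Y : etype) (x : Y -> X) : polytime x ->
  polytime (fun y => first_assignment (d (x y)) (f (x y)) (F (x y)) (D (x y)) : seq (nat * nat)).
Proof.
apply: (polytime_comp (g := fun x => first_assignment (d x) (f x) (F x) (D x) : seq (nat * nat))).
by have := polytime_nearest; rewrite /first_assignment /initial_assignment; ptime.
Qed.

Section Parity.
Variables (rt : X -> nat) (O : X -> nat -> bool) (S : X -> seq nat) (a0 : X -> seq (nat * nat)).
Hypothesis pO : forall (Y : etype) (x : Y -> X) (i : Y -> nat),
  polytime x -> polytime i -> polytime (fun y => O (x y) (i y)).
Hypothesis prt : forall (Y : etype) (x : Y -> X), polytime x -> polytime (fun y => rt (x y)).
Hypothesis pS : forall (Y : etype) (x : Y -> X), polytime x -> polytime (fun y => S (x y)).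
Hypothesis pa0 : forall (Y : etype) (x : Y -> X), polytime x -> polytime (fun y => a0 (x y)).

Lemma polytime_targets (Y : etype) (x : Y -> X) (i : Y -> nat) :
  polytime x -> polytime i ->
  polytime (fun y => targets (F (x y)) (S (x y)) (O (x y)) (i y)).
Proof.
apply: (polytime_comp2 (op := fun x i => targets (F x) (S x) (O x) i)).
by rewrite /targets; ptime.
Qed.

Lemma polytime_penalty_to (Y : etype) (x : Y -> X) (i q : Y -> nat) :
  polytime x -> polytime i -> polytime q ->
  polytime (fun y => penalty_to (d (x y)) (f (x y)) (S (x y)) (a0 (x y)) (i y) (q y)).
Proof. by move=> px pi pq; rewrite /penalty_to /reopening; ptime. Qed.

Lemma polytime_target (Y : etype) (x : Y -> X) (i : Y -> nat) :
  polytime x -> polytime i ->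
  polytime (fun y => target (d (x y)) (f (x y)) (F (x y)) (S (x y)) (O (x y)) (a0 (x y)) (i y)).
Proof.
apply: (polytime_comp2 (op := fun x i => target (d x) (f x) (F x) (S x) (O x) (a0 x) i)).
by have := polytime_targets; have := polytime_penalty_to; rewrite /target; ptime.
Qed.

Lemma polytime_toggle_cost (Y : etype) (x : Y -> X) (i : Y -> nat) :
  polytime x -> polytime i ->
  polytime (fun y => toggle_cost (d (x y)) (f (x y)) (F (x y)) (S (x y)) (O (x y)) (a0 (x y)) (i y)).
Proof.
move=> px pi; rewrite /toggle_cost.
by have := polytime_target; have := polytime_penalty_to; ptime.
Qed.

Lemma polytime_join_edges (Y : etype) (x : Y -> X) : polytime x ->
  polytime (fun y => join_edges (rt (x y)) (F (x y)) (S (x y)) (O (x y)) : seq (nat * nat)).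
Proof.
apply: (polytime_comp (g := fun x => join_edges (rt x) (F x) (S x) (O x) : seq (nat * nat))).
have pt := polytime_targets; rewrite /join_edges /toggleable /edge; apply: polytime_cat; ptime.
Qed.

Lemma polytime_join_cost (Y : etype) (x : Y -> X) (e : Y -> nat * nat) :
  polytime x -> polytime e ->
  polytime (fun y => join_cost (rt (x y)) (d (x y)) (f (x y)) (F (x y)) (S (x y))
     (O (x y)) (a0 (x y)) (e y)).
Proof. by move=> px pe; rewrite /join_cost; have := polytime_toggle_cost; ptime. Qed.

Lemma polytime_parity (Y : etype) (x : Y -> X) : polytime x ->
  polytime (fun y => (correct_parity (rt (x y)) (S (x y)) (O (x y)) (a0 (x y))
     (join_edges (rt (x y)) (F (x y)) (S (x y)) (O (x y)))
     (join_cost (rt (x y)) (d (x y)) (f (x y)) (F (x y)) (S (x y)) (O (x y)) (a0 (x y)))).1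
     : seq (nat * nat)).
Proof.
apply: (polytime_comp (g := fun x => (correct_parity (rt x) (S x) (O x) (a0 x)
     (join_edges (rt x) (F x) (S x) (O x))
     (join_cost (rt x) (d x) (f x) (F x) (S x) (O x) (a0 x))).1 : seq (nat * nat))).
have pe := polytime_join_edges; have pc := polytime_join_cost.
rewrite /correct_parity /tokens0 /chosen_edges /wrong_facilities /edge.
apply: polytime_fst; apply: polytime_token_pass; try ptime.
Qed.

Lemma polytime_close_step (Y : etype) (x : Y -> X) (a : Y -> seq (nat * nat)) (i : Y -> nat) :
  polytime x -> polytime a -> polytime i ->
  polytime (fun y => close_step (d (x y)) (f (x y)) (F (x y)) (S (x y)) (O (x y))
    (a0 (x y)) (a y) (i y) : seq (nat * nat)).
Proof.
move=> px pa pi; have pt := polytime_target px pi.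
by rewrite /close_step /closing; ptime.
Qed.

Lemma polytime_close (a1 : X -> seq (nat * nat)) : polytime a1 ->
  polytime (fun x => foldl (close_step (d x) (f x) (F x) (S x) (O x) (a0 x)) (a1 x) (S x)
    : seq (nat * nat)).
Proof.
move=> pa1.
(* The clients in the state never change, and a facility in it comes from [a1] or is a target: an
   element of [F], or the default 0 of [argmin]. So [N] bounds all facility numbers. *)
pose N x := sumn (F x) + sumn [seq p.2 | p <- a1 x].
have pN : polytime N by have := pF (polytime_id X); rewrite /N; ptime.
have leN (G : seq nat) z : z \in G -> z <= sumn G.
  by move=> zG; rewrite sumnE (big_rem z) //= leq_addr.
have tN x i : target (d x) (f x) (F x) (S x) (O x) (a0 x) i <= N x.
  have [t0|ne] := boolP (nilp (targets (F x) (S x) (O x) i)).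
    by rewrite /target (nilP t0).
  have [tF _ _ _] := targetP (d x) (f x) (a0 x) ne.
  by apply: leq_trans (leN _ _ tF) (leq_addr _ _).
pose Inv x (a : seq (nat * nat)) := unzip1 a = unzip1 (a1 x) /\ all (fun p => p.2 <= N x) a.
have inv1 x i k a : k <= N x -> Inv x a -> Inv x (move_one i k a).
  move=> kN [e1 e2]; split; first by rewrite move_one_clients.
  elim: a e2 {e1} => //= p a IH /andP[lep alla].
  by case: ifP => _ /=; [rewrite kN | rewrite lep IH].
have inv2 x i k a : k <= N x -> Inv x a -> Inv x (move_all i k a).
  move=> kN [e1 e2]; split; first by rewrite move_all_clients.
  rewrite /move_all all_map; apply: sub_all e2 => p /= le; by case: ifP.
have szInv x a : Inv x a ->
    sz a <= sz (unzip1 (a1 x)) + sz (unzip1 (a1 x)) * (4 * sz (N x) + 3).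
  move=> [<-]; elim: a => [|[j c] a IH] /=; first by rewrite sz_nil.
  move=> /andP[/leq_sz_nat lec /IH]; rewrite !sz_cons sz_pair /=.
  have := sz_gt0 (j : nat_etype); move: (sz a) (sz (unzip1 a)) (sz (N x)) (sz j) (sz c) lec.
  by clear; nia.
apply: (@polytime_foldl_inv X _ _
  (fun x (a : seq (nat * nat)) i => close_step (d x) (f x) (F x) (S x) (O x) (a0 x) a i : seq (nat * nat))
  S a1 _ _ _ Inv
  (fun x => sz (unzip1 (a1 x)) + sz (unzip1 (a1 x)) * (4 * sz (N x) + 3))) => //.
- by apply: polytime_close_step; ptime.
- by apply: pS; ptime.
- move=> x; split=> //; apply/allP => p pa /=.
  by apply: leq_trans (leN _ _ _) (leq_addl _ _); apply: (map_f snd).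
- move=> x a i inv; rewrite /close_step; case: ifP => // _.
  by case: ifP => _; [apply: inv1 | apply: inv2].
- have bu : poly_bounded (@sz X) (fun x => sz (unzip1 (a1 x))).
    by apply: polytime_sz; rewrite /unzip1; ptime.
  apply: (poly_boundedD bu); apply: (poly_boundedM bu).
  apply: poly_boundedD (poly_bounded_const _ _).
  by apply: poly_boundedM (poly_bounded_const _ _) _; apply: polytime_sz.
Qed.

End Parity.

Lemma polytime_solve (rt : X -> nat) (O : X -> nat -> bool) :
  (forall (Y : etype) (x : Y -> X) (i : Y -> nat),
    polytime x -> polytime i -> polytime (fun y => O (x y) (i y))) ->
  (forall (Y : etype) (x : Y -> X), polytime x -> polytime (fun y => rt (x y))) ->
  polytime (fun x => solve (rt x) (d x) (f x) (F x) (D x) (O x) : seq (nat * nat)).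
Proof.
move=> pO prt.
pose S x := used_facilities (d x) (f x) (F x) (D x).
pose a0 x : seq (nat * nat) := first_assignment (d x) (f x) (F x) (D x).
have pS (Y : etype) (x : Y -> X) : polytime x -> polytime (fun y => S (x y)).
  exact: polytime_used.
have pa0 (Y : etype) (x : Y -> X) : polytime x -> polytime (fun y => a0 (x y)).
  exact: polytime_first_assignment.
exact: (polytime_close pO pS pa0 (polytime_parity pO prt pS pa0 (polytime_id X))).
Qed.

End FacilityLocation.

Lemma index_foldl (i : nat) (s : seq nat) : index i s =
  (foldl (fun (st : bool * nat) (u : nat) =>
     if st.1 then st else if u == i then (true, st.2) else (false, st.2.+1)) (false, 0) s).2.
Proof.
set step := (fun st u => _); suff main b k : (foldl step (b, k) s).2 = k + ~~ b * index i s.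
  by rewrite main add0n mul1n.
elim: s b k => [|u s IH] b k /=; first by rewrite muln0 addn0.
rewrite {2}/step /=; case: b => /=; first by rewrite IH.
by case: (eqVneq u i) => _; rewrite IH /= ?mul1n ?mul0n ?addn0 // addSnnS.
Qed.

Lemma polytime_index (X : etype) (i : X -> nat) (s : X -> seq nat) :
  polytime i -> polytime s -> polytime (fun x => index (i x) (s x)).
Proof.
apply: polytime_comp2; apply: (polytime_ext (fun p => esym (index_foldl p.1 p.2))).
apply: polytime_snd; apply: (@polytime_foldl_measure _ _ _
  (fun p (st : bool * nat) (u : nat) =>
     if st.1 then st else if u == p.1 then (true, st.2) else (false, st.2.+1))
  (fun p : nat * seq nat => p.2) (fun=> (false, 0)) _ _ _
  (fun st => up_log 2 st.2.+1) 5 (fun=> 1)); try ptime.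
- case=> b k; rewrite sz_pair /=; move: (sz_bool b) (sz_nat_le k); clear; lia.
- case=> b k; rewrite sz_pair /=; move: (log_le_sz k); clear; lia.
- exact: poly_bounded_const.
- move=> p [b k] u /=; case: b => /=; first exact: leq_addr.
  case: ifP => _ /=; first exact: leq_addr.
  by rewrite -[1]/(up_log 2 2); apply: log_leM; clear; lia.
Qed.
#[global] Hint Resolve polytime_index : polytime.

Lemma polytime_predn (X : etype) (n : X -> nat) :
  polytime n -> polytime (fun x => (n x).-1).
Proof.
by move=> pn; apply: (@polytime_ext _ _ (fun x => n x - 1)) => [x|]; [rewrite subn1 | ptime].
Qed.
#[global] Hint Resolve polytime_predn : polytime.

(** The final [unit] is encoded as the empty list, so these nested pairs have the same tree as the
    list in [enc_instance]. *)
Definition raw_input : Type :=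
  (seq bool * (seq bool * (seq bool * (seq (nat * nat) * (seq (seq (nat * nat)) * unit)))))%type.

(** * The algorithm on decoded inputs *)

Section Raw.
Implicit Type x : raw_input.

Definition point_ids x : seq nat := iota 0 (size x.1).
Definition facility_ids x : seq nat := [seq i <- point_ids x | nth false x.1 i].
Definition client_ids x : seq nat := [seq i <- point_ids x | nth false x.2.1 i].
Definition odd_id x (i : nat) : bool := nth false x.2.2.1 i.
(** A plain product avoids greatest common divisors, its bit length is at most the sum of those of
    its factors, and it makes the division in [scaled] exact. *)
Definition common_denominator x : nat :=
  foldl (fun m (q : nat * nat) => m * q.2) 1 (x.2.2.2.1 ++ flatten x.2.2.2.2.1).
Definition scaled x (q : nat * nat) : nat := q.1 * common_denominator x %/ q.2.
Definition scaled_cost x (i : nat) : nat :=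
  scaled x (nth (0, 0) x.2.2.2.1 (index i (facility_ids x))).
(* Indices are clamped, so that the triangle inequality holds for all of them. *)
Definition clamp x (i : nat) : nat :=
  if i < (size x.1).-1 then i else (size x.1).-1.
Definition scaled_dist x (i k : nat) : nat :=
  scaled x (nth (0, 0) (nth [::] x.2.2.2.2.1 (clamp x i)) (clamp x k)).

Definition raw_solve x : assignment :=
  solve (size x.1) (scaled_dist x) (scaled_cost x) (facility_ids x) (client_ids x) (odd_id x).
Definition raw_output x : seq bool * seq nat :=
  ([seq 0 < load (raw_solve x) i | i <- point_ids x], unzip2 (raw_solve x)).

End Raw.

Lemma polytime_raw_output : polytime raw_output.
Proof.
have pl (Y : etype) (x : Y -> raw_input) : polytime x -> polytime (fun y => common_denominator (x y)).
  apply: (polytime_comp (g := common_denominator)) => {Y x}.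
  apply: (@polytime_foldl_nat _ _ (fun _ m (q : nat * nat) => m * q.2) _ _ (fun p => sz p.2)).
  - ptime.
  - by rewrite /raw_input; ptime.
  - ptime.
  - by apply: polytime_sz; ptime.
  - move=> x m [a b] /=; rewrite sz_pair /=.
    apply: (@leq_trans (up_log 2 m.+1 + up_log 2 b.+1)); first by apply: log_leM; clear; nia.
    by rewrite leq_add2l; move: (log_le_sz b); clear; lia.
have pids (Y : etype) (x : Y -> raw_input) : polytime x -> polytime (fun y => point_ids (x y)).
  by apply: (polytime_comp (g := point_ids)); rewrite /point_ids /raw_input; ptime.
have pF (Y : etype) (x : Y -> raw_input) : polytime x -> polytime (fun y => facility_ids (x y)).
  by apply: (polytime_comp (g := facility_ids)); rewrite /facility_ids /raw_input; ptime.
have pD (Y : etype) (x : Y -> raw_input) : polytime x -> polytime (fun y => client_ids (x y)).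
  by apply: (polytime_comp (g := client_ids)); rewrite /client_ids /raw_input; ptime.
have pO (Y : etype) (x : Y -> raw_input) (i : Y -> nat) : polytime x -> polytime i ->
    polytime (fun y => odd_id (x y) (i y)).
  by rewrite /odd_id /raw_input => px pi; ptime.
have ps (Y : etype) (x : Y -> raw_input) : polytime x -> polytime (fun y => size (x y).1).
  by rewrite /raw_input => px; ptime.
have pd (Y : etype) (x : Y -> raw_input) (i k : Y -> nat) : polytime x -> polytime i ->
    polytime k -> polytime (fun y => scaled_dist (x y) (i y) (k y)).
  by move=> px pi pk; rewrite /scaled_dist /scaled /clamp /raw_input; ptime.
have pf (Y : etype) (x : Y -> raw_input) (i : Y -> nat) : polytime x -> polytime i ->
    polytime (fun y => scaled_cost (x y) (i y)).
  by move=> px pi; rewrite /scaled_cost /scaled; ptime.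
have pa : polytime (fun x : raw_input => raw_solve x : seq (nat * nat)).
  exact: (polytime_solve pd pf pF pD pO ps).
have pa1 (Y : etype) (x : Y -> raw_input) : polytime x ->
    polytime (fun y => raw_solve (x y) : seq (nat * nat)).
  exact: (polytime_comp pa).
rewrite /raw_output /unzip2; apply: polytime_pair; last by ptime.
by apply: polytime_map; ptime.
Qed.

Import Order.TTheory GRing.Theory Num.Theory.

(** * Integral instances *)

Lemma assignment_fun (a : assignment) : uniq (unzip1 a) ->
  a = [seq (j, nth 0 (unzip2 a) (index j (unzip1 a))) | j <- unzip1 a].
Proof.
elim: a => //= -[j c] a IH /andP[/= nj ua]; rewrite eqxx /= {1}(IH ua); congr cons.
apply/eq_in_map => k ka; case: (eqVneq j k) => [jk|//].
by rewrite jk ka in nj.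
Qed.

Lemma foldl_muln (s : seq (nat * nat)) m :
  foldl (fun m q => m * q.2) m s = m * \prod_(q <- s) q.2.
Proof. by elim: s m => [|q s IH] m /=; rewrite ?big_nil ?muln1 // IH big_cons mulnA. Qed.

Section Instance.
Variable I : instance.
Notation n := (npoints I).

Definition frac (q : rat) : nat * nat := (`|numq q|%N, `|denq q|%N).

Definition raw : raw_input :=
  ([seq i \in facilities I | i <- enum 'I_n],
   ([seq i \in clients I | i <- enum 'I_n],
    ([seq i \in odd_facilities I | i <- enum 'I_n],
     ([seq frac (opening_cost i) | i <- enum (facilities I)],
      ([seq [seq frac (dist i k) | k <- enum 'I_n] | i <- enum 'I_n], tt))))).

Lemma enc_raw : enc raw = enc_instance I.
Proof.
rewrite /enc /= /enc_instance /enc_set -!map_comp /=.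
by do 4!congr Node; congr Node; congr enc_seq; apply: eq_map => i /=; rewrite -map_comp.
Qed.

Definition ids (A : {set 'I_n}) : seq nat := [seq val i | i <- enum A].

Lemma mem_ids (A : {set 'I_n}) (i : 'I_n) : (val i \in ids A) = (i \in A).
Proof. by rewrite mem_map ?mem_enum //; apply: val_inj. Qed.

Lemma ids_uniq A : uniq (ids A).
Proof. by rewrite map_inj_uniq ?enum_uniq //; apply: val_inj. Qed.

Lemma idsP (A : {set 'I_n}) k : k \in ids A -> exists2 i : 'I_n, i \in A & k = val i.
Proof. by case/mapP => i; rewrite mem_enum => iA ->; exists i. Qed.

Lemma nth_mem (A : {set 'I_n}) (i : 'I_n) :
  nth false [seq j \in A | j <- enum 'I_n] i = (i \in A).
Proof. by rewrite (nth_map i) ?size_enum_ord // nth_ord_enum. Qed.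

Lemma size_raw : size raw.1 = n.
Proof. by rewrite size_map size_enum_ord. Qed.

Lemma point_idsE : point_ids raw = [seq val i | i <- enum 'I_n].
Proof. by rewrite /point_ids size_raw val_enum_ord. Qed.

Lemma filter_ids (A : {set 'I_n}) :
  [seq i <- point_ids raw | nth false [seq j \in A | j <- enum 'I_n] i] = ids A.
Proof.
rewrite point_idsE filter_map; congr map.
rewrite (eq_filter (a2 := mem A)) => [|i /=]; last exact: nth_mem.
by rewrite enumT.
Qed.

Lemma facility_idsE : facility_ids raw = ids (facilities I).
Proof. exact: filter_ids. Qed.

Lemma client_idsE : client_ids raw = ids (clients I).
Proof. exact: filter_ids. Qed.

Lemma odd_idE (i : 'I_n) : odd_id raw i = (i \in odd_facilities I).
Proof. exact: nth_mem. Qed.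

Notation L := (common_denominator raw).

Lemma denominators_gt0 (q : nat * nat) :
  q \in raw.2.2.2.1 ++ flatten raw.2.2.2.2.1 -> 0 < q.2.
Proof.
rewrite mem_cat => /orP[/mapP[i _ ->]|/flattenP[s /mapP[i _ ->] /mapP[k _ ->]]] /=;
  by rewrite absz_gt0 denq_neq0.
Qed.

Lemma common_gt0 : 0 < L.
Proof.
rewrite /common_denominator foldl_muln mul1n big_seq.
by apply: prodn_cond_gt0 => q /denominators_gt0.
Qed.

Lemma scaledE (q : rat) : (0 <= q)%R ->
  frac q \in raw.2.2.2.1 ++ flatten raw.2.2.2.2.1 -> ((scaled raw (frac q))%:R = q * L%:R :> rat)%R.
Proof.
move=> q0 qin; rewrite /scaled /=.
have dvd : `|denq q|%N %| L.
  by rewrite /common_denominator foldl_muln mul1n (big_rem _ qin) dvdn_mulr.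
case/dvdnP: dvd => k ->; rewrite mulnA mulnK ?absz_gt0 ?denq_neq0 // !natrM.
rewrite -[X in (_ = X * _)%R](divq_num_den q) !natr_absz.
rewrite (ger0_norm (denq_ge0 q)) ger0_norm ?numq_ge0 //.
by rewrite mulrACA mulVf ?mulr1 ?intr_eq0 ?denq_neq0.
Qed.

Lemma scaled_costE (i : 'I_n) : i \in facilities I ->
  ((scaled_cost raw i)%:R = opening_cost i * L%:R :> rat)%R.
Proof.
move=> iF; rewrite /scaled_cost facility_idsE index_map; last exact: val_inj.
rewrite (nth_map i) ?index_mem ?mem_enum // nth_index ?mem_enum //.
apply: scaledE; first exact: opening_cost_ge0.
rewrite mem_cat; apply/orP; left.
by apply: (map_f (fun i => frac (opening_cost i))); rewrite mem_enum.
Qed.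

Lemma clampE (i : 'I_n) : clamp raw i = i.
Proof.
rewrite /clamp size_raw; case: ltnP => // le; apply/eqP; rewrite eqn_leq le /=.
by rewrite -ltnS (leq_trans (ltn_ord i)) ?leqSpred.
Qed.

Lemma clamp_idem i : clamp raw (clamp raw i) = clamp raw i.
Proof.
by rewrite /clamp; case: (ltnP i) => [->|le] //; rewrite ltnn.
Qed.

Lemma scaled_dist_clamp i k : scaled_dist raw i k = scaled_dist raw (clamp raw i) (clamp raw k).
Proof. by rewrite /scaled_dist !clamp_idem. Qed.

Lemma scaled_distE (i k : 'I_n) :
  ((scaled_dist raw i k)%:R = dist i k * L%:R :> rat)%R.
Proof.
rewrite /scaled_dist !clampE (nth_map i) ?size_enum_ord // (nth_map i) ?size_enum_ord //.
rewrite !nth_ord_enum; apply: scaledE; first by case: (dist_metric I).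
rewrite mem_cat; apply/orP; right; apply/flattenP.
exists [seq frac (dist i k) | k <- enum 'I_n]; last by apply: map_f; rewrite mem_enum.
by apply: (map_f (fun i => [seq frac (dist i k) | k <- enum 'I_n])); rewrite mem_enum.
Qed.

Lemma scaled_dist_none i k : n = 0 -> scaled_dist raw i k = 0.
Proof.
move=> n0; rewrite /scaled_dist (_ : raw.2.2.2.2.1 = [::]).
  by rewrite !nth_nil /scaled mul0n div0n.
by apply: size0nil; rewrite size_map size_enum_ord.
Qed.

Lemma clamp_ord i : n != 0 -> exists o : 'I_n, clamp raw i = o.
Proof.
move=> n0; have lt : clamp raw i < n.
  rewrite /clamp size_raw; case: ifP => [lt|_]; last by rewrite ltn_predL lt0n.
  exact: leq_trans lt (leq_pred _).
by exists (Ordinal lt).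
Qed.

Lemma scaled_dist_triangle i k m :
  scaled_dist raw i m <= scaled_dist raw i k + scaled_dist raw k m.
Proof.
case: (eqVneq n 0) => [n0|n0]; first by rewrite !scaled_dist_none.
rewrite (scaled_dist_clamp i m) (scaled_dist_clamp i k) (scaled_dist_clamp k m).
have [[o1 ->] [o2 ->] [o3 ->]] := And3 (clamp_ord i n0) (clamp_ord k n0) (clamp_ord m n0).
rewrite -(ler_nat rat) natrD !scaled_distE -mulrDl ler_wpM2r ?ler0n //.
by case: (dist_metric I).
Qed.

Lemma scaled_dist_sym i k : scaled_dist raw i k = scaled_dist raw k i.
Proof.
case: (eqVneq n 0) => [n0|n0]; first by rewrite !scaled_dist_none.
rewrite (scaled_dist_clamp i) (scaled_dist_clamp k).
have [[o1 ->] [o2 ->]] := conj (clamp_ord i n0) (clamp_ord k n0).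
by apply/eqP; rewrite -(eqr_nat rat) !scaled_distE; case: (dist_metric I) => _ _ ->.
Qed.

Lemma scaled_dist0 i : scaled_dist raw i i = 0.
Proof.
case: (eqVneq n 0) => [n0|n0]; first by rewrite scaled_dist_none.
rewrite scaled_dist_clamp; have [o ->] := clamp_ord i n0.
apply/eqP; rewrite -(eqr_nat rat) scaled_distE; case: (dist_metric I) => _ d0 _ _.
by rewrite (proj2 (d0 o o) erefl) mul0r.
Qed.

(** Scaled distances are integers, so a client closer than 1 is at distance 0. Distinct points have
    positive distance, so this client is the facility's own point. *)
Lemma scaled_growth1 : {in facility_ids raw, forall i,
  growth (scaled_dist raw) (client_ids raw) i 1 <= 1}.
Proof.
move=> i; rewrite facility_idsE client_idsE => /idsP[o _ ->]; rewrite growthE.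
have near (k : nat) : k \in ids (clients I) -> 0 < 1 - scaled_dist raw (val o) k -> k = val o.
  move=> /idsP[p _ ->]; rewrite subn_gt0 ltnS leqn0 -(eqr_nat rat) scaled_distE mulf_eq0.
  rewrite (pnatr_eq0 _ L) (negbTE (lt0n_neq0 common_gt0)) orbF => /eqP; case: (dist_metric I) => _ d0 _ _.
  by move/d0 ->.
apply: sum_at_most_one; first exact: ids_uniq.
  by move=> k l kA lA Gk Gl; rewrite (near k) // (near l).
by move=> k _; apply: leq_subr.
Qed.


Lemma count_ids (A : {set 'I_n}) (p : pred nat) :
  count p (ids A) = #|[set i in A | p (val i)]|.
Proof.
rewrite count_map -size_filter cardE; apply: perm_size; apply: uniq_perm.
- exact: filter_uniq (enum_uniq _).
- exact: enum_uniq.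
- by move=> i; rewrite mem_filter !mem_enum !inE andbC.
Qed.

(** * A feasible solution as an integral one, for comparison *)

Section Transfer.
Variable s : solution I.
Hypothesis fs : feasible s.

Definition assigned (j : nat) : nat :=
  if insub j is Some o then val (assign s o) else 0.

Lemma assignedE (j : 'I_n) : assigned j = assign s j.
Proof. by rewrite /assigned valK. Qed.

Lemma opened_sub : {subset ids (opened s) <= facility_ids raw}.
Proof.
rewrite facility_idsE => _ /idsP[o oo ->]; rewrite mem_ids.
by case: fs => /subsetP sub _ _; apply: sub.
Qed.

Lemma assigned_opened : {in client_ids raw, forall j, assigned j \in ids (opened s)}.
Proof.
rewrite client_idsE => _ /idsP[o oD ->]; rewrite assignedE mem_ids.
by case: fs => _ open _; apply: open.
Qed.

Lemma assigned_parity : {in ids (opened s), forall i,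
  odd (count (fun j => assigned j == i) (client_ids raw)) = odd_id raw i}.
Proof.
move=> _ /idsP[o oo ->]; rewrite client_idsE count_ids odd_idE.
case: fs => _ _ <- //; congr (odd _); apply: eq_card => j.
by rewrite !inE assignedE.
Qed.

Lemma opt_costE :
  ((opt_cost (scaled_dist raw) (scaled_cost raw) (client_ids raw) (ids (opened s)) assigned)%:R
   = cost s * L%:R :> rat)%R.
Proof.
rewrite /opt_cost /cost client_idsE natrD !natr_sum !big_map !big_enum mulrDl !mulr_suml /=.
congr (_ + _)%R; apply: eq_bigr => i iA.
  by apply: scaled_costE; case: fs => /subsetP sub _ _; apply: sub.
by rewrite assignedE scaled_distE.
Qed.

Lemma raw_solve_spec :
  [/\ unzip1 (raw_solve raw) = client_ids raw,
      forall i, load (raw_solve raw) i = 0 \/ odd (load (raw_solve raw) i) = odd_id raw i,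
      forall i, 0 < load (raw_solve raw) i -> i \in facility_ids raw
    & connection (scaled_dist raw) (raw_solve raw)
      + \sum_(i <- facility_ids raw | 0 < load (raw_solve raw) i) scaled_cost raw i
      <= 322 * opt_cost (scaled_dist raw) (scaled_cost raw) (client_ids raw)
           (ids (opened s)) assigned].
Proof.
apply: solve_spec; first exact: scaled_dist_triangle.
- exact: scaled_dist_sym.
- exact: scaled_dist0.
- exact: scaled_growth1.
- by rewrite facility_idsE ids_uniq.
- by rewrite facility_idsE size_raw; apply/negP => /idsP[o _ e]; move: (ltn_ord o); rewrite -e ltnn.
- exact: ids_uniq.
- exact: opened_sub.
- exact: assigned_opened.
- exact: assigned_parity.
Qed.

End Transfer.

Definition raw_assign (j : nat) : nat :=
  nth 0 (unzip2 (raw_solve raw)) (index j (unzip1 (raw_solve raw))).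

(** On a feasible instance the default of [insubd] is never taken for a client, because its facility
    is a point of the instance; on other points the assignment does not matter. *)
Definition output : solution I :=
  @Solution I [set i : 'I_n | 0 < load (raw_solve raw) i]
    [ffun j : 'I_n => insubd j (raw_assign j)].

Section Output.
Hypothesis feasibleI : exists s : solution I, feasible s.

Lemma raw_solveE : raw_solve raw = [seq (val j, raw_assign (val j)) | j <- enum (clients I)].
Proof.
case: feasibleI => s /raw_solve_spec[az _ _ _].
rewrite {1}(@assignment_fun (raw_solve raw)) ?az ?client_idsE ?ids_uniq //.
by rewrite -map_comp; apply: eq_map => j; rewrite /raw_assign az client_idsE.
Qed.

Lemma load_raw i : load (raw_solve raw) i = count (fun j => raw_assign j == i) (ids (clients I)).
Proof. by rewrite raw_solveE /load !count_map. Qed.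

Lemma raw_assign_load (j : 'I_n) : j \in clients I -> 0 < load (raw_solve raw) (raw_assign j).
Proof.
move=> jD; rewrite load_raw -has_count; apply/hasP; exists (val j) => //.
by rewrite mem_ids.
Qed.

Lemma load_facility i : 0 < load (raw_solve raw) i -> exists2 o : 'I_n, o \in facilities I & i = o.
Proof.
case: feasibleI => s /raw_solve_spec[_ _ F _] /F; rewrite facility_idsE.
exact: idsP.
Qed.

Lemma outputE (j : 'I_n) : j \in clients I -> assign output j = raw_assign j :> nat.
Proof.
move=> jD; rewrite ffunE; have [o _ e] := load_facility (raw_assign_load jD).
by rewrite val_insubd e ltn_ord.
Qed.

Lemma output_feasible : feasible output.
Proof.
split.
- by apply/subsetP => i; rewrite inE => /load_facility[o oF /val_inj ->].
- by move=> j jD; rewrite inE outputE // raw_assign_load.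
- move=> i; rewrite inE => li; case: feasibleI => s /raw_solve_spec[_ /(_ i) par _ _].
  rewrite -odd_idE; case: par => [l0|<-]; first by rewrite l0 in li.
  rewrite load_raw count_ids; congr (odd _); apply: eq_card => j; rewrite !inE.
  by case: (boolP (j \in clients I)) => //= jD; rewrite -(outputE jD).
Qed.

Lemma enc_output : enc (raw_output raw) = enc_solution output.
Proof.
rewrite /enc /raw_output /enc_solution /enc_set /= point_idsE -!map_comp.
congr (Node (enc_seq _) (enc_seq _)); first by apply: eq_map => i /=; rewrite inE.
rewrite {1}raw_solveE -!map_comp; apply/eq_in_map => j; rewrite mem_enum => jD.
by rewrite /= outputE.
Qed.

Lemma cost_output (s : solution I) : feasible s -> (cost output <= 322%:R * cost s)%R.
Proof.
move=> fs; have L0 : (0 < L%:R :> rat)%R by rewrite ltr0n common_gt0.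
rewrite -(ler_pM2r L0) -mulrA -(opt_costE fs) -natrM.
case: (raw_solve_spec fs) => _ _ _; rewrite -(ler_nat rat); apply: le_trans.
rewrite natrD addrC /cost mulrDl !mulr_suml /connection raw_solveE big_map !natr_sum.
rewrite facility_idsE big_map !big_enum_cond /=.
rewrite le_eqVlt; apply/orP; left; apply/eqP; congr (_ + _)%R; apply: eq_big => i.
- rewrite inE raw_solveE; apply/idP/andP => [li|[_ //]]; split=> //.
  by move: li; rewrite -raw_solveE => /load_facility[o oF /val_inj ->].
- by rewrite inE => /load_facility[o oF /val_inj ->]; rewrite scaled_costE.
- by rewrite andbT.
- by move=> jD; rewrite -[raw_assign i]outputE // scaled_distE.
Qed.

End Output.
End Instance.

Theorem theorem2 :
  exists (alpha : rat) (P : program), approximation_algorithm alpha P.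
Proof.
(* Instances form an encoded type of their own, on which [raw] is the identity on trees. The
   function is total, so the program also halts on infeasible instances. *)
have [P [T [_ ev [k Tk] _]]] : polytime (X := EType enc_instance) (fun I : instance => raw_output (raw I)).
  apply: (polytime_comp polytime_raw_output).
  exact: (polytime_recode (X := EType enc_instance) enc_raw).
exists 322%:R%R, P; split.
  (* The encoded instance has size [m >= 1], so [m + k <= (k + 1) * m], which gives the required
     form of the bound. *)
  exists (k.+1 ^ k), k => I; exists (enc (raw_output (raw I))), (T I); split; first exact: ev.
  apply: leq_trans (Tk I) _; apply: leq_trans (leq_addr _ _); rewrite -expnMn.
  case: (posnP k) => [->|k0]; first exact: leqnn.
  by rewrite leq_exp2r // /sz mulSn leq_add2l leq_pmulr.
move=> I fI; exists (output I), (T I); split.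
- by rewrite -enc_output //; apply: ev.
- exact: output_feasible.
- by move=> s [fs _]; apply: cost_output.
Qed.
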